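(* Let $q$ be a power of an odd prime, $m\in\mathbb{F}_q[T]$ a monic square-free polynomial of degree $M\ge 3$, $m=m_1\cdots m_r$ its factorization into distinct monic irreducibles, $M_i=\deg m_i$. Assume that $\mathcal{L}(u,\chi_m)$ satisfies GSH. Put $$C_m=\frac{\prod_{i=1}^{r}(1-q^{-M_i})}{2^{M'}\prod_{j=1}^{M'}\sin^2\theta_j},$$ and let $d\phi$ be the normalized Haar measure on $\mathbb{T}^{M'}=(\mathbb{R}/2\pi\mathbb{Z})^{M'}$. Write $E=e_{\mathsf{even}}^{(M')}$ and $O=e_{\mathsf{odd}}^{(M')}$. With real numbers $\beta_j$, $\beta_j'$ ($1\le j\le M'$) as defined in the context, let $g(\mathbf{y})=\sum_{j=1}^{M'}\beta_j\sin(y_j)$ and $G(\mathbf{y})=\sum_{j=1}^{M'}\beta_j'\sin(y_j)$. Then the densities $\delta_+^{\lambda,\mathsf{nc}}(m)$ and $\delta_+^{\lambda}(m)$ exist and: 1. If $M$ is odd, $$\delta_+^{\lambda,\mathsf{nc}}(m)=\frac12+\frac12\,d\phi\bigl(\{\mathbf{y}\in\mathbb{T}^{M'}: C_mE>g(\mathbf{y})>-C_mO\}\bigr),$$ $$\delta_+^{\lambda}(m)=\frac12+\frac12\,d\phi\left(\left\{\mathbf{y}\in\mathbb{T}^{M'}: C_m\frac{qE+q^{1/2}O}{q-1}>G(\mathbf{y})>-C_m\frac{q^{1/2}E+qO}{q-1}\right\}\right),$$ and both are strictly greater than $\frac12$. 2. If $M$ is even, $$\delta_+^{\lambda,\mathsf{nc}}(m)=\frac12+\frac12\,d\phi\left(\left\{\mathbf{y}\in\mathbb{T}^{M'}: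 C_m\frac{qE+q^{1/2}O}{q-1}>g(\mathbf{y})>-C_m\frac{q^{1/2}E+qO}{q-1}\right\}\right),$$ $$\delta_+^{\lambda}(m)=\frac12+\frac12\,d\phi\left(\left\{\mathbf{y}\in\mathbb{T}^{M'}: C_m\frac{(q^2+q)E+2q^{3/2}O}{(q-1)^2}>G(\mathbf{y})>-C_m\frac{2q^{3/2}E+(q^2+q)O}{(q-1)^2}\right\}\right).$$
   Context: Let $A=\mathbb{F}_q[T]$, $|f|=q^{\deg f}$. $\lambda$ is the Liouville function: $\lambda(f)=(-1)^{e_1+\cdots+e_k}$ if $f$ is a unit times $g_1^{e_1}\cdots g_k^{e_k}$ with distinct monic irreducible $g_i$. $\chi_m(f)=\left(\frac fm\right)$ is the quadratic (Jacobi-symbol) character modulo $m$, equal to $0$ if $\gcd(f,m)\ne1$. For $n\ge 1$ let $a_\pm^\lambda(n;m)=\#\{f \text{ monic}:\deg f=n,\ \lambda(f)\chi_m(f)=\pm1\}$, $A^\lambda_\pm(n;m)=\sum_{k=1}^n a^\lambda_\pm(k;m)$, $b^\lambda(n;m)=a_+^\lambda(n;m)-a_-^\lambda(n;m)$. Densities: $$\delta_+^{\lambda,\mathsf{nc}}(m)=\lim_{n\to\infty}\frac{\#\{1\le k\le n: a_+^\lambda(k;m)>a_-^\lambda(k;m)\}}{n},\quad \delta_+^{\lambda}(m)=\lim_{n\to\infty}\frac{\#\{1\le k\le n: A_+^\lambda(k;m)>A_-^\lambda(k;m)\}}{n}.$$ $\mathcal{L}(u,\chi_m)=\sum_{f\text{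 monic}}\chi_m(f)u^{\deg f}$, a polynomial, is known to factor as $\prod_{j=1}^{M'}(1-\sqrt q e^{i\theta_j}u)(1-\sqrt q e^{-i\theta_j}u)$ with $M'=(M-1)/2$ if $M$ is odd, and as $(1-u)\prod_{j=1}^{M'}(1-\sqrt q e^{i\theta_j}u)(1-\sqrt q e^{-i\theta_j}u)$ with $M'=(M-2)/2$ if $M$ is even, where $\theta_j\in\mathbb{R}$. GSH for $\mathcal{L}(u,\chi_m)$ means that $\pi,\theta_1,\dots,\theta_{M'}$ are linearly independent over $\mathbb{Q}$. Let $e_k^{(M')}$ be the $k$-th elementary symmetric polynomial in $\cos\theta_1,\dots,\cos\theta_{M'}$ and $e_{\mathsf{even}}^{(M')}=e_0^{(M')}+e_2^{(M')}+\cdots$, $e_{\mathsf{odd}}^{(M')}=e_1^{(M')}+e_3^{(M')}+\cdots$. Under GSH there are real constants $\beta_j,\omega_j$ ($1\le j\le M'$), and a real constant $C$ when $M$ is even, independent of $n$, such that for all $n\ge 2M$: if $M$ is odd, $b^\lambda(n;m)=q^{n/2}\bigl(\alpha_n+\sum_{j}\beta_j\sin(n\theta_j+\omega_j)\bigr)$ with $\alpha_n=C_m e_{\mathsf{even}}^{(M')}$ for even $n$ and $\alpha_n=C_m e_{\mathsf{odd}}^{(M')}$ for odd $n$; if $M$ is even, $b^\lambda(n;m)=q^{n/2}\bigl(\alpha_n'+\sum_{j}\beta_j\sin(n\theta_j+\omega_j)\bigr)+C$ with $\alpha_n'=C_m\frac{q e_{\mathsf{even}}^{(M')}+q^{1/2}e_{\mathsf{odd}}^{(M')}}{q-1}$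 for even $n$ and $\alpha_n'=C_m\frac{q^{1/2} e_{\mathsf{even}}^{(M')}+q e_{\mathsf{odd}}^{(M')}}{q-1}$ for odd $n$. The $\beta_j$ in the claim are these constants (for the respective parity of $M$), and $$\beta_j'=\frac{\beta_j}{\sqrt{1-2q^{-1/2}\cos\theta_j+q^{-1}}}.$$ *)

(* Defs.v *)
From HB Require Import structures.
From mathcomp Require Import all_boot all_order all_algebra.
From mathcomp Require Import all_classical all_reals all_analysis.
From mathcomp Require Import complex.

Set Implicit Arguments.
Unset Strict Implicit.
Unset Printing Implicit Defensive.

Import Order.TTheory GRing.Theory Num.Theory.
Import numFieldNormedType.Exports.

Local Open Scope ring_scope.

Section Arithmetic.
Variable F : finFieldType.
Implicit Types f m P : {poly F}.

Definition squarefree f : Prop :=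
  forall g : {poly F}, (1 < size g)%N -> ~~ (g ^+ 2 %| f).

Definition monic_irr P : bool := (P \is monic) && irreducibleb P.

(* Exponent of P in f, for f != 0 and P of positive degree: P ^+ k %| f then
   forces k < size f. *)
Definition multiplicity P f : nat := \max_(k < size f | P ^+ k %| f) k.

(* A divisor of f != 0 has size at most size f, so the sum runs over all monic
   irreducible factors of f (the others contribute 0). *)
Definition Omega f : nat :=
  \sum_(P : {poly_(size f) F} | monic_irr P) multiplicity P f.

Definition liouville f : int := (-1) ^+ Omega f.

Definition legendre f P : int :=
  if P %| f then 0
  else if [exists g : {poly_(size P).-1 F}, P %| (val g) ^+ 2 - f] then 1
  else -1.

Definition chi m f : int :=
  \prod_(P : {poly_(size m) F} | monic_irr P) legendre f P ^+ multiplicity P m.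

Definition monic_deg (n : nat) : {set {poly_n.+1 F}} :=
  [set f : {poly_n.+1 F} | (val f \is monic) && (size (val f) == n.+1)].

Definition a_plus (n : nat) m : nat :=
  #|[set f in monic_deg n | liouville (val f) * chi m (val f) == 1]|.

Definition a_minus (n : nat) m : nat :=
  #|[set f in monic_deg n | liouville (val f) * chi m (val f) == -1]|.

Definition A_plus (n : nat) m : nat := \sum_(1 <= k < n.+1) a_plus k m.

Definition A_minus (n : nat) m : nat := \sum_(1 <= k < n.+1) a_minus k m.

Definition b_lambda (n : nat) m : int := (a_plus n m)%:Z - (a_minus n m)%:Z.

(* Coefficient of u ^ n in L(u, chi_m). *)
Definition Lcoef m (n : nat) : int := \sum_(f in monic_deg n) chi m (val f).

End Arithmetic.

Section Densities.
Variables (R : realType) (F : finFieldType) (m : {poly F}).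

Definition freq (E : nat -> bool) (n : nat) : R :=
  (\sum_(1 <= k < n.+1) E k)%:R / n%:R.

Definition density_seq_nc : nat -> R :=
  freq (fun k => a_minus k m < a_plus k m)%N.

Definition density_seq : nat -> R := freq (fun k => A_minus k m < A_plus k m)%N.

Definition delta_plus_nc : R := limn density_seq_nc.

Definition delta_plus : R := limn density_seq.

End Densities.

Definition Mprime (M : nat) : nat := if odd M then M.-1./2 else M.-2./2.

Section Zeros.
Variables (R : realType) (M : nat).
Implicit Types (theta beta omega : 'I_(Mprime M) -> R) (q C K : R).

Definition expi (t : R) : R[i] := Complex (cos t) (sin t).

Definition Lfactored q theta : {poly R[i]} :=
  (if odd M then 1 else 1 - 'X) *
  \prod_j ((1 - ((Num.sqrt q)%:C%C * expi (theta j)) *: 'X) *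
           (1 - ((Num.sqrt q)%:C%C * expi (- theta j)) *: 'X)).

(* Equality as power series in u. *)
Definition L_factors (F : finFieldType) (m : {poly F}) theta : Prop :=
  forall n : nat, (Lcoef m n)%:~R = (Lfactored #|F|%:R theta)`_n.

Definition GSH theta : Prop :=
  forall (c0 : rat) (c : 'I_(Mprime M) -> rat),
    ratr c0 * pi + \sum_j ratr (c j) * theta j = 0 ->
    c0 = 0 /\ forall j, c j = 0.

Definition esym_cos theta (k : nat) : R :=
  \sum_(S : {set 'I_(Mprime M)} | #|S| == k) \prod_(j in S) cos (theta j).

Definition e_even theta : R :=
  \sum_(k < (Mprime M).+1 | ~~ odd k) esym_cos theta k.

Definition e_odd theta : R :=
  \sum_(k < (Mprime M).+1 | odd k) esym_cos theta k.

Definition Cm (F : finFieldType) (r : nat) (p : 'I_r -> {poly F}) theta : R :=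
  (\prod_(i < r) (1 - (#|F|%:R ^+ (size (p i)).-1)^-1)) /
  (2 ^+ Mprime M * \prod_j sin (theta j) ^+ 2).

(* alpha_n for odd M, alpha'_n for even M. *)
Definition alpha q C theta (n : nat) : R :=
  let E := e_even theta in
  let O := e_odd theta in
  if odd M then (if odd n then C * O else C * E)
  else if odd n then C * ((Num.sqrt q * E + q * O) / (q - 1))
  else C * ((q * E + Num.sqrt q * O) / (q - 1)).

(* q ^ (n / 2) is (sqrt q) ^ n; the additive constant K occurs for even M only. *)
Definition b_expansion (F : finFieldType) (m : {poly F}) C theta beta omega K
    : Prop :=
  let q : R := #|F|%:R in
  forall n : nat, (2 * M <= n)%N ->
    (b_lambda n m)%:~R =
    Num.sqrt q ^+ n *
      (alpha q C theta n + \sum_j beta j * sin (n%:R * theta j + omega j))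
    + (if odd M then 0 else K).

Definition beta' q theta beta (j : 'I_(Mprime M)) : R :=
  beta j / Num.sqrt (1 - 2 * (Num.sqrt q)^-1 * cos (theta j) + q^-1).

End Zeros.

Section Torus.
Variable R : realType.

Lemma twopi_gt0 : (0 : R) < 2 * pi.
Proof. by rewrite mulr_gt0 ?pi_gt0. Qed.

Definition circle_haar : probability (measurableTypeR R) R :=
  uniform_prob twopi_gt0.

Definition cons_pair (d : nat)
    (z : measurableTypeR R * d.-tuple (measurableTypeR R)) :
    d.+1.-tuple (measurableTypeR R) :=
  [tuple of z.1 :: z.2].

Lemma measurable_cons_pair (d : nat) :
  measurable_fun [set: measurableTypeR R * d.-tuple (measurableTypeR R)]
    (@cons_pair d).
Proof. exact: measurable_cons. Qed.

HB.instance Definition _ (d : nat) :=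
  isMeasurableFun.Build _ _ _ _ (@cons_pair d) (@measurable_cons_pair d).

(* Normalized Haar measure on (R / 2 pi Z) ^ d, with every coordinate
   represented in [0, 2 pi] (the two endpoints form a null set): the d-fold
   product of the uniform probability on [0, 2 pi]. *)
Fixpoint torus_haar (d : nat) : probability (d.-tuple (measurableTypeR R)) R :=
  if d is d'.+1 then
    distribution (circle_haar \x torus_haar d')%E (@cons_pair d')
  else dirac [tuple].

Lemma torus_haar_box (d : nat) (A : 'I_d -> set (measurableTypeR R)) :
  (forall j, measurable (A j)) ->
  torus_haar d [set y | forall j, A j (tnth y j)]%classic =
  (\prod_j circle_haar (A j))%E.
Proof.
elim: d A => [|d IHd] A mA.
  by rewrite big_ord0 /= diracE mem_set//= => -[].
rewrite big_ord_recl -IHd => [|j]; last exact: mA.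
rewrite /distribution /pushforward /= -product_measure1E//=.
  congr (product_measure1 _ _ _); apply/seteqP; split => -[x y] /=.
    move=> Axy; split=> /=; first by have := Axy ord0; rewrite (tnth_nth x).
    by move=> j; have := Axy (lift ord0 j); rewrite !(tnth_nth x).
  move=> [/= Ax Ay] j; case: (unliftP ord0 j) => [k ->|->].
    by have := Ay k; rewrite !(tnth_nth x).
  by rewrite (tnth_nth x).
rewrite (_ : [set _ | _]%classic =
  \bigcap_(j in [set: 'I_d]) ((@tnth _ _ ^~ j) @^-1` A (lift ord0 j)))%classic.
  apply: fin_bigcap_measurable => // j _.
  by rewrite -[X in measurable X]setTI; exact: measurable_tnth.
by apply/seteqP; split => y /= Ay j => [_|]; exact: Ay.
Qed.

Definition sine_sum (d : nat) (beta : 'I_d -> R)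
    (y : d.-tuple (measurableTypeR R)) : R :=
  \sum_j beta j * sin (tnth y j).

(* Haar measure of the set of y with lo < sine_sum beta y < hi, a condition
   that is 2 pi-periodic in each coordinate. *)
Definition haar_between (d : nat) (beta : 'I_d -> R) (lo hi : R) : R :=
  fine (torus_haar d [set y | lo < sine_sum beta y < hi]%classic).

End Torus.

(* Main.v *)
Require Import Defs.
From HB Require Import structures.
From mathcomp Require Import all_boot all_order all_algebra.
From mathcomp Require Import all_classical all_reals all_analysis.
From mathcomp Require Import complex.
From mathcomp Require Import measurable_realfun fingroup cyclic qfpoly ring lra zify.
Import Order.TTheory GRing.Theory Num.Theory.
Import numFieldNormedType.Exports ComplexField.Normc.
Local Open Scope ring_scope.

Set Implicit Arguments.
Unset Strict Implicit.

(* Since lambda * 1 is the indicator of the squares, the Dirichlet convolution of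
   lambda chi_m with chi_m counts the squares prime to m, so that
     (1 - q u^2) L(u, chi_m) * sum_n b(n) u^n = prod_i (1 - u^(2 M_i)).
   Under GSH the inverse zeros of (1 - q u^2) L(u, chi_m) are distinct, and
   partial fractions give the expansion of b(n): +-sqrt q contribute alpha_n, the
   zeros of L the sines, the trivial zero the constant K.  By uniqueness of such
   expansions, the amplitudes beta_j are determined by the residues, hence nonzero.
   Summing over n multiplies each mode by 1 / (1 - 1 / zero), which turns beta_j
   into beta'_j.  Hence both sign conditions read -a_(n mod 2) < X_n up to o(1),
   where X_n is a sine sum along an orbit of the rotation by theta.  GSH also makes
   this orbit equidistributed along n of a given parity; as the level sets of the
   sine sum are null, half of the n have sign condition of density P(g > -a_even),
   the other half P(g > -a_odd).  The law of g is symmetric, which yields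
   1/2 + 1/2 P(-a_odd < g < a_even).  This exceeds 1/2 as soon as
   -a_odd < sum_j |beta_j|, which follows from the vanishing of the coefficient of
   index -1 of the generating series together with bounds on the residues. *)

(** * The generating function of [b_lambda] *)

(** Why [- a_odd] stays below the total amplitude: in the partial fractions of the reciprocal of (1
    - q u^2) L(u, chi_m), the residues divided by their inverse zeros add up to 0, so that minus the
    odd coefficient is bounded by the moduli of the oscillating residues. The Euler numerator
    multiplies the residues at +-sqrt q by exactly P = prod_i (1 - q^(-M_i)), but those at sqrt q
    e^(+-i theta_j) by numbers of modulus strictly greater than P, because 2 M_i theta_j is not a
    multiple of 2 pi. This makes the inequality strict. Summation over n adds a factor 1 - u to the
    denominator, exactly as an even M does; a boolean [e] that records this factor lets one
    computation serve both purposes.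

    The densities require equidistribution for the discontinuous indicator of g > c. It is squeezed
    between explicit polynomials in g, which are trigonometric polynomials on the torus, so that
    only means of cosines along arithmetic progressions have to be computed. *)

Section Monics.
Variable F : finFieldType.
Implicit Types (f g d P : {poly F}) (n : nat).

(** Lists in [{poly F}] rather than sets in [{poly_n.+1 F}]: sums over different degrees then range
    over one type and can be compared by permutation. *)
Definition monics n : seq {poly F} :=
  [seq (val f : {poly F}) | f : {poly_n.+1 F} <- enum (monic_deg F n)].

Definition monics_le n : seq {poly F} :=
  [seq (val f : {poly F}) | f : {poly_n.+1 F} <-
    enum [set f : {poly_n.+1 F} | val f \is monic]].

Lemma monics_uniq n : uniq (monics n).
Proof. by rewrite map_inj_uniq ?enum_uniq //; exact: val_inj. Qed.

Lemma monics_le_uniq n : uniq (monics_le n).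
Proof. by rewrite map_inj_uniq ?enum_uniq //; exact: val_inj. Qed.

Lemma mem_monics n f : (f \in monics n) = (f \is monic) && (size f == n.+1).
Proof.
apply/mapP/andP => [[g]|[mf /eqP sf]].
  by rewrite mem_enum inE => /andP[mg sg] ->.
have sf' : f \is a poly_of_size n.+1 by rewrite qualifE /= sf.
by exists (NPoly sf') => //; rewrite mem_enum inE /= mf sf eqxx.
Qed.

Lemma mem_monics_le n f :
  (f \in monics_le n) = (f \is monic) && (size f <= n.+1)%N.
Proof.
apply/mapP/andP => [[g]|[mf sf]].
  by rewrite mem_enum inE => mg ->; split => //; exact: size_npoly.
have sf' : f \is a poly_of_size n.+1 by rewrite qualifE /= sf.
by exists (NPoly sf') => //; rewrite mem_enum inE /= mf.
Qed.

(** Subtracting ['X^n] gives a bijection onto the polynomials of size at most [n]. *)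
Lemma size_monics n : size (monics n) = (#|F| ^ n)%N.
Proof.
rewrite -card_npoly -[RHS](size_image (fun g : {poly_n F} => 'X^n + val g)).
apply: perm_size; apply: uniq_perm; first exact: monics_uniq.
  by rewrite map_inj_uniq ?enum_uniq // => g h /addrI; exact: val_inj.
move=> f; rewrite mem_monics; apply/andP/mapP => [[mf /eqP sf]|[g _ ->]].
  have sg : f - 'X^n \is a poly_of_size n.
    rewrite qualifE /=; apply/leq_sizeP => j; rewrite leq_eqVlt coefB coefXn.
    case/predU1P => [<-|nj]; last by rewrite nth_default ?sf // gtn_eqF // subr0.
    by rewrite eqxx; move: mf; rewrite monicE lead_coefE sf /= => /eqP ->; rewrite subrr.
  by exists (NPoly sg); rewrite ?mem_enum //= addrC subrK.
have sg : (size (val g) < size ('X^n : {poly F}))%N by rewrite size_polyXn ltnS size_npoly.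
by rewrite monicE lead_coefDl // lead_coefXn eqxx size_polyDl // size_polyXn.
Qed.

Lemma big_monics_le (V : nmodType) n (H : {poly F} -> V) :
  \sum_(f <- monics_le n) H f = \sum_(k < n.+1) \sum_(f <- monics k) H f.
Proof.
rewrite (partition_big (fun f => inord (size f).-1 : 'I_n.+1) xpredT) //=.
apply: eq_bigr => k _; rewrite -big_filter; apply: perm_big.
apply: uniq_perm; rewrite ?filter_uniq ?monics_le_uniq ?monics_uniq // => f.
rewrite mem_filter mem_monics mem_monics_le -val_eqE /=.
case mf : (f \is monic); rewrite ?andbF //=.
have := monic_neq0 mf; rewrite -size_poly_gt0.
case: (size f) => // s _; have := ltn_ord k.
have [sn|sn] := leqP s.+1 n.+1; last by rewrite andbF; lia.
by rewrite inordK //= andbT eqSS.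
Qed.

Definition monic_dvd f : seq {poly F} := [seq d <- monics_le (size f) | d %| f].

Lemma monic_dvd_uniq f : uniq (monic_dvd f).
Proof. by rewrite filter_uniq ?monics_le_uniq. Qed.

Lemma mem_monic_dvd f d : f != 0 -> (d \in monic_dvd f) = (d \is monic) && (d %| f).
Proof.
move=> f0; rewrite mem_filter mem_monics_le andbC -andbA.
case df: (d %| f); rewrite ?andbF // (leq_trans (dvdp_leq f0 df)) //; exact: leqnSn.
Qed.

Lemma sum_monic_dvd (V : nmodType) f N (H : {poly F} -> V) :
  f != 0 -> (size f <= N.+1)%N ->
  \sum_(d <- monic_dvd f) H d = \sum_(d <- monics_le N | d %| f) H d.
Proof.
move=> f0 sf; rewrite -[RHS]big_filter; apply: perm_big; apply: uniq_perm.
- exact: monic_dvd_uniq.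
- by rewrite filter_uniq ?monics_le_uniq.
move=> d; rewrite mem_monic_dvd // mem_filter mem_monics_le andbC.
by case df: (d %| f); rewrite //= (leq_trans (dvdp_leq f0 df)) // andbT.
Qed.

Lemma perm_monics_mul n d : d \is monic -> (size d <= n.+1)%N ->
  perm_eq [seq f <- monics n | d %| f] [seq d * g | g <- monics (n - (size d).-1)].
Proof.
move=> md sd; have d0 := monic_neq0 md; have sd0 : (0 < size d)%N by rewrite size_poly_gt0.
apply: uniq_perm; first by rewrite filter_uniq ?monics_uniq.
  by rewrite map_inj_uniq ?monics_uniq // => g h; exact: mulfI.
move=> f; rewrite mem_filter mem_monics; apply/and3P/mapP => [[]|].
  move=> /dvdpP[g ->]; rewrite mulrC monicMl // => mg /eqP sf; exists g; last by rewrite mulrC.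
  rewrite mem_monics mg; move: sf; rewrite size_Mmonic ?monic_neq0 //.
  have := monic_neq0 mg; rewrite -size_poly_gt0; lia.
case=> g; rewrite mem_monics => /andP[mg /eqP sg] ->.
rewrite dvdp_mulr // monicMl // mg size_Mmonic ?monic_neq0 // sg.
split=> //; apply/eqP; lia.
Qed.

(** After exchanging the two sums, [d] is fixed and the multiples of [d] are parametrized by their
    cofactor, of degree [n] minus that of [d]. *)
Lemma dirichlet_convolution (V : nmodType) n (H : {poly F} -> {poly F} -> V) :
  \sum_(f <- monics n) \sum_(d <- monic_dvd f) H d (f %/ d) =
  \sum_(k < n.+1) \sum_(d <- monics k) \sum_(g <- monics (n - k)) H d g.
Proof.
transitivity (\sum_(f <- monics n) \sum_(d <- monics_le n | d %| f) H d (f %/ d)).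
  apply: eq_big_seq => f; rewrite mem_monics => /andP[mf /eqP sf].
  by apply: sum_monic_dvd; rewrite ?monic_neq0 ?sf.
transitivity (\sum_(k < n.+1) \sum_(d <- monics k)
    \sum_(g <- monics (n - (size d).-1)) H d g); last first.
  apply: eq_bigr => k _; apply: eq_big_seq => d.
  by rewrite mem_monics => /andP[_ /eqP ->].
rewrite -(big_monics_le _ (fun d => \sum_(g <- monics (n - (size d).-1)) H d g)).
rewrite (exchange_big_dep xpredT) //=.
apply: eq_big_seq => d; rewrite mem_monics_le => /andP[md sd].
rewrite -big_filter (perm_big _ (perm_monics_mul md sd)) big_map.
by apply: eq_bigr => g _; rewrite mulrC mulpK // monic_neq0.
Qed.

End Monics.

(** * Divisor sums of the Liouville function *)

Section Liouville.
Variable F : finFieldType.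
Implicit Types (f g d P Q : {poly F}) (n : nat).

Lemma monic_irrP P : reflect (P \is monic /\ irreducible_poly P) (monic_irr P).
Proof. by apply: (iffP andP) => -[mP iP]; split => //; apply/irreducibleP. Qed.

Lemma monic_irr_size P : monic_irr P -> (1 < size P)%N.
Proof. by case/monic_irrP => _ []. Qed.

Lemma irreducible_dvdp_mul P f g :
  irreducible_poly P -> (P %| f * g) = (P %| f) || (P %| g).
Proof.
move=> iP; apply/idP/orP => [|[]]; last 2 first.
- exact: dvdp_mulr.
- exact: dvdp_mull.
have [Pf|nPf] := boolP (P %| f); first by left.
by rewrite Gauss_dvdpr ?irreducible_poly_coprime //; right.
Qed.

Lemma monic_irr_dvdp_eq P Q : monic_irr P -> monic_irr Q -> (P %| Q) = (P == Q).
Proof.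
move=> /monic_irrP[mP iP] /monic_irrP[mQ iQ]; apply/idP/eqP => [PQ|->]; last exact: dvdpp.
have := iQ.2 P _ PQ; rewrite eqp_monic // => eqPQ; apply/eqP/eqPQ.
by have := iP.1; case: (size P) => // -[].
Qed.

Lemma exists_monic_irr f : (1 < size f)%N -> exists2 P, monic_irr P & P %| f.
Proof.
have [n] := ubnP (size f); elim: n f => // n IHn f sf f1.
have f0 : f != 0 by rewrite -size_poly_gt0; lia.
have [/irreducibleP if'|] := boolP (irreducibleb f).
  exists ((lead_coef f)^-1 *: f); last by rewrite dvdpZl ?dvdpp // invr_eq0 lead_coef_eq0.
  apply/monic_irrP; split; first by rewrite monicE lead_coefZ mulVf ?lead_coef_eq0.
  have eqf : (lead_coef f)^-1 *: f %= f by rewrite eqp_scale // invr_eq0 lead_coef_eq0.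
  split; first by rewrite (eqp_size eqf).
  move=> q sq; rewrite (eqp_dvdr _ eqf) => /(if'.2 _ sq) qf.
  by rewrite (eqp_trans qf) // eqp_sym.
rewrite /irreducibleb f1 /= negb_forall => /existsP[q].
rewrite negb_imply -ltnNge -Pdiv.Idomain.dvdpE => /andP[qf q1].
have [|//|P hP Pq] := IHn (val q).
  apply: leq_ltn_trans (size_npoly q) _.
  by move: sf f1; case: (size f) => // s _; rewrite ltnS.
by exists P => //; exact: dvdp_trans qf.
Qed.

Lemma size_exp_leq P k f :
  (1 < size P)%N -> f != 0 -> P ^+ k %| f -> (k < size f)%N.
Proof.
move=> P1 f0 /(dvdp_leq f0); apply: leq_trans.
have := size_exp P k; have : P ^+ k != 0 by rewrite expf_neq0 // -size_poly_gt0 (ltn_trans _ P1).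
rewrite -size_poly_gt0 => + e; have : (k <= (size P).-1 * k)%N by rewrite leq_pmull // -ltnS prednK // (ltn_trans _ P1).
by rewrite -e; case: (size (P ^+ k)).
Qed.

(** The maximum that defines [multiplicity] is taken over [k < size f]; by [size_exp_leq] this bound
    misses no power of [P] dividing [f]. *)
Lemma multiplicityP P f k : (1 < size P)%N -> f != 0 ->
  reflect (P ^+ k %| f /\ ~~ (P ^+ k.+1 %| f)) (multiplicity P f == k).
Proof.
move=> P1 f0; have mono i j : (i <= j)%N -> P ^+ j %| f -> P ^+ i %| f.
  by move=> ij; apply: dvdp_trans; rewrite dvdp_exp2l.
apply: (iffP eqP) => [<-|[Pk nPk]].
  have f1 : (0 < size f)%N by rewrite size_poly_gt0.
  have Pm : P ^+ multiplicity P f %| f.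
    rewrite /multiplicity; apply: (big_ind (fun i => P ^+ i %| f)) => [|i j Pi Pj|//].
      by rewrite expr0 dvd1p.
    by rewrite /maxn; case: ltnP.
  split => //; apply/negP => Pm1; have km := size_exp_leq P1 f0 Pm1.
  have := leq_bigmax_cond (P := fun i : 'I_(size f) => P ^+ i %| f) (F := fun i : 'I_(size f) => i : nat) (Ordinal km) Pm1.
  by rewrite ltnn.
apply/eqP; rewrite eqn_leq; apply/andP; split.
  apply/bigmax_leqP => i Pi; rewrite leqNgt; apply/negP => ki.
  by rewrite (mono _ _ ki Pi) in nPk.
have kf := size_exp_leq P1 f0 Pk.
exact: (leq_bigmax_cond (P := fun i : 'I_(size f) => P ^+ i %| f) (F := fun i : 'I_(size f) => i : nat) (Ordinal kf) Pk).
Qed.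

Lemma multiplicity_mul_irr P Q d : monic_irr P -> monic_irr Q -> d != 0 ->
  multiplicity Q (P * d) = (multiplicity Q d + (Q == P))%N.
Proof.
move=> hP hQ d0; have P0 : P != 0 by case/monic_irrP: hP => /monic_neq0.
have Q1 := monic_irr_size hQ; have Pd0 : P * d != 0 by rewrite mulf_neq0.
have /(multiplicityP _ Q1 d0)[Qm nQm] := eqxx (multiplicity Q d).
apply/eqP/(multiplicityP _ Q1 Pd0); have [QP|QP] := eqVneq Q P.
  by move: Qm nQm; rewrite QP addn1 !exprS !dvdp_mul2l // -!exprS.
rewrite addn0.
have cop k : coprimep (Q ^+ k) P.
  case: k => [|k]; first by rewrite expr0 coprime1p.
  by rewrite coprimep_pexpl // irreducible_poly_coprime ?monic_irr_dvdp_eq //; case/monic_irrP: hQ.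
by rewrite !Gauss_dvdpr.
Qed.

(** The index set of [Omega f] depends on [f]. A common larger one is needed to compare
    [Omega (P * d)] with [Omega d] term by term; the added primes are too large to divide [f]. *)
Lemma Omega_wide f N : f != 0 -> (size f <= N.+1)%N ->
  Omega f = \sum_(P <- monics_le F N | monic_irr P) multiplicity P f.
Proof.
move=> f0 sf.
have [s Es] : exists s : seq {poly F}, s = [seq (val P : {poly F}) | P : {poly_(size f) F} <- enum {poly_(size f) F}] by eexists.
transitivity (\sum_(P <- s | monic_irr P) multiplicity P f).
  by rewrite Es big_map big_enum_cond.
rewrite [RHS](bigID (fun P => size P <= size f)%N) /= [X in _ + X]big1 ?addr0; last first.
  move=> P /andP[hP]; rewrite -ltnNge => sP.
  apply/eqP/multiplicityP; rewrite ?monic_irr_size // expr0 expr1 dvd1p.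
  by split => //; apply: contraL sP => /(dvdp_leq f0); rewrite leqNgt.
rewrite -[LHS]big_filter -[RHS]big_filter; apply: perm_big; apply: uniq_perm.
- by rewrite filter_uniq // Es map_inj_uniq ?enum_uniq //; exact: val_inj.
- by rewrite filter_uniq // monics_le_uniq.
move=> P; rewrite !mem_filter mem_monics_le.
have [hP|] //= := boolP (monic_irr P).
have [-> _] := monic_irrP _ hP; rewrite Es /=; apply/mapP/andP => [[g _ ->]|[sP _]].
  by rewrite size_npoly; split => //; exact: leq_trans (size_npoly _) sf.
have sP' : P \is a poly_of_size (size f) by rewrite qualifE.
by exists (NPoly sP'); rewrite ?mem_enum.
Qed.

Lemma Omega_mul_irr P d : monic_irr P -> d != 0 -> Omega (P * d) = (Omega d).+1.
Proof.
move=> hP d0; have P0 : P != 0 by case/monic_irrP: hP => /monic_neq0.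
have mP : P \is monic by case/monic_irrP: hP.
rewrite (@Omega_wide _ (size (P * d))) ?mulf_neq0 // (@Omega_wide d (size (P * d))) //; last first.
  by rewrite leqW // dvdp_leq ?mulf_neq0 // dvdp_mull.
transitivity (\sum_(Q <- monics_le F (size (P * d)) | monic_irr Q)
    (multiplicity Q d + (Q == P))%N).
  by apply: eq_bigr => Q hQ; exact: multiplicity_mul_irr.
rewrite big_split /= -addn1; congr addn.
rewrite -big_filter (bigD1_seq P) ?filter_uniq ?monics_le_uniq //=.
  by rewrite eqxx big1 // => Q /negbTE ->.
by rewrite mem_filter hP mem_monics_le mP /= leqW // dvdp_leq ?mulf_neq0 // dvdp_mulr.
Qed.

Lemma liouville_mul_irr P d : monic_irr P -> d != 0 ->
  liouville (P * d) = - liouville d.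
Proof. by move=> hP d0; rewrite /liouville Omega_mul_irr // exprS mulN1r. Qed.

Lemma liouville1 : liouville (1 : {poly F}) = 1.
Proof.
rewrite /liouville /Omega big1 // => P hP; apply/eqP/multiplicityP; rewrite ?oner_eq0 ?monic_irr_size //.
rewrite expr0 expr1 dvdpp; split => //; rewrite dvdp1.
by have := monic_irr_size hP; case: (size _) => [|[]].
Qed.

(** A boolean search: a square root of a monic polynomial can be rescaled to a monic one, whose size
    is at most that of [f]. *)
Definition is_square f := has (fun g => g ^+ 2 == f) (monics_le F (size f)).

Lemma is_squareP f : f \is monic -> reflect (exists g, f = g ^+ 2) (is_square f).
Proof.
move=> mf; apply: (iffP hasP) => [[g _ /eqP <-]|[g fg]]; first by exists g.
have g0 : g != 0 by apply: contraTneq mf => g0; rewrite fg g0 expr0n monicE lead_coef0 eq_sym oner_eq0.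
have lg : lead_coef g ^+ 2 = 1 by apply/eqP; rewrite -lead_coef_exp -fg -monicE.
exists ((lead_coef g)^-1 *: g); last by rewrite exprZn exprVn lg invr1 scale1r fg.
rewrite mem_monics_le monicE lead_coefZ mulVf ?lead_coef_eq0 //= eqxx /=.
rewrite size_scale ?invr_eq0 ?lead_coef_eq0 // fg expr2 size_mul //.
have : (0 < size g)%N by rewrite size_poly_gt0.
lia.
Qed.

Lemma is_square1 : is_square 1.
Proof. by apply/is_squareP; [exact: monic1|exists 1; rewrite expr1n]. Qed.

Lemma is_square_mulX2 P f : monic_irr P -> f \is monic ->
  is_square (P ^+ 2 * f) = is_square f.
Proof.
move=> hP mf; have [mP iP] := monic_irrP _ hP.
apply/is_squareP/is_squareP; rewrite ?monicMl ?monic_exp // => -[g].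
  move=> Pf; have : P %| g ^+ 2 by rewrite -Pf expr2 -mulrA dvdp_mulr.
  rewrite expr2 irreducible_dvdp_mul // orbb => /dvdpP[h gh]; exists h.
  apply: (mulfI (expf_neq0 2 (monic_neq0 mP))); rewrite Pf gh; ring.
by move=> ->; exists (P * g); rewrite exprMn.
Qed.

Lemma is_square_mul P f : monic_irr P -> f \is monic -> ~~ (P %| f) -> ~~ is_square (P * f).
Proof.
move=> hP mf nPf; have [mP iP] := monic_irrP _ hP.
apply/negP => /is_squareP [|g fg]; first by rewrite monicMl.
have : P %| g ^+ 2 by rewrite -fg dvdp_mulr.
rewrite expr2 irreducible_dvdp_mul // orbb => /dvdpP[h gh].
move/negP: nPf; apply; apply/dvdpP; exists (h ^+ 2).
by apply: (mulfI (monic_neq0 mP)); rewrite fg gh; ring.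
Qed.

(** The divisors of [P * f] prime to [P] are those of [f]; the others are [P * d] with [d] dividing
    [f], and the extra factor flips the sign. *)
Lemma sum_liouville_split P f : monic_irr P -> f \is monic ->
  \sum_(d <- monic_dvd (P * f)) liouville d =
  \sum_(d <- monic_dvd f | ~~ (P %| d)) liouville d
   - \sum_(d <- monic_dvd f) liouville d.
Proof.
move=> hP mf; have [mP iP] := monic_irrP _ hP.
have f0 := monic_neq0 mf; have P0 := monic_neq0 mP.
have Pf0 : P * f != 0 by rewrite mulf_neq0.
rewrite (bigID (fun d => P %| d)) /= addrC; congr (_ + _).
  rewrite -[LHS]big_filter -[RHS]big_filter; apply: perm_big; apply: uniq_perm; try (apply: filter_uniq; exact: monic_dvd_uniq); move=> d.
  rewrite mem_filter [in RHS]mem_filter (mem_monic_dvd d f0) (mem_monic_dvd d Pf0); have [//|nPd] /= := boolP (P %| d).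
  have [md|] //= := boolP (d \is monic); rewrite Gauss_dvdpr // coprimep_sym.
  by rewrite irreducible_poly_coprime.
rewrite -big_filter (perm_big [seq P * d | d <- monic_dvd f]).
  rewrite big_map -sumrN; apply: eq_big_seq => d; rewrite mem_monic_dvd // => /andP[md _].
  by rewrite liouville_mul_irr ?monic_neq0.
apply: uniq_perm.
- by apply: filter_uniq; exact: monic_dvd_uniq.
- by rewrite map_inj_uniq ?monic_dvd_uniq // => g h; exact: mulfI.
move=> d; rewrite mem_filter mem_monic_dvd //; apply/and3P/mapP => [[/dvdpP[e ->]]|[e]].
  rewrite monicMr // mulrC dvdp_mul2l // => me ef.
  by exists e => //; rewrite mem_monic_dvd // me.
by rewrite mem_monic_dvd // => /andP[me ef] ->; rewrite dvdp_mulr // monicMl // dvdp_mul2l.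
Qed.

(** Induction on the size, with [f = P * g]. If [P] does not divide [g], the two sums of
    [sum_liouville_split] cancel and [f] is not a square. If [g = P * h], a second splitting leaves
    the divisor sum of [h], and [f = P ^+ 2 * h] is a square exactly when [h] is. *)
Lemma sum_liouville f : f \is monic ->
  \sum_(d <- monic_dvd f) liouville d = (is_square f)%:Z.
Proof.
have [n] := ubnP (size f); elim: n f => // n IHn f sf mf.
have f0 := monic_neq0 mf.
have [f1|f1] := leqP (size f) 1.
  have -> : f = 1.
    have sf1 : size f = 1%N by apply/eqP; rewrite eqn_leq f1 size_poly_gt0.
    have /size_poly1P[c c0 fc] : size f == 1%N by rewrite sf1.
    move: mf; rewrite fc monicE lead_coefC => /eqP ->.
    by [].
  rewrite is_square1 (perm_big [:: 1]) ?big_seq1 ?liouville1 //.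
  apply: uniq_perm; rewrite ?monic_dvd_uniq // => d.
  rewrite mem_monic_dvd ?oner_eq0 // inE dvdp1; apply/andP/eqP => [[md /size_poly1P[c c0 dc]]|->].
    by move: md; rewrite dc monicE lead_coefC => /eqP ->.
  by rewrite monic1 size_poly1.
have [P hP /dvdpP[g fg]] := exists_monic_irr f1; have [mP iP] := monic_irrP _ hP.
rewrite mulrC in fg; have mg : g \is monic by move: mf; rewrite fg monicMl.
have P1 := monic_irr_size hP.
have sfg : size f = (size P + size g).-1 by rewrite fg size_mul ?monic_neq0.
rewrite fg sum_liouville_split //.
have [Pg|nPg] := boolP (P %| g); last first.
  rewrite (negbTE (is_square_mul hP mg nPg)) big_seq_cond [X in _ - X]big_seq.
  rewrite (eq_bigl (fun d => d \in monic_dvd g)) ?subrr // => d.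
  rewrite (mem_monic_dvd d (monic_neq0 mg)); case dg: (d %| g); rewrite ?andbF //.
  have nPd : ~~ (P %| d) by apply: contra nPg => Pd; exact: dvdp_trans dg.
  by rewrite nPd andbT.
have [h gh] := dvdpP _ _ Pg; rewrite mulrC in gh.
have mh : h \is monic by move: mg; rewrite gh monicMl.
have sgh : size g = (size P + size h).-1 by rewrite gh size_mul ?monic_neq0.
rewrite [in X in _ - X]gh sum_liouville_split //.
rewrite [in RHS]gh mulrA -expr2 is_square_mulX2 // -IHn //; last first.
  by move: sf P1; rewrite sfg sgh; case: (size P) => [//|[//|a]]; move: (size _) => b; lia.
have -> : \sum_(d <- monic_dvd g | ~~ (P %| d)) liouville d =
          \sum_(d <- monic_dvd h | ~~ (P %| d)) liouville d.
  rewrite -[LHS]big_filter -[RHS]big_filter; apply: perm_big; apply: uniq_perm; try (apply: filter_uniq; exact: monic_dvd_uniq); move=> d.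
  rewrite mem_filter [in RHS]mem_filter (mem_monic_dvd d (monic_neq0 mg)) (mem_monic_dvd d (monic_neq0 mh)); have [//|nPd] /= := boolP (P %| d).
  have [md|] //= := boolP (d \is monic); rewrite gh Gauss_dvdpr // coprimep_sym.
  by rewrite irreducible_poly_coprime.
by rewrite opprB addrC addrNK.
Qed.

End Liouville.

(** * Quadratic characters and the convolution of [b_lambda] with the L-function *)

Lemma finField_generator (K : finFieldType) :
  exists z : K, forall x, x != 0 -> exists i, x = z ^+ i.
Proof.
have /cyclicP[z zP] := field_unit_group_cyclic [set: {unit K}]%G.
exists (FinRing.uval z) => x x0.
have ux : x \is a GRing.unit by rewrite unitfE.
have : FinRing.Unit ux \in fingroup.cycle z by rewrite -zP inE.
by case/fingroup.cycleP => i Ei; exists i; rewrite -FinRing.val_unitX -Ei.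
Qed.

Section Character.
Variable F : finFieldType.
Implicit Types (f g d P Q m : {poly F}) (n : nat).

(** The residue field at [P] and the reduction map, kept abstract behind the four properties that
    the Legendre symbol calls for. *)
Lemma qfpolyP P : monic_irr P -> exists (K : finFieldType) (pi : {poly F} -> K),
  [/\ (forall f g, pi (f * g) = pi f * pi g),
      (forall f g, pi (f - g) = pi f - pi g),
      (forall x, exists2 f : {poly F}, (size f < size P)%N & pi f = x) &
      (forall f, (pi f == 0) = (P %| f))].
Proof.
move=> hP; have [mP iP] := monic_irrP _ hP; have hI : monic_irreducible_poly P by split.
exists {poly %/ P with hI}, (in_qpoly P); split.
- by move=> f g; rewrite rmorphM.
- by move=> f g; rewrite rmorphB.
- move=> x; exists (val x); last by apply: val_inj; apply: in_qpoly_small; exact: size_mk_monic.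
  have <- : size (mk_monic P) = size P by rewrite mk_monicE.
  exact: size_mk_monic.
- move=> f; rewrite -val_eqE /= mk_monicE //.
  by rewrite -Pdiv.IdomainMonic.modpE // /dvdp.
Qed.

Lemma legendre_square P f : monic_irr P ->
  [exists g : {poly_(size P).-1 F}, P %| (val g) ^+ 2 - f] =
  `[< exists g, P %| g ^+ 2 - f >].
Proof.
move=> hP; apply/existsP/asboolP => [[g Pg]|[g Pg]]; first by exists (val g).
have sg : g %% P \is a poly_of_size (size P).-1.
  rewrite qualifE /= -ltnS prednK ?(ltnW (monic_irr_size hP)) //.
  by rewrite ltn_modp -size_poly_gt0 (ltnW (monic_irr_size hP)).
exists (NPoly sg) => /=.
have -> : (g %% P) ^+ 2 - f = (g ^+ 2 - f) - P * ((g %/ P) * (g %% P + g)).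
  by move: (divp_eq g P); move: (g %/ P) (g %% P) => a b ->; ring.
by rewrite dvdp_sub // dvdp_mulr.
Qed.

Lemma legendreM P f g : monic_irr P ->
  legendre (f * g) P = legendre f P * legendre g P.
Proof.
move=> hP; have [mP iP] := monic_irrP _ hP.
rewrite /legendre !legendre_square // irreducible_dvdp_mul //.
case: ifP => [/orP[->|->]|/negbT]; rewrite ?mul0r ?mulr0 // negb_or.
move=> /andP[/negbTE Pf /negbTE Pg]; rewrite Pf Pg.
have [K [pi [piM piB piS pi0]]] := qfpolyP hP.
have sqE h : `[< exists k, P %| k ^+ 2 - h >] = `[< exists x, pi h = x ^+ 2 >].
  apply/asboolP/asboolP => [[k]|[x Ex]].
    by rewrite -pi0 piB subr_eq0 expr2 piM => /eqP <-; exists (pi k).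
  have [k _ kx] := piS x; exists k.
  by rewrite -pi0 piB expr2 piM kx Ex subrr.
rewrite !sqE piM.
have [z zP] := finField_generator K.
have [i Ei] : exists i, pi f = z ^+ i by apply: zP; rewrite pi0 Pf.
have [j Ej] : exists i, pi g = z ^+ i by apply: zP; rewrite pi0 Pg.
have f0 : pi f != 0 by rewrite pi0 Pf.
have g0 : pi g != 0 by rewrite pi0 Pg.
case: asboolP => [[x Ex]|nsq].
  case: asboolP => [[y Ey]|nf]; case: asboolP => [[w Ew]|ng] //.
  - case: ng; exists (x / y); rewrite exprMn exprVn -Ex -Ey.
    by rewrite mulrC mulKf.
  - case: nf; exists (x / w); rewrite exprMn exprVn -Ex -Ew.
    by rewrite mulfK.
case: asboolP => [[y Ey]|nf]; case: asboolP => [[w Ew]|ng] //.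
  by case: nsq; exists (y * w); rewrite exprMn Ey Ew.
(* A nonsquare is an odd power of the generator [z]; the product of two nonsquares is then an even
   power, hence a square. *)
have odd_of h k : pi h = z ^+ k -> ~ (exists x, pi h = x ^+ 2) -> odd k.
  move=> Eh nh; apply/negPn/negP => ek; case: nh; exists (z ^+ k./2).
  by rewrite -exprM muln2 Eh; congr (_ ^+ _); rewrite -[LHS]odd_double_half (negbTE ek).
case: nsq; exists (z ^+ (i + j)./2).
rewrite Ei Ej -exprD -exprM muln2 -[in LHS](odd_double_half (i + j)).
by rewrite oddD (odd_of _ _ Ei nf) (odd_of _ _ Ej ng).
Qed.

Lemma legendre_sqr P f : monic_irr P -> legendre (f ^+ 2) P = (~~ (P %| f))%:Z.
Proof.
move=> hP; rewrite expr2 legendreM // /legendre.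
by case: ifP => // _; case: ifP.
Qed.

Lemma chiM m f g : chi m (f * g) = chi m f * chi m g.
Proof.
by rewrite /chi -big_split /=; apply: eq_bigr => P hP; rewrite legendreM // exprMn.
Qed.

Lemma legendre_values f P : legendre f P \in [:: 0; 1; -1].
Proof. by rewrite /legendre; do 2?case: ifP. Qed.

Lemma values_mul (x y : int) : x \in [:: 0; 1; -1] -> y \in [:: 0; 1; -1] ->
  x * y \in [:: 0; 1; -1].
Proof. by rewrite !inE => /or3P[]/eqP-> /or3P[]/eqP->. Qed.

Lemma chi_values m f : chi m f \in [:: 0; 1; -1].
Proof.
rewrite /chi; apply: (big_ind (fun x => x \in [:: 0; 1; -1])) =>// [x y|P hP]; first exact: values_mul.
by elim: (multiplicity P m) => [//|k IHk]; rewrite exprS values_mul ?legendre_values.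
Qed.

Lemma liouville_values f : liouville f \in [:: 0; 1; -1].
Proof. by rewrite /liouville -signr_odd; case: odd. Qed.

(** The product of [liouville] and [chi m] takes only the values 0, 1 and -1, so counting signs
    amounts to summing it. *)
Lemma b_lambdaE n m :
  b_lambda n m = \sum_(f <- monics F n) liouville f * chi m f.
Proof.
have H (c : int) : #|[set f in monic_deg F n | liouville (val f) * chi m (val f) == c]|%:Z
    = \sum_(f <- monics F n) (liouville f * chi m f == c)%:Z.
  rewrite /monics big_map big_enum /= -sum1_card (big_morph Posz PoszD (erefl _)) big_mkcond.
  rewrite [RHS]big_mkcond /=; apply: eq_bigr => f _; rewrite !inE.
  by case: (_ \is _); case: (_ == n.+1); case: (_ == c).
rewrite /b_lambda /a_plus /a_minus !H -sumrB; apply: eq_bigr => f _.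
have := values_mul (liouville_values f) (chi_values m f).
by rewrite !inE => /or3P[]/eqP->.
Qed.

Lemma LcoefE m n : Lcoef m n = \sum_(f <- monics F n) chi m f.
Proof. by rewrite /Lcoef /monics big_map big_enum. Qed.

(** [chi m] is completely multiplicative and comes out of the divisor sum, which then is the divisor
    sum of [liouville]. *)
Lemma conv_b_lambda_Lcoef m n :
  \sum_(k < n.+1) b_lambda k m * Lcoef m (n - k) =
  \sum_(f <- monics F n | is_square f) chi m f.
Proof.
transitivity (\sum_(f <- monics F n) \sum_(d <- monic_dvd f)
    liouville d * chi m d * chi m (f %/ d)).
  rewrite (dirichlet_convolution n (fun d g => liouville d * chi m d * chi m g)).
  apply: eq_bigr => k _; rewrite b_lambdaE LcoefE mulr_suml.
  by apply: eq_bigr => d _; rewrite mulr_sumr.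
rewrite [RHS]big_mkcond /=; apply: eq_big_seq => f.
rewrite mem_monics => /andP[mf _].
transitivity (\sum_(d <- monic_dvd f) liouville d * chi m f).
  apply: eq_big_seq => d; rewrite (mem_monic_dvd d (monic_neq0 mf)) => /andP[md df].
  by rewrite -mulrA -chiM [d * _]mulrC divpK.
by rewrite -mulr_suml sum_liouville //; case: is_square; rewrite ?mul1r ?mul0r.
Qed.

Lemma sum_squares m n :
  \sum_(f <- monics F n | is_square f) chi m f =
  if odd n then 0 else \sum_(g <- monics F n./2) chi m (g ^+ 2).
Proof.
have szsq (g : {poly F}) : g \is monic -> size (g ^+ 2) = (size g).-1.*2.+1.
  move=> mg; rewrite expr2 size_Mmonic ?monic_neq0 //.
  by have := monic_neq0 mg; rewrite -size_poly_gt0; case: (size g) => // s _; rewrite addSn /= addnS -addnn.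
case: ifP => on.
  rewrite big_seq_cond big1 // => f /andP[]; rewrite mem_monics => /andP[mf /eqP sf].
  case/hasP => g; rewrite mem_monics_le => /andP[mg _] /eqP gf.
  by have := szsq g mg; rewrite gf sf => -[nE]; rewrite nE odd_double in on.
rewrite -[RHS](big_map (fun g => g ^+ 2) xpredT) -[LHS]big_filter; apply: perm_big.
apply: uniq_perm.
- by apply: filter_uniq; exact: monics_uniq.
- rewrite map_inj_in_uniq ?monics_uniq // => g h.
  rewrite !mem_monics => /andP[mg _] /andP[mh _] /eqP.
  rewrite eqf_sqr => /orP[/eqP //|/eqP gh].
  (* Squaring is injective on monic polynomials: two monic polynomials can be opposite only if -1 =
     1, and then they are equal anyway. *)
  have m1 : (-1 : F) = 1.
    by move: mg mh; rewrite gh !monicE lead_coefN => /eqP + /eqP h1; rewrite h1.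
  by rewrite gh -scaleN1r m1 scale1r.
move=> f; rewrite mem_filter mem_monics; apply/and3P/mapP => [[+ mf /eqP sf]|[g]].
  case/hasP => g; rewrite mem_monics_le => /andP[mg _] /eqP gf.
  exists g => //; rewrite mem_monics mg; have := szsq g mg; rewrite gf sf => -[nE].
  by rewrite nE doubleK prednK ?eqxx // size_poly_gt0 (monic_neq0 mg).
rewrite mem_monics => /andP[mg /eqP sg] ->.
rewrite szsq // sg /= halfK on subn0 eqxx monic_exp //; split => //.
by apply/is_squareP; [rewrite monic_exp|exists g].
Qed.

(** All exponents in [chi] are 0 or 1 since [m] is square-free, and the irreducible factors of [m]
    are exactly the [p i]. *)
Lemma chi_prod (r : nat) (p : 'I_r -> {poly F}) m f : squarefree m -> m != 0 ->
  injective p -> (forall i, p i \is monic /\ irreducible_poly (p i)) ->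
  m = \prod_(i < r) p i -> chi m f = \prod_(i < r) legendre f (p i).
Proof.
move=> sqm m0 injp irrp Em.
have hp i : monic_irr (p i) by apply/monic_irrP/irrp.
have pm i : p i %| m by rewrite Em (bigD1 i) //= dvdp_mulr.
have irr_dvd Q : monic_irr Q -> Q %| m -> exists i, Q = p i.
  move=> hQ; have [_ iQ] := monic_irrP _ hQ; rewrite Em.
  elim/big_ind: _ => [|x y IHx IHy|i _].
  - by rewrite dvdp1; have := monic_irr_size hQ; case: (size Q) => [|[]].
  - by rewrite irreducible_dvdp_mul // => /orP[].
  - by rewrite monic_irr_dvdp_eq // => /eqP ->; exists i.
rewrite /chi (bigID (fun P : {poly_(size m) F} => val P %| m)) /=.
rewrite [X in _ * X]big1 ?mulr1; last first.
  move=> P /andP[hP nPm]; have /eqP-> : multiplicity P m == 0%N; last by rewrite expr0.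
  by apply/multiplicityP; rewrite ?monic_irr_size // expr0 dvd1p expr1.
transitivity (\prod_(P : {poly_(size m) F} | monic_irr P && (val P %| m)) legendre f P).
  apply: eq_bigr => P /andP[hP Pm]; have /eqP-> : multiplicity P m == 1%N; last by rewrite expr1.
  by apply/multiplicityP; rewrite ?monic_irr_size // expr1 Pm; split=> //; apply: sqm; exact: monic_irr_size.
transitivity (\prod_(Q <- [seq p i | i <- enum 'I_r]) legendre f Q); last first.
  by rewrite big_map big_enum.
have [s Es] : exists s : seq {poly F},
    s = [seq (val P : {poly F}) | P : {poly_(size m) F} <- enum {poly_(size m) F}].
  by eexists.
transitivity (\prod_(Q <- s | monic_irr Q && (Q %| m)) legendre f Q).
  by rewrite Es big_map big_enum_cond.
rewrite -big_filter; apply: perm_big; apply: uniq_perm.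
- by apply: filter_uniq; rewrite Es map_inj_uniq ?enum_uniq //; exact: val_inj.
- by rewrite map_inj_uniq ?enum_uniq.
move=> Q; rewrite mem_filter; apply/andP/mapP => [[/andP[hQ Qm] _]|[i _ ->]].
  by have [i ->] := irr_dvd Q hQ Qm; exists i; rewrite ?mem_enum.
rewrite hp pm; split=> //; rewrite Es.
have sp : p i \is a poly_of_size (size m) by rewrite qualifE /= dvdp_leq.
by apply/mapP; exists (NPoly sp); rewrite ?mem_enum.
Qed.

End Character.

(** * Polynomials acting on formal power series *)

Section PowerSeriesAction.
Variable A : comNzRingType.
Implicit Types (P Q : {poly A}) (a b : nat -> A) (n k : nat).

(* [a] stands for the formal power series with coefficients [a n]. *)
Definition pmul P a n : A := \sum_(i < n.+1) P`_i * a (n - i)%N.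

Lemma pmulE N P a n : (n < N)%N -> pmul P a n = (P * \poly_(i < N) a i)`_n.
Proof.
move=> nN; rewrite coefM; apply: eq_bigr => i _.
by rewrite coef_poly (leq_ltn_trans (leq_subr _ _) nN).
Qed.

Lemma eq_pmul P a b n : (forall k, a k = b k) -> pmul P a n = pmul P b n.
Proof. by move=> ab; apply: eq_bigr => i _; rewrite ab. Qed.

Lemma pmulM P Q a n : pmul (P * Q) a n = pmul P (pmul Q a) n.
Proof.
rewrite (pmulE _ _ (ltnSn n)) -mulrA coefM; apply: eq_bigr => i _.
by rewrite -pmulE // ltnS leq_subr.
Qed.

Lemma pmul_coef P Q n : pmul P (fun i => Q`_i) n = (P * Q)`_n.
Proof. by rewrite coefM. Qed.

Lemma pmulBl P Q a n : pmul (P - Q) a n = pmul P a n - pmul Q a n.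
Proof. by rewrite -sumrB; apply: eq_bigr => i _; rewrite coefB mulrBl. Qed.

Lemma pmulZl c P a n : pmul (c *: P) a n = c * pmul P a n.
Proof. by rewrite mulr_sumr; apply: eq_bigr => i _; rewrite coefZ mulrA. Qed.

Lemma pmulDr P a b n : pmul P (fun k => a k + b k) n = pmul P a n + pmul P b n.
Proof. by rewrite -big_split; apply: eq_bigr => i _; rewrite mulrDr. Qed.

Lemma pmulZr c P a n : pmul P (fun k => c * a k) n = c * pmul P a n.
Proof. by rewrite mulr_sumr; apply: eq_bigr => i _; rewrite mulrCA. Qed.

Lemma pmul_sumr (I : finType) P (a : I -> nat -> A) n :
  pmul P (fun k => \sum_i a i k) n = \sum_i pmul P (a i) n.
Proof. by rewrite exchange_big; apply: eq_bigr => i _; rewrite mulr_sumr. Qed.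

Lemma pmulXn k a n : pmul 'X^k a n = if (k <= n)%N then a (n - k)%N else 0.
Proof.
rewrite /pmul; case: leqP => [kn|nk].
  rewrite (bigD1 (Ordinal (kn : (k < n.+1)%N))) //= coefXn eqxx mul1r big1 ?addr0 // => i.
  by rewrite -val_eqE /= coefXn => /negbTE ->; rewrite mul0r.
by rewrite big1 // => i _; rewrite coefXn ltn_eqF ?mul0r // (leq_ltn_trans _ nk) // -ltnS.
Qed.

Lemma pmul1 a n : pmul 1 a n = a n.
Proof. by rewrite -(expr0 'X) pmulXn subn0. Qed.

(** With constant term 1 the coefficient of index [n] of the product determines [a n] from the
    earlier ones. *)
Lemma pmul_inj P a b : P`_0 = 1 ->
  (forall n, pmul P a n = pmul P b n) -> forall n, a n = b n.
Proof.
move=> P0 ab n; have [k] := ubnP n; elim: k n => // k IHk n; rewrite ltnS => nk.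
have := ab n; rewrite /pmul !big_ord_recl /= P0 !mul1r !subn0.
rewrite (eq_bigr (fun i : 'I_n => P`_(bump 0 i) * b (n - bump 0 i)%N)); first exact: addIr.
move=> i _; rewrite IHk // (leq_trans _ nk) // /bump /= add1n.
by have := ltn_ord i; lia.
Qed.

End PowerSeriesAction.

(** * The Euler product of the squares prime to [m] *)

Section EulerProduct.
Variable F : finFieldType.
Implicit Types (f g P Q m : {poly F}) (s : seq {poly F}) (n : nat).

Definition coprime_count s n : int :=
  \sum_(g <- monics F n) (all (fun P => ~~ (P %| g)) s)%:Z.

(** The polynomials to be removed are [P * g] with [g] prime to [s]; on generating functions this is
    the factor [1 - u ^ deg P]. *)
Lemma coprime_count_cons P s n : monic_irr P -> all (@monic_irr F) s -> P \notin s ->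
  coprime_count (P :: s) n =
  coprime_count s n
   - (if ((size P).-1 <= n)%N then coprime_count s (n - (size P).-1) else 0).
Proof.
move=> hP hs Ps; have [mP iP] := monic_irrP _ hP.
have P1 := monic_irr_size hP.
rewrite /coprime_count [X in X - _](bigID (fun g => P %| g)) /= addrC -[LHS]addr0 -addrA.
congr (_ + _).
  rewrite [RHS]big_mkcond; apply: eq_bigr => g _; by case: (P %| g).
case: leqP => sP; last first.
  rewrite subr0 big_seq_cond big1 // => g /andP[]; rewrite mem_monics => /andP[mg /eqP sg].
  move/(dvdp_leq (monic_neq0 mg)); rewrite sg => sPn.
  by have := leq_trans sP (leq_pred _); move: sP sPn P1; case: (size P) => // k /=; lia.
rewrite -[X in X - _]big_filter (perm_big _ (perm_monics_mul mP _)); last first.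
  by move: sP P1; case: (size P).
rewrite big_map; apply/esym/eqP; rewrite subr_eq0; apply/eqP; apply: eq_bigr => g _.
congr (Posz (nat_of_bool _)); apply: eq_in_all => Q Qs.
have hQ := allP hs Q Qs; have [mQ iQ] := monic_irrP _ hQ.
rewrite irreducible_dvdp_mul // (monic_irr_dvdp_eq hQ hP).
by case: eqVneq => // QP; rewrite -QP Qs in Ps.
Qed.

Variable A : comNzRingType.

(** The generating function of [coprime_count s] with [u] replaced by [u ^ 2]: a square of degree
    [n] is counted by its root of degree [n./2]. *)
Definition square_coprime_count s n : A :=
  if odd n then 0 else (coprime_count s n./2)%:~R.

(** Without primes the series is the geometric series in [q u ^ 2]; each prime contributes one
    factor of the right-hand side. *)
Lemma pmul_square_coprime_count s n : uniq s -> all (@monic_irr F) s ->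
  pmul (1 - #|F|%:R *: 'X^2) (square_coprime_count s) n =
  (\prod_(P <- s) (1 - 'X^((size P).-1.*2)) : {poly A})`_n.
Proof.
elim: s n => [n _ _|P s IHs n /= /andP[Ps us] /andP[hP hs]].
  rewrite big_nil coef1 pmulBl pmul1 pmulZl pmulXn.
  have cop0 k : coprime_count [::] k = (#|F| ^ k)%N%:Z.
    rewrite -size_monics -sum1_size (big_morph Posz PoszD (erefl _)).
    by apply: eq_bigr.
  rewrite /square_coprime_count; case: n => [|[|n]] /=; rewrite ?mulr0 ?subr0 //.
    by rewrite cop0.
  rewrite subSS subSS subn0 negbK; case: (odd n); first by rewrite mulr0 subr0.
  rewrite /= !cop0 expnS PoszM intrM -!pmulrn.
  by rewrite subrr.
have E k : square_coprime_count (P :: s) k =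
    pmul (1 - 'X^((size P).-1.*2)) (square_coprime_count s) k.
  rewrite pmulBl pmul1 pmulXn /square_coprime_count.
  case: (boolP (odd k)) => [ok|ek].
    by case: leqP => [dk|]; rewrite ?subr0 // oddB // ok odd_double subr0.
  rewrite coprime_count_cons // intrB.
  have -> : ((size P).-1.*2 <= k)%N = ((size P).-1 <= k./2)%N.
    by rewrite -[in LHS](odd_double_half k) (negbTE ek) add0n leq_double.
  case: leqP => dk; rewrite ?mulr0z ?subr0 //.
  have dk2 : ((size P).-1.*2 <= k)%N.
    by rewrite -[X in (_ <= X)%N](odd_double_half k) (negbTE ek) add0n leq_double.
  rewrite oddB // odd_double addbF (negbTE ek).
  congr (_ - (coprime_count s _)%:~R).
  by rewrite -[in RHS](odd_double_half k) (negbTE ek) add0n -doubleB doubleK.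
rewrite (eq_pmul _ _ E) -pmulM mulrC pmulM big_cons -pmul_coef.
by apply: eq_pmul => k; rewrite IHs.
Qed.

Lemma b_lambda_generating (r : nat) (p : 'I_r -> {poly F}) m (L : {poly A}) n :
  squarefree m -> m != 0 -> injective p ->
  (forall i, p i \is monic /\ irreducible_poly (p i)) -> m = \prod_(i < r) p i ->
  (forall k, (Lcoef m k)%:~R = L`_k) ->
  pmul ((1 - #|F|%:R *: 'X^2) * L) (fun k => (b_lambda k m)%:~R) n =
  (\prod_(i < r) (1 - 'X^((size (p i)).-1.*2)) : {poly A})`_n.
Proof.
move=> sqm m0 injp irrp Em HL.
have hp i : monic_irr (p i) by apply/monic_irrP/irrp.
pose s := [seq p i | i <- enum 'I_r].
have us : uniq s by rewrite map_inj_uniq ?enum_uniq.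
have hs : all (@monic_irr F) s by apply/allP => _ /mapP[i _ ->].
have -> : \prod_(i < r) (1 - 'X^((size (p i)).-1.*2)) =
    \prod_(P <- s) (1 - 'X^((size P).-1.*2)) :> {poly A}.
  by rewrite big_map big_enum.
rewrite -(pmul_square_coprime_count n us hs) pmulM; apply: eq_pmul => k.
transitivity ((\sum_(i < k.+1) b_lambda i m * Lcoef m (k - i))%:~R : A).
  rewrite rmorph_sum (reindex_inj rev_ord_inj) /=; apply: eq_bigr => i _.
  by rewrite rmorphM /= HL subSS mulrC subKn // -ltnS.
rewrite conv_b_lambda_Lcoef sum_squares /square_coprime_count; case: (odd k) => //.
congr (_%:~R); apply: eq_bigr => g _.
rewrite (chi_prod _ sqm m0 injp irrp Em).
rewrite (eq_bigr (fun i => (~~ (p i %| g))%:Z)); last by move=> i _; rewrite legendre_sqr.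
rewrite -(big_enum _ _ _ (fun i => (~~ (p i %| g))%:Z)) -(big_map p xpredT (fun P => (~~ (P %| g))%:Z)) -/s.
by elim: s {us hs} => [|P s IHs]; rewrite ?big_nil // big_cons IHs /=; case: (P %| g); rewrite ?mul0r ?mul1r.
Qed.

End EulerProduct.

(** * Partial fractions and the spectral expansion *)

Section PartialFractions.
Variables (K : fieldType) (I : finType) (rho : I -> K).
Hypotheses (rho_inj : injective rho) (rho_neq0 : forall i, rho i != 0).
Implicit Types (c : I -> K) (b : nat -> K) (N Q : {poly K}).

Definition den : {poly K} := \prod_i (1 - rho i *: 'X).
Definition den_wo k : {poly K} := \prod_(i | i != k) (1 - rho i *: 'X).

Lemma den_factor k : den = (1 - rho k *: 'X) * den_wo k.
Proof. by rewrite /den (bigD1 k). Qed.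

Let lin_horner a x : (1 - a *: 'X : {poly K}).[x] = 1 - a * x.
Proof. by rewrite !hornerE. Qed.

Let lin_neq0 a : (1 - a *: 'X : {poly K}) != 0.
Proof.
apply/eqP => /(congr1 (fun p : {poly K} => p.[0])).
by rewrite lin_horner mulr0 subr0 horner0 => /eqP; rewrite oner_eq0.
Qed.

(** Reads a cofactor off a known factorization of [den], in place of evaluating the product over the
    other indices. *)
Lemma den_wo_unique k Q : den = (1 - rho k *: 'X) * Q -> den_wo k = Q.
Proof. by rewrite (den_factor k) => /(mulfI (lin_neq0 _)). Qed.

Lemma den_wo_neq0 k : (den_wo k).[(rho k)^-1] != 0.
Proof.
rewrite /den_wo horner_prod prodf_seq_neq0; apply/allP => i _; apply/implyP => ik.
rewrite lin_horner subr_eq0 eq_sym; apply: contra ik => /eqP E.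
by apply/eqP/rho_inj; rewrite -[RHS]mul1r -E mulfVK.
Qed.

Lemma den_wo_root k l : k != l -> (den_wo k).[(rho l)^-1] = 0.
Proof.
move=> kl; rewrite /den_wo horner_prod (bigD1 l) 1?eq_sym //=.
by rewrite lin_horner mulfV // subrr mul0r.
Qed.

Lemma den_coef0 : den`_0 = 1.
Proof.
rewrite -horner_coef0 /den horner_prod big1 // => i _.
by rewrite lin_horner mulr0 subr0.
Qed.

Let size_lin i : size (1 - rho i *: 'X : {poly K}) = 2.
Proof.
by rewrite addrC size_polyDl size_polyN size_scale ?size_polyX ?size_poly1.
Qed.

Lemma size_den : size den = #|I|.+1.
Proof.
rewrite /den size_prod => [|i _]; last exact: lin_neq0.
have -> : (\sum_i size (1 - rho i *: 'X : {poly K})%R = #|I| * 2)%N.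
  by rewrite -sum_nat_const; apply: eq_bigr => i _; exact: size_lin.
by rewrite subSn ?leq_pmulr // muln2 -addnn addnK.
Qed.

Lemma size_den_wo k : size (den_wo k) = #|I|.
Proof.
have := size_den; rewrite (den_factor k) size_mul ?lin_neq0 ?size_lin //.
  by move=> [].
apply: contraNneq (den_wo_neq0 k) => ->; by rewrite horner0.
Qed.

Lemma vanish_on_inv N : (forall k, N.[(rho k)^-1] = 0) -> den %| N.
Proof.
move=> HN; pose rs := [seq (rho i)^-1 | i <- enum I].
have D : den %= \prod_(z <- rs) ('X - z%:P).
  rewrite /den big_map big_enum /=.
  elim/big_ind2: _ => [|p1 p2 q1 q2 E1 E2|i _]; first exact: eqpxx.
    exact: eqp_trans (eqp_mulr _ E1) (eqp_mull _ E2).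
  have -> : 1 - rho i *: 'X = (- rho i) *: ('X - (rho i)^-1%:P) :> {poly K}.
    by rewrite scalerBr scaleNr scaleNr -[X in _ - - X]mul_polyC -polyCM mulfV // opprK addrC.
  by rewrite eqp_scale // oppr_eq0.
rewrite (eqp_dvdl _ D); apply: uniq_roots_dvdp.
  by apply/allP => _ /mapP[i _ ->]; apply/rootP/HN.
by rewrite uniq_rootsE map_inj_uniq ?enum_uniq // => i j /invr_inj /rho_inj.
Qed.

Lemma pmul_geometric k n : pmul den (fun n => rho k ^+ n) n = (den_wo k)`_n.
Proof.
rewrite (den_factor k) mulrC pmulM -[den_wo k in RHS]mulr1 -pmul_coef.
apply: eq_pmul => j; rewrite pmulBl pmul1 pmulZl -[X in pmul X]expr1 pmulXn coef1.
case: j => [|j]; first by rewrite expr0 mulr0 subr0.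
by rewrite /= subn1 -exprS subrr.
Qed.

(** The coefficient of [1 / (1 - rho k u)] in the partial fractions of [N / den]. *)
Definition residue N k := N.[(rho k)^-1] / (den_wo k).[(rho k)^-1].

(** The Lagrange interpolant [S] of [N] at the zeros of [den] differs from [N] by a multiple
    [Q * den]. So [b] is [Q] plus the geometric terms, and the size hypothesis says that [n] lies
    beyond the last coefficient of [Q]. *)
Lemma partial_fractions N b n : (0 < #|I|)%N ->
  (forall n, pmul den b n = N`_n) -> (size N <= n + #|I|)%N ->
  b n = \sum_k residue N k * rho k ^+ n.
Proof.
move=> I0 Hb sN; pose S : {poly K} := \sum_k residue N k *: den_wo k.
have : den %| N - S.
  apply: vanish_on_inv => k; rewrite hornerD hornerN horner_sum (bigD1 k) //= big1.
    by rewrite addr0 hornerZ /residue divfK ?den_wo_neq0 // subrr.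
  by move=> l lk; rewrite hornerZ den_wo_root ?mulr0.
case/dvdpP => Q NS.
have sS : (size S <= #|I|)%N.
  apply: leq_trans (size_sum _ _ _) _; apply/bigmax_leqP => k _.
  by rewrite (leq_trans (size_scale_leq _ _)) // size_den_wo.
have E : forall j, b j = Q`_j + \sum_k residue N k * rho k ^+ j.
  apply: (pmul_inj den_coef0) => j; rewrite Hb pmulDr pmul_coef pmul_sumr.
  rewrite mulrC -NS -[N in LHS](subrK S) coefD; congr (_ + _).
  rewrite coef_sum; apply: eq_bigr => k _.
  by rewrite coefZ pmulZr pmul_geometric.
rewrite E nth_default ?add0r //.
have [->|Q0] := eqVneq Q 0; first by rewrite size_poly0.
have : size (Q * den) = (size Q + #|I|)%N.
  by rewrite size_mul // -?size_poly_gt0 ?size_den // addnS.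
rewrite -NS => sQ; rewrite -(leq_add2r #|I|) -sQ.
by rewrite (leq_trans (size_polyD _ _)) // size_polyN geq_max sN (leq_trans sS) // leq_addl.
Qed.

(** The polynomial [p] in the shift operator kills every mode other than [k] and multiplies mode [k]
    by [p.[rho k]], which is nonzero. *)
Lemma exponential_sums_unique c n0 :
  (forall n, (n0 <= n)%N -> \sum_k c k * rho k ^+ n = 0) -> forall k, c k = 0.
Proof.
move=> Hc k; pose p : {poly K} := \prod_(l | l != k) ('X - (rho l)%:P).
have : \sum_l c l * rho l ^+ n0 * p.[rho l] = 0.
  transitivity (\sum_(i < size p) p`_i * \sum_l c l * rho l ^+ (n0 + i)); last first.
    by apply: big1 => i _; rewrite Hc ?mulr0 // leq_addr.
  under [RHS]eq_bigr do rewrite mulr_sumr.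
  rewrite exchange_big; apply: eq_bigr => l _ /=.
  rewrite horner_coef mulr_sumr; apply: eq_bigr => i _.
  by rewrite exprD; ring.
rewrite (bigD1 k) //= big1 ?addr0 => [|l lk].
  move/eqP; rewrite !mulf_eq0 => /orP[/orP[/eqP //|]|].
    by rewrite expf_eq0 (negbTE (rho_neq0 k)) andbF.
  rewrite /p horner_prod prodf_seq_eq0 => /hasP[l _ /andP[lk]].
  by rewrite hornerXsubC subr_eq0 => /eqP/rho_inj kl; rewrite kl eqxx in lk.
by rewrite /p horner_prod (bigD1 l) //= hornerXsubC subrr mul0r mulr0.
Qed.

(** Interpolation writes 1 as the combination of the [den_wo k] with coefficients [residue 1 k]. The
    top coefficient of [den_wo k] is a nonzero constant times [(rho k)^-1], while that of 1 in this
    degree is 0. *)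
Lemma sum_inv_residue1 : (1 < #|I|)%N -> \sum_k (rho k)^-1 * residue 1 k = 0.
Proof.
move=> I1; pose S : {poly K} := \sum_k residue 1 k *: den_wo k.
have S1 : 1 - S = 0.
  have : den %| 1 - S.
    apply: vanish_on_inv => k; rewrite hornerD hornerN horner_sum (bigD1 k) //= big1.
      by rewrite addr0 hornerZ /residue divfK ?den_wo_neq0 // subrr.
    by move=> l lk; rewrite hornerZ den_wo_root ?mulr0.
  have [-> //|S0] := eqVneq (1 - S) 0.
  move=> /(dvdp_leq S0); rewrite size_den leqNgt ltnS => /negP[].
  rewrite (leq_trans (size_polyD _ _)) // size_polyN geq_max size_poly1 (ltnW I1) /=.
  apply: leq_trans (size_sum _ _ _) _; apply/bigmax_leqP => k _.
  by rewrite (leq_trans (size_scale_leq _ _)) // size_den_wo.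
have := congr1 (fun p : {poly K} => p`_(#|I|.-1)) S1.
rewrite coefB coef0 coef1 coef_sum; case: #|I| I1 (size_den_wo) => [|[|n]] //= _ sz.
move/eqP; rewrite sub0r oppr_eq0 => /eqP E.
have lead_wo k : (den_wo k)`_n.+1 = - (\prod_i (- rho i)) * (rho k)^-1.
  have -> : n.+1 = (size (den_wo k)).-1 by rewrite sz.
  rewrite -lead_coefE /den_wo lead_coef_prod (bigD1 k (P := xpredT)) //=.
  rewrite !mulNr opprK mulrAC mulfV // mul1r.
  apply: eq_bigr => i _; rewrite addrC lead_coefDl ?size_polyN ?size_scale ?size_polyX ?size_poly1 //.
  by rewrite lead_coefN lead_coefZ lead_coefX mulr1.
move/eqP: E; under eq_bigr do rewrite coefZ lead_wo mulrCA.
rewrite -mulr_sumr mulf_eq0 oppr_eq0 prodf_seq_eq0 => /orP[/hasP[i _ /andP[_]]|/eqP E].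
  by rewrite oppr_eq0 (negbTE (rho_neq0 i)).
by rewrite -[RHS]E; apply: eq_bigr => k _; rewrite mulrC.
Qed.

End PartialFractions.

(** * Zeros of sine and cosine, and polar coordinates *)

Section RealTrigonometry.
Variable R : realType.
Implicit Types x y : R.

Lemma sin_intMpi (k : int) : sin (k%:~R * pi) = 0 :> R.
Proof.
have H n : sin (n%:R * pi) = 0 :> R.
  by elim: n => [|n IHn]; rewrite ?mul0r ?sin0 // -natr1 mulrDl mul1r sinDpi IHn oppr0.
by case: k => n; rewrite ?NegzE ?mulrNz ?mulNr ?sinN -!pmulrn H ?oppr0.
Qed.

Lemma sin_eq0_intMpi x : sin x = 0 -> exists k : int, x = k%:~R * pi.
Proof.
move=> sx; pose k := Num.floor (x / pi); exists k.
have pi0 : (0 : R) < pi := pi_gt0 R.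
have /andP[kx xk] := floor_itv (x / pi).
pose y := x - k%:~R * pi.
have y0 : 0 <= y by rewrite subr_ge0 -ler_pdivlMr.
have ypi : y < pi.
  by rewrite ltrBlDl -[X in _ + X]mul1r -mulrDl -ltr_pdivrMr // -[1]/(1%:~R) -intrD.
have sy : sin y = 0 by rewrite sinB sx sin_intMpi mul0r mulr0 subr0.
apply/eqP; rewrite -subr_eq0 -/y eq_le y0 andbT leNgt; apply/negP => y1.
by have := sin_gt0_pi (x := y); rewrite y1 ypi sy ltxx => /(_ isT).
Qed.

Lemma cos_eq1_intMpi x : cos x = 1 -> exists k : int, x = k%:~R * (2 * pi).
Proof.
move=> cx; have E : x = (x / 2) *+ 2 by rewrite mulr2n -splitr.
have : sin (x / 2) = 0.
  move: cx; rewrite {1}E cos_mulr2n => c1.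
  have := cos2Dsin2 (x / 2) => c2.
  by apply/eqP; rewrite -sqrf_eq0; apply/eqP; move: c1 c2; rewrite mulr2n; lra.
case/sin_eq0_intMpi => k Ek; exists k.
by rewrite E Ek mulr2n; ring.
Qed.

Lemma polar_unit x y : x ^+ 2 + y ^+ 2 = 1 -> exists t, x = cos t /\ y = sin t.
Proof.
move=> xy; have x1 : -1 <= x <= 1.
  by apply/andP; split; have := sqr_ge0 y; nra.
have cx := acosK x1; have := cos2Dsin2 (acos x); rewrite cx -xy => /addrI/eqP.
rewrite eqf_sqr => /orP[/eqP sy|/eqP sy].
  by exists (acos x); rewrite cx sy.
by exists (- acos x); rewrite cosN sinN cx sy opprK.
Qed.

Lemma polar x y : exists r t, x = r * cos t /\ y = r * sin t.
Proof.
have [xy0|xy0] := eqVneq (x ^+ 2 + y ^+ 2) 0.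
  have x0 : x ^+ 2 = 0 by have := sqr_ge0 x; have := sqr_ge0 y; lra.
  have y0 : y ^+ 2 = 0 by lra.
  exists 0, 0; rewrite !mul0r; split; apply/eqP; rewrite -sqrf_eq0; exact/eqP.
have xyp : 0 < x ^+ 2 + y ^+ 2 by rewrite lt_def xy0 addr_ge0 ?sqr_ge0.
pose r := Num.sqrt (x ^+ 2 + y ^+ 2).
have r0 : r != 0 by rewrite gt_eqF // sqrtr_gt0.
have r2 : r ^+ 2 = x ^+ 2 + y ^+ 2 by rewrite sqr_sqrtr // ltW.
have [t [xt yt]] : exists t, x / r = cos t /\ y / r = sin t.
  by apply: polar_unit; rewrite !expr_div_n -mulrDl -r2 mulfV // expf_neq0.
by exists r, t; rewrite -xt -yt; split; rewrite mulrC divfK.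
Qed.

End RealTrigonometry.

Local Open Scope complex_scope.

Section ExpI.
Variable R : realType.
Implicit Types (x y t : R).

Lemma expi0 : expi (0 : R) = 1.
Proof. by rewrite /expi cos0 sin0. Qed.

Lemma expiD x y : expi (x + y) = expi x * expi y.
Proof. by rewrite /expi sinD cosD; apply/eqP; rewrite eq_complex /= eqxx [X in _ == X]addrC eqxx. Qed.

Lemma expiNK x : expi x * expi (- x) = 1.
Proof. by rewrite -expiD subrr expi0. Qed.

Lemma expi_neq0 x : expi x != 0.
Proof. by apply: contra_eq_neq (expiNK x) => ->; rewrite mul0r eq_sym oner_eq0. Qed.

Lemma expiN x : expi (- x) = (expi x)^-1.
Proof. by apply: (mulfI (expi_neq0 x)); rewrite expiNK mulfV ?expi_neq0. Qed.

Lemma expi_nat x n : expi x ^+ n = expi (n%:R * x).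
Proof.
elim: n => [|n IHn]; first by rewrite mul0r expi0 expr0.
by rewrite exprS IHn -expiD -natr1 mulrDl mul1r addrC.
Qed.

Lemma normc_expi x : normc (expi x) = 1.
Proof. by rewrite /normc /expi cos2Dsin2 sqrtr1. Qed.

Lemma expi_eq x y : expi x = expi y -> exists k : int, x - y = k%:~R * (2 * pi).
Proof.
move=> [cE sE]; apply: cos_eq1_intMpi.
by rewrite cosB cE sE -!expr2 cos2Dsin2.
Qed.

Lemma normcR x : normc (x%:C) = `|x|.
Proof. by rewrite /= expr0n addr0 sqrtr_sqr. Qed.

Lemma normc_prod (I : Type) (r : seq I) (z : I -> R[i]) :
  normc (\prod_(i <- r) z i) = \prod_(i <- r) normc (z i).
Proof. by elim/big_rec2: _ => [|i a b _ <-]; rewrite ?normc1 // normcM. Qed.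

Lemma normc_sum (I : Type) (r : seq I) (z : I -> R[i]) :
  normc (\sum_(i <- r) z i) <= \sum_(i <- r) normc (z i).
Proof.
elim/big_rec2: _ => [|i a b _ H]; first by rewrite normc0.
by rewrite (le_trans (le_normcD _ _)) // lerD2l.
Qed.

Lemma Re_normc (z : R[i]) : `|complex.Re z| <= normc z.
Proof.
case: z => x y; rewrite /= -sqrtr_sqr ler_wsqrtr // lerDl sqr_ge0 //.
Qed.

End ExpI.

Section ElementarySymmetric.
Variables (R : realType) (M : nat) (theta : 'I_(Mprime M) -> R).

(** At [x = 1] and [x = -1] this turns [e_even] and [e_odd] into the products that occur in the
    values of the L-function at +-1 / sqrt q. *)
Lemma prod_esym_cos (x : R) :
  \prod_j (1 + x * cos (theta j)) = \sum_(k < (Mprime M).+1) x ^+ k * esym_cos theta k.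
Proof.
under eq_bigr do rewrite addrC.
rewrite (bigA_distr 1 _ (fun j => x * cos (theta j)) (fun=> 1)) /=.
rewrite (partition_big (fun S : {set 'I_(Mprime M)} => inord #|S| : 'I_(Mprime M).+1) xpredT) //=.
apply: eq_bigr => k _; rewrite /esym_cos mulr_sumr.
apply: eq_big => [S|S].
  by rewrite -val_eqE /= inordK // ltnS -[X in (_ <= X)%N]card_ord max_card.
rewrite -val_eqE /= inordK; last by rewrite ltnS -[X in (_ <= X)%N]card_ord max_card.
move=> /eqP <-; rewrite -big_mkcond /= big_split /= prodr_const //.
Qed.

Lemma e_evenDodd : e_even theta + e_odd theta = \prod_j (1 + cos (theta j)).
Proof.
have := prod_esym_cos 1; under eq_bigr do rewrite mul1r.
move=> ->; under eq_bigr do rewrite expr1n mul1r.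
by rewrite (bigID (fun k : 'I_(Mprime M).+1 => odd k)) /= addrC.
Qed.

Lemma e_evenBodd : e_even theta - e_odd theta = \prod_j (1 - cos (theta j)).
Proof.
have := prod_esym_cos (-1); under eq_bigr do rewrite mulN1r.
move=> ->; rewrite (bigID (fun k : 'I_(Mprime M).+1 => odd k)) /= addrC.
congr (_ + _); first by apply: eq_bigr => k /negbTE ok; rewrite -signr_odd ok mul1r.
by rewrite /e_odd -sumrN; apply: eq_bigr => k ok; rewrite -signr_odd ok mulN1r.
Qed.

End ElementarySymmetric.

(** The integral form of GSH: coincidences of zeros and characters of the torus lead to relations
    with integer coefficients. *)
Definition int_independent (R : realType) (d : nat) (theta : 'I_d -> R) : Prop :=
  forall (c0 : int) (c : 'I_d -> int),
    c0%:~R * pi + \sum_j (c j)%:~R * theta j = 0 -> forall j, c j = 0.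

Lemma GSH_int (R : realType) (M : nat) (theta : 'I_(Mprime M) -> R) :
  GSH theta -> int_independent theta.
Proof.
move=> gsh c0 c E j.
have := gsh c0%:~R (fun j => (c j)%:~R); rewrite ratr_int.
under eq_bigr do rewrite ratr_int.
by move=> /(_ E)[_ /(_ j)/eqP]; rewrite intr_eq0 => /eqP.
Qed.

Section Independence.
Variables (R : realType) (d : nat) (theta : 'I_d -> R).
Hypothesis indep : int_independent theta.

Lemma indep_single j (c : int) (k : int) : c%:~R * theta j = k%:~R * pi -> c = 0.
Proof.
move=> E; have := indep (c0 := - k) (c := fun i => if i == j then c else 0).
rewrite (bigD1 j) //= eqxx big1 => [|i /negbTE ->]; last by rewrite mul0r.
by rewrite addr0 E mulrNz mulNr addNr => /(_ erefl j); rewrite eqxx.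
Qed.

Lemma indep_pair i j (a b k : int) : i != j ->
  a%:~R * theta i + b%:~R * theta j = k%:~R * pi -> a = 0.
Proof.
move=> ij E.
have := indep (c0 := - k) (c := fun l => if l == i then a else if l == j then b else 0).
have ji : (j == i) = false by rewrite eq_sym; exact: negbTE.
rewrite (bigD1 i) //= eqxx (bigD1 j) ?ji //= eqxx.
rewrite big1 => [|l /andP[/negbTE -> /negbTE ->]]; last by rewrite mul0r.
by rewrite addr0 E mulrNz mulNr addNr => /(_ erefl i); rewrite eqxx.
Qed.

Lemma sin_indep_neq0 j (n : nat) : (0 < n)%N -> sin (n%:R * theta j) != 0.
Proof.
move=> n0; apply/eqP => /sin_eq0_intMpi[k]; rewrite pmulrn => /indep_single H.
by move: n0; rewrite -ltz_nat H.
Qed.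

Lemma sin_theta_neq0 j : sin (theta j) != 0.
Proof. by have := sin_indep_neq0 j (ltnSn 0); rewrite mul1r. Qed.

Lemma cos_theta_lt1 j : -1 < cos (theta j) < 1.
Proof.
have := cos2Dsin2 (theta j); have := sin_theta_neq0 j.
rewrite -sqrf_eq0; have := sqr_ge0 (sin (theta j)); rewrite le_eqVlt eq_sym => /orP[->//|s0 _ E].
by apply/andP; split; nra.
Qed.

End Independence.

(** * The inverse zeros and their distinctness *)

Section Spectrum.
Variables (R : realType) (d : nat) (theta : 'I_d -> R) (q : R).
Hypotheses (indep : int_independent theta) (q_gt1 : 1 < q).

Notation sq := (Num.sqrt q).

(* Index set of the inverse zeros of [(1 - q u^2) L(u)]: signs for the pair
   [+- sqrt q], pairs [(j, sign)] for [sqrt q * e^(+- i theta_j)], and one more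
   index for the trivial zero [1] when [e] holds. *)
Definition spectral_index (e : bool) : finType :=
  ((bool + 'I_d * bool) + 'I_e)%type.

Definition spectral_value e (k : spectral_index e) : R[i] :=
  match k with
  | inl (inl s) => ((-1) ^+ s * sq)%:C
  | inl (inr (j, s)) => sq%:C * expi ((-1) ^+ s * theta j)
  | inr _ => 1
  end.

Lemma sq_gt1 : 1 < sq.
Proof. by rewrite -sqrtr1 ltr_sqrt // (lt_trans ltr01). Qed.

Lemma sq2 : sq ^+ 2 = q.
Proof. by rewrite sqr_sqrtr // ltW // (lt_trans ltr01). Qed.

Lemma sqC_neq0 : sq%:C != 0.
Proof. by rewrite fmorph_eq0 gt_eqF // (lt_trans ltr01 sq_gt1). Qed.

Lemma spectral_value_neq0 e (k : spectral_index e) : spectral_value k != 0.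
Proof.
case: k => [[s|[j s]]|k] /=; last exact: oner_neq0.
  rewrite fmorph_eq0 mulf_neq0 ?signr_eq0 // gt_eqF //.
  exact: lt_trans ltr01 sq_gt1.
by rewrite mulf_neq0 ?sqC_neq0 ?expi_neq0.
Qed.

Lemma normc_spectral_value e (k : spectral_index e) :
  normc (spectral_value k) = if k is inr _ then 1 else sq.
Proof.
have sq0 : 0 < sq := lt_trans ltr01 sq_gt1.
case: k => [[s|[j s]]|k]; rewrite [spectral_value _]/=; last by rewrite normc1.
  by rewrite normcR normrM normr_sign mul1r gtr0_norm.
by rewrite normcM normc_expi normcR mulr1 gtr0_norm.
Qed.

(** The values +-sqrt q are real and the oscillating ones are not, since [sin (theta j)] is nonzero;
    two equal oscillating values would give an integer relation between one or two angles and pi;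
    the trivial zero has a different modulus. *)
Lemma spectral_value_inj e : injective (@spectral_value e).
Proof.
have sq0 : 0 < sq := lt_trans ltr01 sq_gt1.
have sgn2 (s : bool) : ((-1) ^+ s : R) = ((-1) ^+ s : int)%:~R by case: s.
have sJ (s : bool) (j : 'I_d) (t : bool) : ((-1) ^+ s * sq)%:C <> sq%:C * expi ((-1) ^+ t * theta j).
  case=> _; rewrite mul0r addr0 => /esym/eqP; rewrite mulf_eq0 gt_eqF //=.
  move/eqP => E; have /eqP := sin_theta_neq0 indep j; apply.
  by move: E; case: t; rewrite ?mulN1r ?sinN ?mul1r // => /eqP; rewrite oppr_eq0 => /eqP ->.
have JJ (j j' : 'I_d) (s s' : bool) : sq%:C * expi ((-1) ^+ s * theta j) = sq%:C * expi ((-1) ^+ s' * theta j') -> (j, s) = (j', s').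
  move/(mulfI sqC_neq0)/expi_eq => [k E].
  have E2 : ((-1) ^+ s : int)%:~R * theta j + (- (-1) ^+ s' : int)%:~R * theta j' = (k * 2)%:~R * pi.
    by rewrite intrM -mulrA -[(2%:~R : R)]/2 -E mulrNz mulNr -!sgn2.
  have [jj|jj] := eqVneq j j'; last by have := indep_pair indep jj E2; case: (s).
  move: E2; rewrite -jj -mulrDl -intrD => /(indep_single indep).
  by case: (s); case: (s').
have N1 (a : spectral_index e) (k : 'I_e) : spectral_value a = 1 -> exists k', a = inr k'.
  move=> E; have := normc_spectral_value a; rewrite E normc1 => {E}; case: a => [a /eqP|k' _].
    by rewrite lt_eqF // sq_gt1.
  by exists k'.
move=> x y; case: x => [[s|[j s]]|k]; case: y => [[s'|[j' s']]|k'] //= E.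
- congr (inl (inl _)); move: E => /complexI/eqP.
  rewrite -subr_eq0 -mulrBl mulf_eq0 (gt_eqF sq0) orbF.
  by case: s; case: s' => //; rewrite ?expr1 ?expr0 => /eqP; lra.
- by have := sJ _ _ _ E.
- by have [] := N1 (inl (inl s)) k' E.
- by have := sJ _ _ _ (esym E).
- by congr (inl (inr _)); exact: JJ.
- by have [] := N1 (inl (inr (j, s))) k' E.
- by have [] := N1 (inl (inl s')) k (esym E).
- by have [] := N1 (inl (inr (j', s'))) k (esym E).
- by congr inr; apply: val_inj; move: (ltn_ord k) (ltn_ord k'); case: (e) k k' => -[[|?] ?] [[|?] ?].
Qed.

Definition L_core : {poly R[i]} :=
  \prod_j ((1 - (sq%:C * expi (theta j)) *: 'X) *
           (1 - (sq%:C * expi (- theta j)) *: 'X)).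

Definition trivial_factor (e : bool) : {poly R[i]} := if e then 1 - 'X else 1.

Lemma big_spectral_index (T : Type) (idx : T) (op : Monoid.com_law idx) e
    (f : spectral_index e -> T) :
  \big[op/idx]_k f k =
  op (op (op (f (inl (inl true))) (f (inl (inl false))))
         (\big[op/idx]_j op (f (inl (inr (j, false)))) (f (inl (inr (j, true))))))
     (\big[op/idx]_k f (inr k)).
Proof.
rewrite big_sumType big_sumType; congr (op (op _ _) _).
  by rewrite big_bool.
rewrite (eq_bigr (fun p => f (inl (inr (p.1, p.2))))); last by case.
rewrite -(pair_bigA _ (fun j s => f (inl (inr (j, s))))) /=.
apply: eq_bigr => j _; rewrite Monoid.mulmC.
by rewrite big_bool.
Qed.

Lemma den_spectral e :
  den (@spectral_value e) = (1 - q%:C *: 'X^2) * L_core * trivial_factor e.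
Proof.
rewrite /den big_spectral_index /=; congr (_ * _ * _).
- rewrite expr1 expr0 mulN1r mul1r rmorphN scaleNr opprK.
  rewrite -[X in X%:C *: 'X^2]sq2 rmorphXn /= -!mul_polyC rmorphXn /=; ring.
- by apply: eq_bigr => j _; rewrite expr0 expr1 mul1r mulN1r.
- rewrite /trivial_factor; case: e; first by rewrite big_ord1 scale1r.
  by rewrite big_ord0.
Qed.

Lemma card_spectral_index e : #|spectral_index e| = (2 + d.*2 + e)%N.
Proof. by rewrite !card_sum card_prod card_bool !card_ord muln2. Qed.

End Spectrum.

(** * Explicit residues and the main coefficient *)

Section Residues.
Variables (R : realType) (d : nat) (theta : 'I_d -> R) (q : R).
Hypotheses (indep : int_independent theta) (q_gt1 : 1 < q).

Notation sq := (Num.sqrt q).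
Notation value := (spectral_value theta q).

(** The inverse of the cofactor at the zero [(-1) ^+ s / sq]: 2 comes from the opposite zero, the
    product from the L-function, the last factor from [1 - u]. *)
Definition sign_residue (e s : bool) : R :=
  ((2 * \prod_j (2 * (1 - (-1) ^+ s * cos (theta j)))) *
   (if e then 1 - (-1) ^+ s / sq else 1))^-1.

Let sq0 : sq != 0.
Proof. by rewrite gt_eqF // (lt_trans ltr01 (sq_gt1 q_gt1)). Qed.

Lemma residueE (I : finType) (K : fieldType) (rho : I -> K) N k :
  residue rho N k = N.[(rho k)^-1] * residue rho 1 k.
Proof. by rewrite /residue hornerC mul1r. Qed.

Lemma expi_pair t : expi t + expi (- t) = (2 * cos t)%:C :> R[i].
Proof.
rewrite /expi cosN sinN; apply/eqP; rewrite eq_complex /= subrr eqxx andbT.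
by rewrite mulr2n mulrDl mul1r.
Qed.

Lemma sign_value_inv (s : bool) : ((-1) ^+ s * sq)^-1 = (-1) ^+ s / sq.
Proof. by rewrite invfM -exprVn invrN1. Qed.

(** At these points a conjugate pair of factors is the squared distance from [expi (theta j)] to 1
    or -1. *)
Lemma L_core_sign (s : bool) :
  (L_core theta q).[((-1) ^+ s / sq)%:C] =
  (\prod_j (2 * (1 - (-1) ^+ s * cos (theta j))))%:C.
Proof.
rewrite horner_prod rmorph_prod; apply: eq_bigr => j _; rewrite !hornerE.
have -> : forall a b x y : R[i], (1 - x * a * y) * (1 - x * b * y) =
    1 - (a + b) * (x * y) + (x * y) ^+ 2 * (a * b) by move=> a b x y; ring.
rewrite expi_pair expiNK mulr1.
have -> : sq%:C * ((-1) ^+ s / sq)%:C = ((-1) ^+ s)%:C.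
  by rewrite -rmorphM /= mulrCA mulfV // mulr1.
have -> : ((-1) ^+ s)%:C ^+ 2 = 1 :> R[i].
  by rewrite -rmorphXn /= sqrr_sign.
apply/eqP; rewrite eq_complex /=; apply/andP; split; apply/eqP; ring.
Qed.

Lemma residue_sign e (s : bool) :
  residue (@value e) 1 (inl (inl s)) = (sign_residue e s)%:C.
Proof.
rewrite /residue hornerC mul1r.
rewrite (@den_wo_unique _ _ (@value e) _
  ((1 + ((-1) ^+ s * sq)%:C *: 'X) * L_core theta q * trivial_factor R e)).
  rewrite [value _]/= -fmorphV sign_value_inv !hornerM L_core_sign.
  rewrite /sign_residue (fmorphV (real_complex R)) !rmorphM /=; congr (_ * _ * _)^-1.
    rewrite hornerD hornerZ hornerX hornerC mulrACA -!rmorphM /= -expr2 sqrr_sign mulfV // !mulr1.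
    by rewrite -[2 in RHS]/(1 + 1) rmorphD rmorph1.
  rewrite /trivial_factor; case: e => /=; rewrite !hornerE //.
  by rewrite rmorphB rmorph1 rmorphM.
rewrite den_spectral // [value _]/= !mulrA; congr (_ * _ * _).
rewrite -[X in X%:C *: 'X^2](sq2 q_gt1) -!mul_polyC.
have <- : ((-1) ^+ s * sq) ^+ 2 = sq ^+ 2 by rewrite exprMn sqrr_sign mul1r.
rewrite !rmorphXn /=; ring.
Qed.

(** The effect of one more factor [1 - u] in the denominator; in modulus, this is the passage from
    [beta] to [beta']. *)
Lemma residue_pairE (j : 'I_d) (s : bool) :
  residue (@value true) 1 (inl (inr (j, s))) =
  residue (@value false) 1 (inl (inr (j, s))) / (1 - (@value false (inl (inr (j, s))))^-1).
Proof.
rewrite /residue hornerC !mul1r -invfM.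
rewrite (@den_wo_unique _ _ (@value true) _
   (den_wo (@value false) (inl (inr (j, s))) * (1 - 'X))).
  by rewrite hornerM !hornerE.
transitivity (den (@value false) * (1 - 'X)).
  by rewrite !den_spectral // /trivial_factor mulr1.
by rewrite (den_factor (@value false) (inl (inr (j, s)))) -mulrA.
Qed.

Definition trivial_residue : R :=
  ((1 - q) * \prod_j (1 - 2 * sq * cos (theta j) + q))^-1.

Lemma residue_trivial (k : 'I_true) :
  residue (@value true) 1 (inr k) = trivial_residue%:C.
Proof.
rewrite /residue hornerC mul1r.
rewrite (@den_wo_unique _ _ (@value true) _ ((1 - q%:C *: 'X^2) * L_core theta q)).
  rewrite [value _]/= invr1 hornerM /trivial_residue (fmorphV (real_complex R)) rmorphM /=.
  congr (_ * _)^-1; first by rewrite hornerD hornerN hornerZ hornerXn hornerC expr1n mulr1 rmorphB rmorph1.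
  rewrite horner_prod rmorph_prod; apply: eq_bigr => j _; rewrite !hornerE.
  have -> : forall a b x : R[i], (1 - x * a) * (1 - x * b) =
      1 - (a + b) * x + x ^+ 2 * (a * b) by move=> a b x; ring.
  rewrite expi_pair expiNK mulr1 -[X in _ = real_complex R (_ + X)](sq2 q_gt1).
  apply/eqP; rewrite eq_complex /=; apply/andP; split; apply/eqP; ring.
by rewrite den_spectral // [value _]/= scale1r mulrC.
Qed.

(** [1 - q] is negative, and each factor of the product is the squared modulus of 1 minus an
    oscillating value. *)
Lemma trivial_residue_lt0 : trivial_residue < 0.
Proof.
rewrite invr_lt0 nmulr_rlt0 ?subr_lt0 //; apply: prodr_gt0 => j _.
have /andP[c1 c2] := cos_theta_lt1 indep j; have s1 := sq_gt1 q_gt1.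
rewrite -[X in _ + X](sq2 q_gt1); nra.
Qed.

(** [e] tells whether the denominator contains [1 - u]. It holds for [b_lambda] with [M] even and
    also for its partial sums with [M] odd, which is why it is independent of [M] here. *)
Definition main_coef (e : bool) (C E O : R) (n : nat) : R :=
  if e then
    if odd n then C * ((sq * E + q * O) / (q - 1))
    else C * ((q * E + sq * O) / (q - 1))
  else if odd n then C * O else C * E.

(** The product of the squared sines is [(E + O) * (E - O)], so the closed formulas in [E] and [O]
    are the sum of the two residues at +-sqrt q over a common denominator. *)
Lemma main_coefE e (P E O : R) n :
  E + O = \prod_j (1 + cos (theta j)) -> E - O = \prod_j (1 - cos (theta j)) ->
  main_coef e (P / (2 ^+ d * \prod_j sin (theta j) ^+ 2)) E O n =
  P * (sign_residue e false + (-1) ^+ n * sign_residue e true).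
Proof.
move=> EDO EBO.
have s1 := sq_gt1 q_gt1; have sq2' := sq2 q_gt1.
have pP : 0 < \prod_j (1 + cos (theta j)).
  by apply: prodr_gt0 => j _; have /andP[] := cos_theta_lt1 indep j; lra.
have pM : 0 < \prod_j (1 - cos (theta j)).
  by apply: prodr_gt0 => j _; have /andP[] := cos_theta_lt1 indep j; lra.
have -> : \prod_j sin (theta j) ^+ 2 = (E + O) * (E - O).
  rewrite EDO EBO -big_split /=; apply: eq_bigr => j _.
  by have := cos2Dsin2 (theta j) => c2; rewrite -[LHS](addrK (cos (theta j) ^+ 2)) [X in X - _]addrC c2; ring.
have pr (s : bool) : \prod_j (2 * (1 - (-1) ^+ s * cos (theta j))) =
    2 ^+ d * (if s then E + O else E - O).
  rewrite big_split /= prodr_const card_ord; congr (_ * _).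
  by case: s; rewrite ?EDO ?EBO; apply: eq_bigr => j _; rewrite ?expr1 ?expr0; ring.
rewrite /sign_residue !pr -[(-1) ^+ n]signr_odd /main_coef.
move: s1 sq2' sq0; move: sq => S s1 sq2' S0; rewrite -sq2' /=.
have d0 : (2 : R) ^+ d != 0 by rewrite expf_neq0.
have h1 : E + O != 0 by rewrite EDO gt_eqF.
have h2 : E - O != 0 by rewrite EBO gt_eqF.
have h3 : S - 1 != 0 by rewrite subr_eq0 gt_eqF.
have h4 : S + 1 != 0 by rewrite gt_eqF //; lra.
have h5 : S ^+ 2 - 1 != 0.
  by rewrite (_ : _ - _ = (S - 1) * (S + 1)) ?mulf_neq0 //; ring.
by case: e; case: (odd n); rewrite /= ?expr1 ?expr0; field; rewrite ?h1 ?h2 ?h3 ?h4 ?h5 ?d0 ?S0.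
Qed.

End Residues.

Lemma normc_ge0 (R : realType) (z : R[i]) : 0 <= normc z.
Proof. by case: z => x y; exact: sqrtr_ge0. Qed.

Lemma sum_spectral_index (d : nat) (V : nmodType) e (f : spectral_index d e -> V) :
  \sum_k f k = f (inl (inl true)) + f (inl (inl false))
    + \sum_j (f (inl (inr (j, false))) + f (inl (inr (j, true)))) + \sum_k f (inr k).
Proof. exact: big_spectral_index. Qed.

(** * Bounding the odd main coefficient by the amplitudes *)

Section AmplitudeBound.
Variables (R : realType) (d : nat) (theta : 'I_d -> R) (q : R).
Hypotheses (indep : int_independent theta) (q_gt1 : 1 < q).

Notation sq := (Num.sqrt q).
Notation value := (spectral_value theta q).

Let sq_gt0 : 0 < sq.
Proof. exact: lt_trans ltr01 (sq_gt1 q_gt1). Qed.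

(* The vanishing of [\sum_k residue_k / rho_k], which says that the Taylor
   coefficients of [1 / den] extend by [0] to the odd index [-1], expresses the
   main coefficient at odd indices through the oscillating ones; the
   contribution of the trivial zero has a favourable sign. *)
Lemma main_coef_odd_lower e (P E O : R) (B : 'I_d -> R) : 0 < P -> (0 < d)%N ->
  E + O = \prod_j (1 + cos (theta j)) -> E - O = \prod_j (1 - cos (theta j)) ->
  (forall j s, P * normc (residue (@value e) 1 (inl (inr (j, s)))) < B j / 2) ->
  - main_coef q e (P / (2 ^+ d * \prod_j sin (theta j) ^+ 2)) E O 1 < \sum_j B j.
Proof.
move=> P0 d0 EDO EBO HB.
rewrite (main_coefE indep q_gt1 e P 1 EDO EBO) expr1 mulN1r.
pose res := residue (@value e) 1.
have injv := spectral_value_inj indep q_gt1 (e := e).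
have v0 := spectral_value_neq0 theta q_gt1 (e := e).
have V s : (@value e (inl (inl s)))^-1 * (sign_residue theta q e s)%:C =
    ((-1) ^+ s / sq * sign_residue theta q e s)%:C.
  by rewrite [value _]/= -fmorphV sign_value_inv // -rmorphM.
have := sum_inv_residue1 injv v0; rewrite card_spectral_index => /(_ isT).
rewrite sum_spectral_index -/res.
rewrite {1 2}/res !(residue_sign theta q_gt1) !V.
move=> /(congr1 (@complex.Re R)).
set S := \sum_j _; set T := \sum_k _.
have ReD (x y : R[i]) : complex.Re (x + y) = complex.Re x + complex.Re y by case: x; case: y.
rewrite !ReD [complex.Re _%:C]/= [complex.Re ((-1) ^+ false / _ * _)%:C]/= expr1 expr0.
have ST : complex.Re T <= 0.
  rewrite /T; case: (e) @res @T @S injv v0 HB => res T S _ _ _; last by rewrite big_ord0.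
  rewrite big_ord1 /res residue_trivial // [value _]/= invr1 mul1r /=.
  exact: ltW (trivial_residue_lt0 indep q_gt1).
(* All oscillating values have modulus [sq], so the factor [sq] exactly compensates the division by
   them. *)
have SS : sq * complex.Re S <= \sum_j (normc (res (inl (inr (j, false)))) + normc (res (inl (inr (j, true))))).
  apply: (@le_trans _ _ (sq * normc S)).
    by rewrite ler_pM2l // (le_trans (ler_norm _)) // Re_normc.
  rewrite -ler_pdivlMl // (le_trans (normc_sum _ _)) // mulr_sumr ler_sum // => j _.
  rewrite (le_trans (le_normcD _ _)) // mulrDr lerD //.
    by rewrite normcM normcV normc_spectral_value.
  by rewrite normcM normcV normc_spectral_value.
have SB : P * \sum_j (normc (res (inl (inr (j, false)))) + normc (res (inl (inr (j, true)))))
    < \sum_j B j.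
  rewrite mulr_sumr; apply: ltr_sum => [|j _]; last first.
    by have := HB j false; have := HB j true; rewrite mulrDr -/res; lra.
  by apply/hasP; exists (Ordinal d0); rewrite ?mem_index_enum.
move=> H; apply: le_lt_trans SB.
rewrite -mulrN ler_pM2l //; apply: le_trans SS.
have -> : complex.Re S = (sign_residue theta q e true - sign_residue theta q e false) / sq - complex.Re T.
  by move: H; rewrite /= mulN1r mul1r mulrBl ![_ / sq]mulrC mulNr; lra.
rewrite mulrBr mulrCA mulfV ?gt_eqF // mulr1.
have : sq * complex.Re T <= 0 by rewrite pmulr_rle0.
lra.
Qed.

(** The squared modulus exceeds [(1 - a) ^+ 2] by [2 * a * (1 - cos t)], which is positive. *)
Lemma normc_1B_gt (a t : R) : 0 < a -> sin t != 0 -> 1 - a < normc (1 - a%:C * expi t).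
Proof.
move=> a0 st; rewrite (le_lt_trans (ler_norm _)) // -sqrtr_sqr /=.
have ct : cos t < 1.
  have := cos2Dsin2 t; have : 0 < sin t ^+ 2 by rewrite lt_def sqr_ge0 sqrf_eq0 st.
  nra.
rewrite ltr_sqrt.
  have := cos2Dsin2 t; nra.
have : 0 < sin t ^+ 2 by rewrite lt_def sqr_ge0 sqrf_eq0 st.
have a2 : 0 < a ^+ 2 by rewrite exprn_gt0.
move=> s2; rewrite ltr_wpDl ?sqr_ge0 //.
by rewrite mul0r addr0 sub0r sqrrN exprMn mulr_gt0.
Qed.

Lemma normc_1B_valueV e j s : normc (1 - (@value e (inl (inr (j, s))))^-1) =
  Num.sqrt (1 - 2 * sq^-1 * cos (theta j) + q^-1).
Proof.
have -> : (@value e (inl (inr (j, s))))^-1 = (sq^-1)%:C * expi (- ((-1) ^+ s * theta j)).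
  by rewrite [value _]/= invfM expiN fmorphV.
rewrite /expi cosN sinN.
have -> : cos ((-1) ^+ s * theta j) = cos (theta j).
  by case: s; rewrite ?mulN1r ?mul1r ?cosN.
have E : sin ((-1) ^+ s * theta j) ^+ 2 = 1 - cos (theta j) ^+ 2.
  have <- : sin (theta j) ^+ 2 = 1 - cos (theta j) ^+ 2 by rewrite -(cos2Dsin2 (theta j)); ring.
  by case: s; rewrite ?mulN1r ?mul1r ?sinN ?sqrrN.
move: E; set x := sin _; move=> E.
have -> : 1 - (sq^-1)%:C * (cos (theta j) -i* x) =
    Complex (1 - sq^-1 * cos (theta j)) (sq^-1 * x).
  by apply/eqP; rewrite eq_complex /=; apply/andP; split; apply/eqP; ring.
rewrite /normc; congr Num.sqrt.
have -> : q^-1 = sq^-1 ^+ 2 by rewrite exprVn (sq2 q_gt1).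
transitivity ((1 - sq^-1 * cos (theta j)) ^+ 2 + sq^-1 ^+ 2 * x ^+ 2); first by ring.
by rewrite E; ring.
Qed.

End AmplitudeBound.

(** * The expansion of [b_lambda] and its amplitudes *)

Section Expansion.
Variables (R : realType) (F : finFieldType) (m : {poly F}) (M r : nat).
Variables (p : 'I_r -> {poly F}) (theta : 'I_(Mprime M) -> R).
Hypotheses (m_monic : m \is monic) (m_sqfree : squarefree m) (size_m : size m = M.+1).
Hypotheses (M_ge3 : (3 <= M)%N) (p_inj : injective p).
Hypothesis p_irr : forall i, p i \is monic /\ irreducible_poly (p i).
Hypotheses (m_prod : m = \prod_(i < r) p i) (Lm : L_factors m theta) (gsh : GSH theta).

Let q : R := #|F|%:R.
Notation sq := (Num.sqrt q).
Let e := ~~ odd M.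
Notation value := (spectral_value theta q).
Let indep := GSH_int gsh.

Lemma card_field_gt1 : 1 < q.
Proof. by rewrite ltr1n card_finNzRing_gt1. Qed.
Let q_gt1 := card_field_gt1.

Let sq_gt0 : 0 < sq.
Proof. exact: lt_trans ltr01 (sq_gt1 q_gt1). Qed.

Definition euler_numerator : {poly R[i]} := \prod_(i < r) (1 - 'X^((size (p i)).-1.*2)).

Definition euler_constant : R := \prod_(i < r) (1 - (q ^+ (size (p i)).-1)^-1).

Lemma deg_p_gt0 i : (0 < (size (p i)).-1)%N.
Proof. by have [_ [p1 _]] := p_irr i; case: (size (p i)) p1 => [|[]]. Qed.

Lemma size_euler_numerator : (size euler_numerator <= M.*2.+1)%N.
Proof.
have H (s : seq 'I_r) : (\prod_(i <- s) p i != 0) &&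
   (size (\prod_(i <- s) (1 - 'X^((size (p i)).-1.*2) : {poly R[i]}))%R <=
     (size (\prod_(i <- s) p i)%R).-1.*2.+1)%N.
  elim: s => [|i s /andP[IH0 IHs]]; first by rewrite !big_nil oner_eq0 !size_poly1.
  have pi0 : p i != 0 by have [/monic_neq0] := p_irr i.
  rewrite !big_cons mulf_neq0 //= (leq_trans (size_polyMleq _ _)) //.
  rewrite size_mul //.
  have s1 : (size (1 - 'X^((size (p i)).-1.*2) : {poly R[i]})%R <= (size (p i)).-1.*2.+1)%N.
    rewrite (leq_trans (size_polyD _ _)) // size_polyN size_polyXn size_poly1.
    by rewrite geq_max leqnn andbT.
  rewrite -size_poly_gt0 in IH0; rewrite -size_poly_gt0 in pi0.
  have arith (a b u v : nat) : (0 < v)%N -> (0 < u)%N -> (a <= u.-1.*2.+1)%N ->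
    (b <= v.-1.*2.+1)%N -> ((a + b).-1 <= (u + v).-2.*2.+1)%N by lia.
  exact: arith.
have := H (index_enum _); rewrite -m_prod size_m => /andP[_]; exact.
Qed.

Lemma card_index_M : #|spectral_index (Mprime M) e| = M.+1.
Proof.
rewrite card_spectral_index /e /Mprime; have := odd_double_half M.
move: M_ge3; case: (odd M) => /=; case: M => [|[|k]] //= _; lia.
Qed.

(** There are [M + 1] inverse zeros and the numerator has degree at most [2 * M], so the polynomial
    part has no coefficient in this range. *)
Lemma b_lambda_spectral n : (2 * M <= n)%N ->
  (b_lambda n m)%:~R = \sum_k residue (@value e) euler_numerator k * value k ^+ n :> R[i].
Proof.
move=> nM; apply: (@partial_fractions _ _ _ (spectral_value_inj indep q_gt1 (e := e))
  (spectral_value_neq0 theta q_gt1 (e := e)) euler_numerator (fun k => (b_lambda k m)%:~R)).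
- by rewrite card_index_M.
- move=> k.
  rewrite -(b_lambda_generating (A := R[i]) (L := Lfactored q theta) _ m_sqfree (monic_neq0 m_monic) p_inj p_irr m_prod Lm).
  rewrite den_spectral // /Lfactored -mulrA [L_core _ _ * _]mulrC.
  have -> : q%:C = #|F|%:R by rewrite rmorph_nat.
  by rewrite /trivial_factor /e; case: (odd M).
- by rewrite card_index_M (leq_trans size_euler_numerator) // -mul2n; lia.
Qed.

Lemma euler_numerator_sign (s : bool) :
  euler_numerator.[(@value e (inl (inl s)))^-1] = euler_constant%:C.
Proof.
rewrite [value _]/= -fmorphV sign_value_inv // horner_prod rmorph_prod.
apply: eq_bigr => i _; rewrite hornerD hornerN hornerXn hornerC -rmorphXn /=.
rewrite -mul2n exprM [(_ / _) ^+ 2]exprMn sqrr_sign mul1r [sq^-1 ^+ 2]exprVn (sq2 q_gt1) exprVn.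
by rewrite rmorphB rmorph1.
Qed.

Lemma euler_constant_gt0 : 0 < euler_constant.
Proof.
apply: prodr_gt0 => i _; rewrite subr_gt0 invf_lt1 ?exprn_gt0 //.
  by rewrite exprn_egt1 // -lt0n deg_p_gt0.
exact: lt_trans ltr01 q_gt1.
Qed.

(** Each factor is 1 minus a number of modulus [q ^- k] whose argument is not a multiple of pi by
    GSH, so [normc_1B_gt] applies to it. *)
Lemma euler_numerator_pair j s :
  euler_constant < normc (euler_numerator.[(@value e (inl (inr (j, s))))^-1]).
Proof.
have q0 : 0 < q := lt_trans ltr01 q_gt1.
rewrite horner_prod normc_prod; apply: ltr_prod.
  (* A strict inequality of products requires a factor: the empty product would make [m] equal to 1,
     of degree 0. *)
  apply/hasP; have r0 : (0 < r)%N.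
    move: m_prod size_m M_ge3; case: (r) p => // p' ->.
    by rewrite big_ord0 size_poly1 => -[<-].
  by exists (Ordinal r0); rewrite ?mem_index_enum.
move=> i _; set k := (size (p i)).-1; have k0 : (0 < k)%N := deg_p_gt0 i.
apply/andP; split.
  by rewrite subr_ge0 invf_le1 ?exprn_gt0 // exprn_ege1 // ltW.
rewrite hornerD hornerN hornerXn hornerC [value _]/= invfM -expiN exprMn expi_nat.
have -> : (sq%:C)^-1 ^+ k.*2 = (q ^- k)%:C.
  by rewrite -fmorphV -rmorphXn /= -mul2n exprM [sq^-1 ^+ 2]exprVn (sq2 q_gt1) exprVn.
apply: normc_1B_gt; first by rewrite invr_gt0 exprn_gt0.
rewrite mulrN sinN oppr_eq0 mulrCA.
case: s; rewrite ?mulN1r ?mul1r ?sinN ?oppr_eq0; apply: (sin_indep_neq0 indep); lia.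
Qed.

Let C : R := Cm p theta.
Let E : R := e_even theta.
Let O : R := e_odd theta.

Lemma CmE : C = euler_constant / (2 ^+ Mprime M * \prod_j sin (theta j) ^+ 2).
Proof. by []. Qed.

Lemma alpha_main_coef n : alpha q C theta n = main_coef q e C E O n.
Proof. by rewrite /alpha /main_coef /e; case: (odd M). Qed.

Lemma main_coef_spectral n :
  (sq ^+ n * main_coef q e C E O n)%:C =
  residue (@value e) euler_numerator (inl (inl true)) * (@value e (inl (inl true))) ^+ n +
  residue (@value e) euler_numerator (inl (inl false)) * (@value e (inl (inl false))) ^+ n.
Proof.
rewrite CmE (main_coefE indep q_gt1 e _ n (e_evenDodd theta) (e_evenBodd theta)).
rewrite 2!(residueE _ euler_numerator) !euler_numerator_sign !(residue_sign theta q_gt1).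
rewrite ![value _]/= -!rmorphXn -!rmorphM -rmorphD /=; congr (_%:C).
by rewrite expr0 mul1r expr1 !exprMn; ring.
Qed.

Lemma Re_oscillation (c : R[i]) j (s : bool) n :
  complex.Re (c * (@value e (inl (inr (j, s)))) ^+ n) =
  sq ^+ n * (complex.Re c * cos (n%:R * theta j)
              - (-1) ^+ s * complex.Im c * sin (n%:R * theta j)).
Proof.
rewrite [value _]/= exprMn expi_nat -rmorphXn /= mulrCA.
case: c => x y; rewrite /expi /= mulrCA.
by case: s; rewrite ?expr1 ?expr0 ?mulN1r ?mul1r ?sinN ?cosN; ring.
Qed.

(** [b_lambda] and the main term are real, so real parts can be taken in the spectral expansion; the
    two terms of each pair then form a real combination of a cosine and a sine, which polar
    coordinates turn into one shifted sine. *)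
Lemma exists_expansion : exists beta omega K, b_expansion m C theta beta omega K.
Proof.
pose c (k : spectral_index (Mprime M) e) := residue (@value e) euler_numerator k.
have /fin_all_exists[f Hf] (j : 'I_(Mprime M)) : exists rt : R * R,
   complex.Im (c (inl (inr (j, true)))) - complex.Im (c (inl (inr (j, false)))) = rt.1 * cos rt.2 /\
   complex.Re (c (inl (inr (j, true)))) + complex.Re (c (inl (inr (j, false)))) = rt.1 * sin rt.2.
  have [a [t H]] := polar (complex.Im (c (inl (inr (j, true)))) - complex.Im (c (inl (inr (j, false)))))
    (complex.Re (c (inl (inr (j, true)))) + complex.Re (c (inl (inr (j, false))))).
  by exists (a, t).
exists (fun j => (f j).1), (fun j => (f j).2), (complex.Re (\sum_k c (inr k))).
move=> n nM; have := b_lambda_spectral nM.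
rewrite sum_spectral_index -main_coef_spectral => /(congr1 (@complex.Re R)).
have ReD (x y : R[i]) : complex.Re (x + y) = complex.Re x + complex.Re y by case: x; case: y.
have ReS (I : finType) (x : I -> R[i]) : complex.Re (\sum_i x i) = \sum_i complex.Re (x i).
  by apply: (big_morph _ ReD).
have -> : complex.Re ((b_lambda n m)%:~R : R[i]) = (b_lambda n m)%:~R.
  by rewrite -(rmorph_int (real_complex R)).
move=> ->; rewrite !ReD ReS alpha_main_coef mulrDr; congr (_ + _ + _).
  rewrite mulr_sumr; apply: eq_bigr => j _.
  rewrite ReD !Re_oscillation sinD; have [h1 h2] := Hf j.
  have -> : (f j).1 * (sin (n%:R * theta j) * cos (f j).2 + cos (n%:R * theta j) * sin (f j).2) =
      sin (n%:R * theta j) * ((f j).1 * cos (f j).2) + cos (n%:R * theta j) * ((f j).1 * sin (f j).2).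
    by ring.
  by rewrite -h1 -h2 /c -/q expr0 expr1; ring.
have -> : \sum_k residue (@value e) euler_numerator (inr k) * value (inr k) ^+ n = \sum_k c (inr k).
  by apply: eq_bigr => k _; rewrite [value _]/= expr1n mulr1.
by move: c {Hf}; rewrite /e; case: (odd M) => c //; rewrite big_ord0.
Qed.

Lemma amplitude_residue beta omega K j s : b_expansion m C theta beta omega K ->
  normc (residue (@value e) euler_numerator (inl (inr (j, s)))) = `|beta j| / 2.
Proof.
move=> Hb.
(* The given expansion rewritten by Euler's formula for the sine. Its main term already consists of
   the residues at +-sqrt q, so uniqueness bears on the other coefficients. *)
pose c (k : spectral_index (Mprime M) e) : R[i] := match k with
  | inl (inl s) => residue (@value e) euler_numerator (inl (inl s))
  | inl (inr (j, s)) => (beta j / 2)%:C * ((- (-1) ^+ s)*i * expi ((-1) ^+ s * omega j))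
  | inr _ => K%:C end.
have U : forall k, residue (@value e) euler_numerator k - c k = 0.
  apply: (exponential_sums_unique (spectral_value_inj indep q_gt1 (e := e)) (spectral_value_neq0 theta q_gt1 (e := e)) (n0 := (2 * M)%N)) => n nM.
  under eq_bigr do rewrite mulrBl.
  rewrite sumrB -b_lambda_spectral //; apply/eqP; rewrite subr_eq0; apply/eqP.
  have intC (k : int) : k%:~R = (k%:~R : R)%:C :> R[i] by rewrite rmorph_int.
  rewrite [RHS]sum_spectral_index intC Hb // -/q.
  have rcD (x y : R) : (x + y)%:C = x%:C + y%:C by rewrite rmorphD.
  rewrite alpha_main_coef mulrDr !rcD main_coef_spectral; congr (_ + _ + _).
    rewrite mulr_sumr rmorph_sum; apply: eq_bigr => i _ /=.
    rewrite !exprMn !expi_nat -!rmorphXn /= expr0 expr1 !mulN1r !mul1r.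
    apply/eqP; rewrite eq_complex /=; apply/andP; split; apply/eqP; rewrite ?mulrN ?cosN ?sinN ?sinD; by field.
  under eq_bigr do rewrite [value _]/= expr1n mulr1.
  by rewrite /c /e; case: (odd M); rewrite ?big_ord0 ?big_ord1 ?rmorph0.
have /eqP := U (inl (inr (j, s))); rewrite subr_eq0 => /eqP ->.
rewrite /c !normcM normc_expi normcR mulr1 normrM [X in _ * X * _]ger0_norm ?invr_ge0 //.
have -> : normc (- (-1) ^+ s)*i = 1 :> R.
  by rewrite /= expr0n add0r sqrrN sqrr_sign sqrtr1.
by rewrite mulr1.
Qed.

Lemma residue1_neq0 e' k : residue (@value e') 1 k != 0.
Proof.
rewrite /residue hornerC mul1r invr_neq0 //.
exact: (den_wo_neq0 (spectral_value_inj indep q_gt1 (e := e')) (spectral_value_neq0 theta q_gt1 (e := e'))).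
Qed.

(** The residue of the full quotient is the value of the Euler numerator times [residue 1], and the
    former has modulus above [euler_constant]. *)
Lemma amplitude_gt beta omega K j s : b_expansion m C theta beta omega K ->
  euler_constant * normc (residue (@value e) 1 (inl (inr (j, s)))) < `|beta j| / 2.
Proof.
move=> Hb; rewrite -(amplitude_residue j s Hb) (residueE _ euler_numerator) [X in _ < X]normcM ltr_pM2r.
  exact: euler_numerator_pair.
have := residue1_neq0 (inl (inr (j, s)) : spectral_index _ e).
rewrite lt_def => h; apply/andP; split; first by apply: contraNneq h => /eq0_normc ->.
exact: normc_ge0.
Qed.

Lemma amplitude_neq0 beta omega K j : b_expansion m C theta beta omega K -> beta j != 0.
Proof.
move=> Hb; apply: contraTneq (amplitude_gt j true Hb) => ->.
rewrite normr0 mul0r -leNgt mulr_ge0 ?(ltW euler_constant_gt0) //.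
exact: normc_ge0.
Qed.

Lemma Mprime_gt0 : (0 < Mprime M)%N.
Proof.
rewrite /Mprime; have := odd_double_half M.
by move: M_ge3; case: (odd M); case: (M) => [|[|[|[|k]]]] //=; lia.
Qed.

Lemma sum_amplitudes_gt beta omega K : odd M -> b_expansion m C theta beta omega K ->
  - (C * O) < \sum_j `|beta j|.
Proof.
move=> oM Hb; have e0 : e = false by rewrite /e oM.
have -> : C * O = main_coef q e C E O 1 by rewrite /main_coef e0.
apply: (main_coef_odd_lower indep q_gt1 (e := e) (B := fun j => `|beta j|) euler_constant_gt0
  Mprime_gt0 (e_evenDodd theta) (e_evenBodd theta)) => j s.
exact: amplitude_gt Hb.
Qed.

(** The bound is applied with [e := true] although [M] is odd, since partial sums carry the
    additional factor [1 - u]. Residues and amplitudes are divided by the same modulus. *)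
Lemma sum_amplitudes'_gt beta omega K : odd M -> b_expansion m C theta beta omega K ->
  - (C * ((sq * E + q * O) / (q - 1))) < \sum_j `|beta' q theta beta j|.
Proof.
move=> oM Hb; have e0 : e = false by rewrite /e oM.
apply: (main_coef_odd_lower indep q_gt1 (e := true) (B := fun j => `|beta' q theta beta j|) euler_constant_gt0 Mprime_gt0 (e_evenDodd theta) (e_evenBodd theta)) => j s.
have := amplitude_gt j s Hb; rewrite e0 => H.
rewrite (residue_pairE theta q_gt1) normcM normcV normc_1B_valueV // mulrA.
have -> : `|beta' q theta beta j| / 2 =
    `|beta j| / 2 / Num.sqrt (1 - 2 * sq^-1 * cos (theta j) + q^-1).
  by rewrite /beta' normrM normfV [`|Num.sqrt _|]ger0_norm ?sqrtr_ge0 // mulrAC.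
rewrite ltr_pM2r //.
(* The modulus is nonzero because the oscillating value has modulus [sq > 1] and differs from 1. *)
rewrite invr_gt0 lt_def sqrtr_ge0 andbT -(normc_1B_valueV theta q_gt1 false j s).
apply/eqP => /eq0_normc/eqP; rewrite subr_eq0 eq_sym => /eqP v1.
have := normc_spectral_value theta q_gt1 (inl (inr (j, s)) : spectral_index (Mprime M) false).
rewrite -[value _]invrK v1 invr1 normc1 => /eqP; rewrite lt_eqF //.
exact: sq_gt1.
Qed.

End Expansion.

Local Close Scope complex_scope.
Local Open Scope classical_set_scope.

(** * Equidistribution on the torus *)

Section ProbabilityConstants.
Context (d : measure_display) (T : measurableType d) (R : realType) (P : probability T R).

Lemma integral_prob_cst (r : \bar R) : (\int[P]_x cst r x = r)%E.
Proof.
rewrite integral_cst //; transitivity (r * 1)%E; last exact: mule1.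
by congr (_ * _)%E; exact: probability_setT.
Qed.

Lemma Rintegral_prob_cst (r : R) : \int[P]_x r = r.
Proof. by rewrite /Rintegral (integral_prob_cst r%:E). Qed.

Lemma bounded_prob_integrable (f : T -> R) B :
  measurable_fun setT f -> (forall y, `|f y| <= B) -> P.-integrable setT (EFin \o f).
Proof.
move=> mf fB; apply: measurable_bounded_integrable => //.
  rewrite [X in (X < _)%E](_ : _ = 1%E) ?ltry //; exact: probability_setT.
exists B; split; first exact: num_real.
by move=> x Bx y _ /=; rewrite (le_trans (fB y)) // ltW.
Qed.

End ProbabilityConstants.

Section CircleIntegral.
Variable R : realType.
Implicit Types (k : int) (x t : R).

Lemma cos_int2pi k : cos (k%:~R * (2 * pi)) = 1 :> R.
Proof.
have -> : k%:~R * (2 * pi) = (k%:~R * pi) *+ 2 :> R by rewrite -mulr_natr; ring.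
rewrite cos_mulr2n; have := cos2Dsin2 (k%:~R * pi : R); rewrite sin_intMpi expr0n addr0 => ->.
by rewrite mulr2n addrK.
Qed.

Lemma sin_int2pi k : sin (k%:~R * (2 * pi)) = 0 :> R.
Proof. by have := sin_intMpi R (k * 2); rewrite intrM -mulrA. Qed.

Lemma sinD_int2pi k x : sin (x + k%:~R * (2 * pi)) = sin x.
Proof. by rewrite sinD cos_int2pi sin_int2pi mulr1 mulr0 addr0. Qed.

Lemma continuous_1Dcos (a b : R) : continuous (fun x => 1 + cos (a * x + b)).
Proof.
move=> x; apply: cvgD; first exact: cvg_cst.
apply: continuous_comp; last exact: continuous_cos.
apply: cvgD; last exact: cvg_cst.
by apply: cvgM; [exact: cvg_cst|exact: cvg_id].
Qed.

Lemma cos_ge0D1 x : 0 <= 1 + cos x.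
Proof. by have := cos_geN1 x; lra. Qed.

(** Adding 1 makes the integrand nonnegative, so that substitution and Tonelli apply directly to
    extended integrals. *)
Lemma integral_circle_1Dcos k t :
  (\int[circle_haar R]_x (1 + cos (k%:~R * x + t))%:E =
   (1 + if k == 0 then cos t else 0)%:E)%E.
Proof.
have [->|k0] := eqVneq k 0.
  under eq_integral do rewrite mul0r add0r.
  exact: (integral_prob_cst _ (1 + cos t)%:E).
have kR : (k%:~R : R) != 0 by rewrite intr_eq0.
rewrite integral_uniform; last 2 first.
- apply/measurable_EFinP; apply: measurable_realfun.continuous_measurable_fun.
  exact: continuous_1Dcos.
- by move=> x; rewrite lee_fin cos_ge0D1.
pose G x : R := x + sin (k%:~R * x + t) / k%:~R.
have dG x : is_derive x 1 G (1 + cos (k%:~R * x + t)).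
  rewrite /G; apply: is_derive_eq.
  by rewrite /GRing.scale /=; field.
have cG : continuous G by move=> x; apply: differentiable_continuous; apply/derivable1_diffP.
rewrite (@continuous_FTC2 R (fun x : R => 1 + cos (k%:~R * x + t)) G) ?twopi_gt0 //.
- rewrite /G subr0 add0r mulr0 [k%:~R * _ + _]addrC sinD_int2pi add0r -EFinB -EFinM.
  by rewrite addrK addr0 mulVf // gt_eqF // twopi_gt0.
- by apply: continuous_subspaceT; exact: continuous_1Dcos.
- split; first by move=> x _; exact: ex_derive.
    by apply: cvg_at_right_filter; exact: cG.
  by apply: cvg_at_left_filter; exact: cG.
- by move=> x _; rewrite derive1E; exact: derive_val.
Qed.

(** By the sum-to-product formula, a nonempty level set through [x0] lies in the translates of [x0]
    and [- x0 - pi] by multiples of [2 * pi]. *)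
Lemma countable_sin_level (s : R) : countable [set x | sin x = s].
Proof.
have [[x0 sx0]|nx] := pselect (exists x, sin x = s); last first.
  by rewrite (_ : [set x | sin x = s] = set0) //; apply/seteqP; split => // x /= sx; apply: nx; exists x.
apply: (@sub_countable _ _ _ (range (fun p : int * bool =>
   (if p.2 then x0 else - x0 - pi) + p.1%:~R * (2 * pi)))).
  apply: subset_card_le => x /= sx.
  have : cos ((x + x0) / 2) * sin ((x - x0) / 2) = 0.
    have : sin ((x + x0) / 2 + (x - x0) / 2) - sin ((x + x0) / 2 - (x - x0) / 2) = 0.
      have -> : (x + x0) / 2 + (x - x0) / 2 = x by field.
      have -> : (x + x0) / 2 - (x - x0) / 2 = x0 by field.
      by rewrite sx sx0 subrr.
    rewrite sinD sinB; lra.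
  move/eqP; rewrite mulf_eq0 => /orP[/eqP c0|/eqP s0].
    have : sin ((x + x0) / 2 + pi / 2) = 0 by rewrite sinDpihalf.
    case/sin_eq0_intMpi => k Ek; exists (k, false) => //=.
    lra.
  have [k Ek] := sin_eq0_intMpi s0; exists (k, true) => //=; lra.
by apply: (sub_countable (card_image_le _ _)); exact: countableP.
Qed.

Lemma circle_sin_level (s : R) : circle_haar R [set x | sin x = s] = 0%E.
Proof.
have ms : measurable ([set x | sin x = s] : set (measurableTypeR R)).
  apply: countable_measurable; last exact: countable_sin_level.
  by move=> x; exact: measurable_set1.
have N : (@lebesgue_measure R).-null_set [set x | sin x = s].
  apply/measure0_null_setP => //; apply: countable_lebesgue_measure0.
  exact: countable_sin_level.
apply/(measure0_null_setP (circle_haar R) ms).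
exact: (dominates_uniform_prob (twopi_gt0 R)) N.
Qed.

End CircleIntegral.

Section TorusIntegral.
Variable R : realType.
Notation T := (measurableTypeR R).

Definition phase (d : nat) (a : 'I_d -> int) (t : R) (y : d.-tuple T) : R :=
  \sum_j (a j)%:~R * tnth y j + t.

Lemma measurable_phase d (a : 'I_d -> int) t : measurable_fun setT (phase a t).
Proof.
apply: measurable_funD => //; apply: measurable_sum => j.
apply: measurable_funM => //; exact: measurable_tnth.
Qed.

Lemma measurable_cos_phase d (a : 'I_d -> int) t :
  measurable_fun setT (fun y => cos (phase a t y)).
Proof.
apply: measurableT_comp; last exact: measurable_phase.
by apply: measurable_realfun.continuous_measurable_fun; exact: continuous_cos.
Qed.

(** Orthogonality of characters, by induction on [d]: for a fixed first coordinate, its contribution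
    to the phase is absorbed into the shift [t]. *)
Lemma integral_torus_1Dcos d (a : 'I_d -> int) t :
  (\int[torus_haar R d]_y (1 + cos (phase a t y))%:E =
   (1 + if [forall j, a j == 0] then cos t else 0)%:E)%E.
Proof.
elim: d a t => [|d IHd] a t.
  rewrite /= integral_dirac // ?diracT ?mul1e.
    rewrite /phase big_ord0 add0r; case: forallP => // -[]; by case.
  by apply/measurable_EFinP; apply: measurable_funD => //; exact: measurable_cos_phase.
rewrite ge0_integral_distribution; last 2 first.
- by apply/measurable_EFinP; apply: measurable_funD => //; exact: measurable_cos_phase.
- by move=> y; rewrite lee_fin cos_ge0D1.
have E (z : T * d.-tuple T) : phase a t (cons_pair z) =
    phase (fun j => a (lift ord0 j)) ((a ord0)%:~R * z.1 + t) z.2.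
  rewrite /phase big_ord_recl [RHS]addrA [X in _ = X + t]addrC; congr (_ + _ + _).
  by apply: eq_bigr => j _; congr (_ * _); rewrite !(tnth_nth z.1).
under eq_integral do rewrite /= E.
rewrite fubini_tonelli1; last 2 first.
- apply/measurable_EFinP; apply: measurable_funD => //.
  under eq_fun do rewrite -E.
  apply: (measurableT_comp (measurable_cos_phase a t)); exact: measurable_cons_pair.
- by move=> z; rewrite lee_fin cos_ge0D1.
rewrite /fubini_F /=; under eq_integral do rewrite IHd.
have [a0|na0] := boolP [forall j : 'I_d, a (lift ord0 j) == 0].
  rewrite integral_circle_1Dcos; congr (1 + _)%:E; congr (if _ then _ else _).
  apply/eqP/forallP => [h j|/(_ ord0)/eqP //].
  by case: (unliftP ord0 j) => [i ->|->]; [exact: (forallP a0)|rewrite h].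
rewrite (integral_prob_cst _ (1 + 0)%:E); congr (1 + _)%:E.
case: ifP => // /forallP h; case/negP: na0; apply/forallP => j; exact: h.
Qed.

Lemma Rintegral_torus_cos d (a : 'I_d -> int) t :
  \int[torus_haar R d]_y cos (phase a t y) = if [forall j, a j == 0] then cos t else 0.
Proof.
have i1 : (torus_haar R d).-integrable setT (EFin \o (fun y => cos (phase a t y))).
  apply: (@bounded_prob_integrable _ _ _ _ _ 1); first exact: measurable_cos_phase.
  by move=> y; rewrite ler_norml cos_geN1 cos_le1.
have i0 : (torus_haar R d).-integrable setT (EFin \o (fun=> 1)).
  by apply: (@bounded_prob_integrable _ _ _ _ _ 1) => // y; rewrite normr1.
have := RintegralD measurableT i0 i1.
rewrite {1}/Rintegral integral_torus_1Dcos Rintegral_prob_cst /=.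
by move/addrI => ->.
Qed.

End TorusIntegral.

Section TrigPolynomials.
Variables (R : realType) (d : nat).
Notation T := (measurableTypeR R).
Implicit Types (f g : d.-tuple T -> R) (a : 'I_d -> int) (p : {poly R}).

(** Real combinations of shifted cosines with integer frequencies. The shifts include sines, and
    product-to-sum formulas give closure under products, hence under polynomials. *)
Inductive trigpoly : (d.-tuple T -> R) -> Prop :=
| trig_cos c a t : trigpoly (fun y => c * cos (phase a t y))
| trig_add f g : trigpoly f -> trigpoly g -> trigpoly (fun y => f y + g y).

Lemma eq_trigpoly f g : f =1 g -> trigpoly f -> trigpoly g.
Proof. by move=> /funext ->. Qed.

Lemma trig_cst c : trigpoly (fun=> c).
Proof.
apply: (eq_trigpoly _ (trig_cos c (fun=> 0) 0)) => y.
by rewrite /phase big1 ?addr0 ?cos0 ?mulr1 // => j _; rewrite mul0r.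
Qed.

Lemma trig_mul f g : trigpoly f -> trigpoly g -> trigpoly (fun y => f y * g y).
Proof.
move=> tf tg; elim: tf => [c a t|f1 f2 _ IH1 _ IH2]; last first.
  by apply: (eq_trigpoly _ (trig_add IH1 IH2)) => y; rewrite mulrDl.
elim: tg => [c' a' t'|g1 g2 _ IH1 _ IH2]; last first.
  by apply: (eq_trigpoly _ (trig_add IH1 IH2)) => y; rewrite mulrDr.
apply: (eq_trigpoly _ (trig_add (trig_cos (c * c' / 2) (fun j => a j + a' j) (t + t'))
   (trig_cos (c * c' / 2) (fun j => a j - a' j) (t - t')))) => y.
have -> : phase (fun j => a j + a' j) (t + t') y = phase a t y + phase a' t' y.
  rewrite /phase addrACA -big_split /=; congr (_ + _); apply: eq_bigr => j _.
  by rewrite intrD mulrDl.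
have -> : phase (fun j => a j - a' j) (t - t') y = phase a t y - phase a' t' y.
  rewrite /phase opprD addrACA -sumrB /=; congr (_ + _); apply: eq_bigr => j _.
  by rewrite intrB mulrBl.
by rewrite cosD cosB; field.
Qed.

Lemma trig_sum (n : nat) (F : 'I_n -> d.-tuple T -> R) :
  (forall i, trigpoly (F i)) -> trigpoly (fun y => \sum_i F i y).
Proof.
elim: n F => [|n IHn] F tF.
  by apply: (eq_trigpoly _ (trig_cst 0)) => y; rewrite big_ord0.
apply: (eq_trigpoly _ (trig_add (tF ord0) (IHn (fun i => F (lift ord0 i)) _))) => [y|i //].
by rewrite big_ord_recl.
Qed.

Lemma trig_sine_sum (beta : 'I_d -> R) : trigpoly (sine_sum beta).
Proof.
apply: trig_sum => j.
apply: (eq_trigpoly _ (trig_cos (beta j) (fun i => (i == j)%:Z) (- (pi / 2)))) => y.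
rewrite /phase (bigD1 j) //= eqxx mul1r big1 ?addr0 => [|i /negbTE ->].
  by rewrite cosBpihalf.
by rewrite mul0r.
Qed.

Lemma trig_horner p f : trigpoly f -> trigpoly (fun y => p.[f y]).
Proof.
move=> tf; elim/poly_ind: p => [|p c IHp].
  by apply: (eq_trigpoly _ (trig_cst 0)) => y; rewrite horner0.
apply: (eq_trigpoly _ (trig_add (trig_mul IHp tf) (trig_cst c))) => y.
by rewrite hornerMXaddC.
Qed.

Lemma trig_measurable f : trigpoly f -> measurable_fun setT f.
Proof.
elim=> [c a t|f1 f2 _ m1 _ m2]; last exact: measurable_funD.
by apply: measurable_funM => //; exact: measurable_cos_phase.
Qed.

Lemma trig_bounded f : trigpoly f -> exists B, forall y, `|f y| <= B.
Proof.
elim=> [c a t|f1 f2 _ [B1 b1] _ [B2 b2]].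
  by exists `|c| => y; rewrite normrM ler_piMr // ler_norml cos_geN1 cos_le1.
by exists (B1 + B2) => y; rewrite (le_trans (ler_normD _ _)) // lerD.
Qed.

Lemma trig_integrable f : trigpoly f -> (torus_haar R d).-integrable setT (EFin \o f).
Proof.
by move=> tf; have [B fB] := trig_bounded tf; apply: (bounded_prob_integrable (torus_haar R d) (trig_measurable tf) fB).
Qed.

End TrigPolynomials.

(** * Means over integers of given parity and Weyl's criterion *)

Section Means.
Variable R : realType.
Implicit Types (u v : nat -> R) (t : R) (b : bool).

Definition mean u (N : nat) : R := (\sum_(1 <= n < N.+1) u n) / N%:R.

Lemma meanD u v N : mean (fun n => u n + v n) N = mean u N + mean v N.
Proof. by rewrite /mean big_split mulrDl. Qed.

Lemma meanZ c u N : mean (fun n => c * u n) N = c * mean u N.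
Proof. by rewrite /mean -mulr_sumr mulrA. Qed.

Lemma mean_cst c N : (0 < N)%N -> mean (fun=> c) N = c.
Proof.
move=> N0; rewrite /mean sumr_const_nat subn1 /= -[c *+ N]mulr_natr mulfK //.
by rewrite pnatr_eq0 -lt0n.
Qed.

Lemma le_mean u v N : (forall n, u n <= v n) -> mean u N <= mean v N.
Proof.
move=> uv; rewrite /mean ler_wpM2r ?invr_ge0 ?ler0n // ler_sum_nat // => n _.
Qed.

Lemma mean_cvg0 u B : (forall N, `|\sum_(1 <= n < N.+1) u n| <= B) ->
  mean u N @[N --> \oo] --> 0.
Proof.
move=> uB.
have : (fun N => B * (N%:R : R)^-1) N @[N --> \oo] --> B * 0.
  by apply: cvgM; [exact: cvg_cst|]; rewrite -cvg_shiftS; exact: cvg_harmonic.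
rewrite mulr0 => BN; apply/norm_cvg0P; apply: (squeeze_cvgr _ (cvg_cst 0) BN).
near=> N; rewrite normr_ge0 /= /mean normrM normfV [`|N%:R|]ger0_norm ?ler0n //.
by rewrite ler_wpM2r ?invr_ge0 ?ler0n.
Unshelve. all: by end_near. Qed.

Lemma sum_cos_progression t phi N :
  2 * sin (t / 2) * \sum_(1 <= n < N.+1) cos (n%:R * t + phi) =
  sin (N%:R * t + phi + t / 2) - sin (phi + t / 2).
Proof.
elim: N => [|N IHN]; first by rewrite big_geq // mulr0 mul0r add0r subrr.
rewrite big_nat_recr //= mulrDr IHN.
have -> : N%:R * t + phi + t / 2 = (N.+1%:R * t + phi) - t / 2 by rewrite -natr1; field.
rewrite (sinB (N.+1%:R * t + phi)) (sinD (N.+1%:R * t + phi)); ring.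
Qed.

Lemma mean_cos_cvg0 t phi : sin (t / 2) != 0 ->
  mean (fun n => cos (n%:R * t + phi)) N @[N --> \oo] --> 0.
Proof.
move=> st; apply: (@mean_cvg0 _ (`|2 * sin (t / 2)|^-1 * 2)) => N.
have s0 : 2 * sin (t / 2) != 0 by rewrite mulf_neq0.
rewrite -(ler_pM2l (_ : 0 < `|2 * sin (t / 2)|)) ?normr_gt0 //.
rewrite mulrA mulfV ?normr_eq0 // mul1r -normrM sum_cos_progression.
rewrite (le_trans (ler_normB _ _)) // [leRHS](_ : 2 = 1 + 1) //.
by apply: lerD; rewrite ler_norml sin_geN1 sin_le1.
Qed.

Lemma cos_natDpi n (x : R) : cos (n%:R * pi + x) = (-1) ^+ n * cos x.
Proof.
elim: n => [|n IHn]; first by rewrite mul0r add0r mul1r.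
by rewrite -natr1 mulrDl mul1r addrAC cosDpi IHn exprS mulN1r mulNr.
Qed.

(** Restricting a cosine to one parity produces a second cosine whose frequency is shifted by pi. *)
Lemma parity_weight b n : ((odd n == b)%:R : R) = 2^-1 + 2^-1 * (-1) ^+ b * (-1) ^+ n.
Proof.
rewrite -[(-1) ^+ n]signr_odd; case: (odd n); case: b; rewrite /= ?expr1 ?expr0; by field.
Qed.

(** The frequencies [t] and [t + pi] are nonresonant when [sin (t / 2)] and [cos (t / 2)] are
    nonzero; both follow from [sin t != 0]. *)
Lemma mean_parity_cos_cvg0 b t phi : sin t != 0 ->
  mean (fun n => (odd n == b)%:R * cos (n%:R * t + phi)) N @[N --> \oo] --> 0.
Proof.
move=> st.
have E : sin t = 2 * (sin (t / 2) * cos (t / 2)).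
  rewrite [in LHS](_ : t = (t / 2) *+ 2); last by rewrite mulr2n -splitr.
  by rewrite sin_mulr2n -mulr_natl [cos _ * _]mulrC.
have s1 : sin (t / 2) != 0 by apply: contra_neq st => H; rewrite E H mul0r mulr0.
have s2 : sin ((t + pi) / 2) != 0.
  by rewrite mulrDl sinDpihalf; apply: contra_neq st => H; rewrite E H !mulr0.
have -> : mean (fun n => (odd n == b)%:R * cos (n%:R * t + phi)) =
   (fun N => 2^-1 * mean (fun n => cos (n%:R * t + phi)) N
      + 2^-1 * (-1) ^+ b * mean (fun n => cos (n%:R * (t + pi) + phi)) N).
  apply/funext => N; rewrite -!meanZ -meanD; congr (mean _ N); apply/funext => n.
  rewrite parity_weight mulrDl; congr (_ + _).
  by rewrite mulrDr addrAC [_ + n%:R * pi]addrC cos_natDpi mulrA.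
rewrite -[X in _ --> X](_ : 2^-1 * 0 + 2^-1 * (-1) ^+ b * 0 = 0); last by rewrite !mulr0 addr0.
by apply: cvgD; apply: cvgMr; exact: mean_cos_cvg0.
Qed.

Lemma mean_parity b : mean (fun n => (odd n == b)%:R) N @[N --> \oo] --> (2^-1 : R).
Proof.
have -> : mean (fun n => (odd n == b)%:R) =
   (fun N => mean (fun=> 2^-1) N + 2^-1 * (-1) ^+ b * mean (fun n => cos (n%:R * pi + 0)) N).
  apply/funext => N; rewrite -!meanZ -meanD; congr (mean _ N); apply/funext => n.
  by rewrite parity_weight cos_natDpi cos0 mulr1.
rewrite -[X in _ --> X](_ : 2^-1 + 2^-1 * (-1) ^+ b * 0 = 2^-1); last by rewrite mulr0 addr0.
apply: cvgD.
  apply: (@cvg_near_cst _ _ _ _ _ _); near=> N; apply: mean_cst; near: N; exact: nbhs_infty_gt.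
by apply: cvgMr; apply: mean_cos_cvg0; rewrite sin_pihalf oner_neq0.
Unshelve. all: by end_near. Qed.

End Means.

Section Equidistribution.
Variables (R : realType) (d : nat) (theta omega : 'I_d -> R).
Hypothesis indep : int_independent theta.
Notation T := (measurableTypeR R).

(** The coordinates are left unreduced modulo [2 * pi]: the functions evaluated along the orbit are
    periodic. *)
Definition orbit (n : nat) : d.-tuple T := [tuple n%:R * theta j + omega j | j < d].

Lemma phase_orbit a t n :
  phase a t (orbit n) = n%:R * (\sum_j (a j)%:~R * theta j) + phase a t [tuple omega j | j < d].
Proof.
rewrite /phase addrA mulr_sumr -big_split; congr (_ + _); apply: eq_bigr => j _.
by rewrite /= !tnth_mktuple; ring.
Qed.

Lemma weyl_equidistribution b f : trigpoly f ->
  mean (fun n => (odd n == b)%:R * f (orbit n)) N @[N --> \oo] -->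
  2^-1 * \int[torus_haar R d]_y f y.
Proof.
elim=> [c a t|f1 f2 tf1 IH1 tf2 IH2]; last first.
  rewrite RintegralD //; [|exact: trig_integrable..].
  rewrite mulrDr (_ : mean _ = fun N => mean (fun n => (odd n == b)%:R * f1 (orbit n)) N +
     mean (fun n => (odd n == b)%:R * f2 (orbit n)) N); first exact: cvgD.
  by apply/funext => N; rewrite -meanD; congr (mean _ N); apply/funext => n; rewrite mulrDr.
have E : (fun n => (odd n == b)%:R * (c * cos (phase a t (orbit n)))) =
    (fun n => c * ((odd n == b)%:R * cos (phase a t (orbit n)))).
  by apply/funext => n; rewrite mulrCA.
rewrite E RintegralZl //; last first.
  have := trig_integrable (trig_cos 1 a t).
  by congr (_.-integrable _ _); apply/funext => y /=; rewrite mul1r.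
rewrite mulrCA Rintegral_torus_cos.
rewrite (_ : mean _ = fun N => c * mean (fun n => (odd n == b)%:R * cos (phase a t (orbit n))) N); last first.
  by apply/funext => N; rewrite meanZ.
apply: cvgMr; case: ifP => [/forallP a0|/negbT na0].
  rewrite (_ : mean _ = fun N => cos t * mean (fun n => (odd n == b)%:R) N).
    by rewrite mulrC; apply: cvgMr; exact: mean_parity.
  apply/funext => N; rewrite -meanZ; congr (mean _ N); apply/funext => n.
  rewrite mulrC; congr (cos _ * _); rewrite /phase big1 ?add0r // => j _.
  by rewrite (eqP (a0 j)) mul0r.
rewrite mulr0 (_ : mean _ = mean (fun n => (odd n == b)%:R *
  cos (n%:R * (\sum_j (a j)%:~R * theta j) + phase a t [tuple omega j | j < d]))); last first.
  by congr mean; apply/funext => n; rewrite phase_orbit.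
(* A resonance would be an integer relation between pi and the [theta j], forcing all frequencies to
   be 0. *)
apply: mean_parity_cos_cvg0; apply/eqP => /sin_eq0_intMpi[k Ek].
case/negP: na0; apply/forallP => j; apply/eqP; apply: (indep (c0 := - k)).
by rewrite Ek mulrNz mulNr addNr.
Qed.

End Equidistribution.

(** * Polynomial approximation of a step *)

Section StepPolynomials.
Variable R : realType.
Implicit Types (u x : R) (n k : nat).

Lemma bernoulli_lower u n : 0 <= u <= 1 -> 1 - n%:R * u <= (1 - u) ^+ n.
Proof.
case/andP => u0 u1; elim: n => [|n IHn]; first by rewrite mul0r subr0 expr0.
rewrite exprSr -natr1; have n0 : 0 <= (n%:R : R) by [].
apply: (@le_trans _ _ ((1 - n%:R * u) * (1 - u))); first by nra.
by rewrite ler_wpM2r // subr_ge0.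
Qed.

Lemma bernoulli_upper u n : 0 <= u <= 1 -> (1 - u) ^+ n * (1 + n%:R * u) <= 1.
Proof.
case/andP => u0 u1; elim: n => [|n IHn]; first by rewrite mul0r addr0 expr0 mulr1.
apply: le_trans IHn; rewrite exprSr -mulrA -natr1; have n0 : 0 <= (n%:R : R) by [].
by apply: ler_wpM2l; [rewrite exprn_ge0 // subr_ge0|nra].
Qed.

Lemma exists_small_powers (z1 z2 e : R) : 0 <= z1 < 1 -> 0 <= z2 < 1 -> 0 < e ->
  exists k, z1 ^+ k <= e /\ z2 ^+ k <= e.
Proof.
move=> /andP[z10 z11] /andP[z20 z21] e0.
have H z : 0 <= z -> z < 1 -> exists N, forall n, (N <= n)%N -> z ^+ n <= e.
  move=> z0 zl1; have : `|z| < 1 by rewrite ger0_norm.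
  move/cvg_expr/cvgrPdist_le/(_ _ e0) => [N _ HN]; exists N => n Nn.
  by have := HN n Nn; rewrite /= sub0r normrN ger0_norm // exprn_ge0.
have [N1 H1] := H _ z10 z11; have [N2 H2] := H _ z20 z21.
by exists (maxn N1 N2); rewrite H1 ?H2 // ?leq_maxl ?leq_maxr.
Qed.

(* The polynomials [(1 - t ^ k) ^ (2 ^ k)] approximate on [0, 1] the indicator
   function of [t < 1 / 2], by the two Bernoulli inequalities. *)
Lemma step_poly (S c dl e : R) : 0 < dl -> 0 < e -> exists p : {poly R},
  forall x, `|x| <= S ->
    [/\ 0 <= p.[x] <= 1, c + dl <= x -> 1 - e <= p.[x] & x <= c - dl -> p.[x] <= e].
Proof.
(* [W] bounds [x - c] on the range considered, so [x] is carried affinely into [0, 1] with [c] at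
   1/2. The summand 1 keeps [W] positive, and [dl] keeps [eta] at most 1/2. *)
move=> dl0 e0; pose W := `|S| + `|c| + 1 + dl.
have W0 : 0 < W by rewrite ltr_wpDl // ltr_wpDl // addr_ge0.
pose eta := dl / (2 * W).
have eta0 : 0 < eta by rewrite divr_gt0 // mulr_gt0.
have eta1 : eta <= 2^-1.
  by rewrite /eta ler_pdivrMr ?mulr_gt0 // mulrA mulVf // mul1r lerDr ?addr_ge0.
have [k [k1 k2]] : exists k, (1 - 2 * eta) ^+ k <= e /\ (1 + 2 * eta)^-1 ^+ k <= e.
  apply: exists_small_powers => //; first by apply/andP; split; lra.
  by rewrite invr_ge0; apply/andP; split; [lra|rewrite invf_lt1; lra].
pose t : {poly R} := (2^-1 + c / (2 * W))%:P - (2 * W)^-1 *: 'X.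
exists ((1 - t ^+ k) ^+ (2 ^ k)) => x xS.
have tE : t.[x] = 2^-1 - (x - c) / (2 * W).
  rewrite hornerD hornerN hornerZ hornerX hornerC; field; exact: lt0r_neq0.
rewrite horner_exp hornerD hornerN horner_exp hornerC; move: (t.[x]) tE => y yE.
have /andP[xc1 xc2] : - W <= x - c <= W.
  rewrite -ler_norml (le_trans (ler_normB _ _)) // /W.
  by have := ler_norm S; lra.
have W2 : 0 < (2 * W)^-1 by rewrite invr_gt0 mulr_gt0.
have WW : W / (2 * W) = 2^-1 by field; exact: lt0r_neq0.
have y0 : 0 <= y by rewrite yE subr_ge0 -WW ler_wpM2r // ltW.
have y1 : y <= 1.
  have : - W / (2 * W) <= (x - c) / (2 * W) by rewrite ler_wpM2r // ltW.
  rewrite mulNr WW yE; lra.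
have yk : 0 <= y ^+ k <= 1 by rewrite exprn_ge0 //= exprn_ile1.
have E : (2 ^ k)%:R * y ^+ k = (2 * y) ^+ k by rewrite natrX exprMn.
have pk0 : 0 <= (1 - y ^+ k) ^+ (2 ^ k) by rewrite exprn_ge0 // subr_ge0; case/andP: yk.
split.
- rewrite pk0 /= exprn_ile1 ?subr_ge0 //; first by case/andP: yk.
  by rewrite gerBl; case/andP: yk.
- move=> cx; apply: le_trans (bernoulli_lower (2 ^ k) yk).
  have y2 : 2 * y <= 1 - 2 * eta.
    by rewrite /eta yE; have : dl / (2 * W) <= (x - c) / (2 * W); [rewrite ler_wpM2r ?(ltW W2) //; lra|lra].
  by rewrite E lerB //; apply: le_trans k1; rewrite lerXn2r ?nnegrE //; lra.
- move=> xc; have y2 : 1 + 2 * eta <= 2 * y.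
    by rewrite /eta yE; have : (x - c) / (2 * W) <= - dl / (2 * W); [rewrite ler_wpM2r ?(ltW W2) //; lra|rewrite mulNr; lra].
  have := bernoulli_upper (2 ^ k) yk; rewrite E; move: pk0.
  set P := (1 - _) ^+ _ => P0 HP; apply: le_trans k2.
  have z0 : 0 < (1 + 2 * eta) ^+ k by rewrite exprn_gt0 //; lra.
  have y2k : (1 + 2 * eta) ^+ k <= (2 * y) ^+ k.
    by rewrite lerXn2r ?nnegrE //; lra.
  rewrite exprVn -[leRHS]mul1r ler_pdivlMr //; apply: le_trans HP.
  by rewrite ler_wpM2l //; lra.
Qed.

End StepPolynomials.

(** * The distribution of the sine sum *)

Section SineSumLaw.
Variables (R : realType) (d : nat) (beta : 'I_d -> R).
Notation T := (measurableTypeR R).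
Notation mu := (torus_haar R d).
Let g := sine_sum beta.

Lemma measurable_sine_sum : measurable_fun setT g.
Proof. by apply: trig_measurable; exact: trig_sine_sum. Qed.

Lemma measurable_sine_sum_preimage (A : set R) : measurable A -> measurable (g @^-1` A).
Proof. by move=> mA; rewrite -[X in measurable X]setTI; exact: measurable_sine_sum. Qed.

Lemma sine_sum_bound y : `|g y| <= \sum_j `|beta j|.
Proof.
rewrite (le_trans (ler_norm_sum _ _ _)) // ler_sum // => j _.
by rewrite normrM ler_piMr // sin_max.
Qed.

Definition upper_tail (c : R) : R := fine (mu [set y | c < g y]).

Lemma measurable_gt c : measurable [set y | c < g y].
Proof.
rewrite (_ : [set y | _] = g @^-1` `]c, +oo[).
  by apply: measurable_sine_sum_preimage; exact: measurable_itv.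
by apply/seteqP; split => y /=; rewrite in_itv /= andbT.
Qed.

Lemma measurable_level c : measurable [set y | g y = c].
Proof. by apply: (measurable_sine_sum_preimage (measurable_set1 c)). Qed.

Lemma torus_fin (A : set (d.-tuple T)) : measurable A -> mu A = (fine (mu A))%:E.
Proof. by move=> mA; rewrite fineK // fin_num_measure. Qed.

Lemma upper_tailE c : mu [set y | c < g y] = (upper_tail c)%:E.
Proof. exact: (torus_fin (measurable_gt c)). Qed.

Lemma upper_tail_cvg_right c :
  upper_tail (c + n.+1%:R^-1) @[n --> \oo] --> upper_tail c.
Proof.
apply: (@fine_cvg _ _ _ _ (fun n => mu [set y | c + n.+1%:R^-1 < g y])).
rewrite -upper_tailE.
have -> : [set y | c < g y] = \bigcup_n [set y | c + n.+1%:R^-1 < g y].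
  apply/seteqP; split => y /=; last by move=> [n _ /=]; apply: le_lt_trans; rewrite lerDl.
  move=> cg; have [n n1] := ltr_add_invr cg; exists n => //=.
apply: nondecreasing_cvg_mu => [n||n k nk]; first exact: measurable_gt.
  by apply: bigcup_measurable => n _; exact: measurable_gt.
apply/subsetPset => y /=; apply: le_lt_trans.
by rewrite lerD2l lef_pV2 ?posrE // ler_nat.
Qed.

(** The sets decrease to [c <= g], not to [c < g]; hence the assumption on the level set. *)
Lemma upper_tail_cvg_left c : mu [set y | g y = c] = 0%E ->
  upper_tail (c - n.+1%:R^-1) @[n --> \oo] --> upper_tail c.
Proof.
move=> lc; apply: (@fine_cvg _ _ _ _ (fun n => mu [set y | c - n.+1%:R^-1 < g y])).
have -> : (upper_tail c)%:E = mu (\bigcap_n [set y | c - n.+1%:R^-1 < g y]).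
  rewrite -upper_tailE.
  have -> : \bigcap_n [set y | c - n.+1%:R^-1 < g y] = [set y | c < g y] `|` [set y | g y = c].
    apply/seteqP; split => y /=.
      move=> H; have [cy|yc|->] := ltgtP c (g y); [by left| |by right].
      have [n n1] := ltr_add_invr yc; have := H n I; rewrite /= ltrBlDr => /lt_trans/(_ n1).
      by rewrite ltxx.
    case=> [cy|gy] n _ /=; rewrite ltrBlDr ?gy ?ltrDl ?invr_gt0 //.
    by rewrite (lt_trans cy) // ltrDl invr_gt0.
  apply/esym; apply: (null_setU mu (measurable_level c)).1; last exact: measurable_gt.
  by apply/measure0_null_setP => //; exact: measurable_level.
apply: nonincreasing_cvg_mu => [|n||n k nk].
- by apply: (@le_lt_trans _ _ 1%E); [apply: probability_le1; exact: measurable_gt|exact: ltry].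
- exact: measurable_gt.
- by apply: bigcap_measurable => [|n _]; [exists 0%N|exact: measurable_gt].
- apply/subsetPset => y /=; apply: le_lt_trans.
  by rewrite lerD2l lerN2 lef_pV2 ?posrE // ler_nat.
Qed.

Lemma upper_tail_continuous c e : mu [set y | g y = c] = 0%E -> 0 < e ->
  exists2 dl, 0 < dl & upper_tail (c - dl) <= upper_tail c + e /\
                       upper_tail c - e <= upper_tail (c + dl).
Proof.
move=> lc e0.
have /cvgrPdist_le/(_ _ e0)[n1 _ H1] := @upper_tail_cvg_right c.
have /cvgrPdist_le/(_ _ e0)[n2 _ H2] := @upper_tail_cvg_left c lc.
pose n := maxn n1 n2; exists n.+1%:R^-1; first by rewrite invr_gt0.
have := H1 n (leq_maxl _ _); have := H2 n (leq_maxr _ _).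
by rewrite /= !ler_norml => /andP[? ?] /andP[? ?]; split; lra.
Qed.

Lemma Rintegral_gt c : \int[mu]_y \1_[set y | c < g y] y = upper_tail c.
Proof. by rewrite /Rintegral integral_indic ?setIT //; exact: measurable_gt. Qed.

Lemma indic_le1 (A : set (d.-tuple T)) y : `|\1_A y| <= 1 :> R.
Proof. by rewrite /indic; case: (_ \in _); rewrite ?normr1 ?normr0. Qed.

Lemma measurable_indic_gt c : measurable_fun setT (\1_[set y | c < g y] : _ -> R).
Proof. by apply: measurable_indic; exact: measurable_gt. Qed.

Lemma integrable_gt c : mu.-integrable setT (EFin \o \1_[set y | c < g y]).
Proof.
exact: (bounded_prob_integrable mu (measurable_indic_gt c) (indic_le1 _)).
Qed.

Lemma integrable_gtDcst c e :
  mu.-integrable setT (EFin \o (fun y => \1_[set y | c < g y] y + e)).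
Proof.
apply: (@bounded_prob_integrable _ _ _ mu _ (1 + `|e|)).
  by apply: measurable_funD => //; exact: measurable_indic_gt.
by move=> y; rewrite (le_trans (ler_normD _ _)) // lerD2r indic_le1.
Qed.

Lemma Rintegral_gtDcst c e :
  \int[mu]_y (\1_[set y | c < g y] y + e) = upper_tail c + e.
Proof.
rewrite RintegralD //; last 2 first.
- exact: integrable_gt.
- exact: (trig_integrable (trig_cst d e)).
by rewrite Rintegral_gt Rintegral_prob_cst.
Qed.

Lemma Rintegral_poly_le p c e : (forall y, p.[g y] <= \1_[set y | c < g y] y + e) ->
  \int[mu]_y p.[g y] <= upper_tail c + e.
Proof.
move=> H; rewrite -Rintegral_gtDcst; apply: le_Rintegral => //.
- exact: (trig_integrable (trig_horner p (trig_sine_sum beta))).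
- exact: integrable_gtDcst.
Qed.

Lemma Rintegral_poly_ge p c e : (forall y, \1_[set y | c < g y] y + e <= p.[g y]) ->
  upper_tail c + e <= \int[mu]_y p.[g y].
Proof.
move=> H; rewrite -Rintegral_gtDcst; apply: le_Rintegral => //.
- exact: integrable_gtDcst.
- exact: (trig_integrable (trig_horner p (trig_sine_sum beta))).
Qed.

End SineSumLaw.

(** By Tonelli with the last coordinates fixed: since [beta ord0] is nonzero, the equation
    prescribes the sine of the first coordinate, which happens on a null set. *)
Lemma sine_sum_level_null (R : realType) (d : nat) (beta : 'I_d -> R) (c : R) :
  (0 < d)%N -> (forall j, beta j != 0) ->
  torus_haar R d [set y | sine_sum beta y = c] = 0%E.
Proof.
case: d beta => // d beta _ b0.
pose A := @cons_pair R d @^-1` [set y | sine_sum beta y = c].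
have mA : measurable A.
  rewrite -[A]setTI; apply: measurable_cons_pair => //; exact: measurable_level.
change ((circle_haar R \x torus_haar R d)%E A = 0%E).
rewrite -[A]setIT -integral_indic // fubini_tonelli2; last 2 first.
- by apply/measurable_EFinP; exact: measurable_indic.
- by move=> z; rewrite lee_fin.
rewrite (eq_integral (fun=> 0%E)) ?integral0 // => y _.
pose s := (c - \sum_(j < d) beta (lift ord0 j) * sin (tnth y j)) / beta ord0.
transitivity (\int[circle_haar R]_x (\1_[set x : measurableTypeR R | sin x = s] x)%:E)%E; last first.
  rewrite integral_indic // ?setIT; first exact: circle_sin_level.
  apply: countable_measurable; last exact: countable_sin_level.
  by move=> x; exact: measurable_set1.
apply: eq_integral => x _; congr (_%:E); rewrite /indic; congr ((_ : bool)%:R).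
have AE : A (x, y) <-> sin x = s.
  rewrite /A /= /sine_sum big_ord_recl (tnth_nth x) /=.
  under eq_bigr => j _ do rewrite (tnth_nth x) /= -(tnth_nth x).
  rewrite /s; split=> [<-|->]; first by rewrite addrK mulrC mulKf.
  by rewrite mulrC divfK // subrK.
by apply/idP/idP => /set_mem/AE/mem_set.
Qed.

(** * Sign densities *)

Section Density.
Variables (R : realType) (d : nat) (theta omega beta : 'I_d -> R).
Hypotheses (indep : int_independent theta) (d_gt0 : (0 < d)%N) (beta_neq0 : forall j, beta j != 0).
Notation mu := (torus_haar R d).
Notation g := (sine_sum beta).
Notation X n := (sine_sum beta (orbit theta omega n)).

Lemma mean_initial_cvg0 n0 : mean (fun n => (n < n0)%:R) N @[N --> \oo] --> (0 : R).
Proof.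
apply: (@mean_cvg0 _ _ n0%:R) => N.
have H : (\sum_(1 <= n < N.+1) (n < n0 : nat) <= minn N n0)%N.
  elim: N => [|N IHN]; first by rewrite big_geq.
  rewrite big_nat_recr //=; move: IHN; move: (\sum_(1 <= n < N.+1) _)%N => s.
  by case: (ltnP N.+1 n0) => h /=; lia.
by rewrite -natr_sum normr_nat ler_nat (leq_trans H) // geq_minr.
Qed.

(** The hypothesis says that [E n] is the condition [c < X n] up to an error tending to 0. Null
    level sets make the tail continuous at [c], which absorbs this error. *)
Lemma density_half b (E : nat -> bool) c :
  (forall dl, 0 < dl -> exists n0, forall n, (n0 <= n)%N -> odd n = b ->
     (c + dl <= X n -> E n) /\ (E n -> c - dl <= X n)) ->
  mean (fun n => ((odd n == b) && E n)%:R) N @[N --> \oo] --> 2^-1 * upper_tail beta c.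
Proof.
move=> HE; apply/cvgrPdist_le => e0 e0_gt0.
(* One [e] each for the Weyl limit, the defect of the step polynomial along the orbit, the initial
   segment, and half of the [2 * e] in the integral. *)
pose e := e0 / 4; have e_gt0 : 0 < e by rewrite divr_gt0.
pose S := \sum_j `|beta j|.
have [dl dl0 [U1 U2]] := upper_tail_continuous (sine_sum_level_null c d_gt0 beta_neq0) e_gt0.
(* One third of [dl] allows for the error in [E], and two thirds for the transition of each
   polynomial: [p1] falls between [c - dl3] and [c - dl], and [p2] rises between [c + dl3] and
   [c + dl]. *)
pose dl3 := dl / 3; have dl30 : 0 < dl3 by rewrite divr_gt0.
have [n0 Hn0] := HE dl3 dl30.
have [p1 Hp1] := step_poly S (c - 2 * dl3) dl30 e_gt0.
have [p2 Hp2] := step_poly S (c + 2 * dl3) dl30 e_gt0.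
have dlE : dl = 3 * dl3 by rewrite /dl3; field.
have I1 : \int[mu]_y p1.[g y] <= upper_tail beta c + 2 * e.
  apply: (@le_trans _ _ (upper_tail beta (c - dl) + e)); last by lra.
  apply: Rintegral_poly_le => y; have [/andP[p0 p1'] _ H] := Hp1 (g y) (sine_sum_bound beta y).
  rewrite /indic; case: (boolP (y \in _)) => [_|/negP ny]; first by rewrite /=; lra.
  rewrite add0r H // leNgt; apply/negP => gy; apply: ny; apply: mem_set => /=; lra.
have I2 : upper_tail beta c - 2 * e <= \int[mu]_y p2.[g y].
  apply: (@le_trans _ _ (upper_tail beta (c + dl) - e)); first by lra.
  apply: Rintegral_poly_ge => y; have [/andP[p0 p1'] H _] := Hp2 (g y) (sine_sum_bound beta y).
  rewrite /indic; case: (boolP (y \in _)) => [/set_mem /= gy|_]; last by rewrite /=; lra.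
  by rewrite H //; lra.
have W1 := weyl_equidistribution omega indep b (trig_horner p1 (trig_sine_sum beta)).
have W2 := weyl_equidistribution omega indep b (trig_horner p2 (trig_sine_sum beta)).
have Z := mean_initial_cvg0 n0.
move/cvgrPdist_le : W1 => /(_ e e_gt0) W1.
move/cvgrPdist_le : W2 => /(_ e e_gt0) W2.
move/cvgrPdist_le : Z => /(_ e e_gt0) Z.
near=> N.
have N0 : (0 < N)%N by near: N; exact: nbhs_infty_gt.
have Z' : `|0 - mean (fun n => (n < n0)%:R) N| <= e by near: N; exact: Z.
have W1' : `|2^-1 * \int[mu]_y p1.[g y] - mean (fun n => (odd n == b)%:R * p1.[X n]) N| <= e.
  by near: N; exact: W1.
have W2' : `|2^-1 * \int[mu]_y p2.[g y] - mean (fun n => (odd n == b)%:R * p2.[X n]) N| <= e.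
  by near: N; exact: W2.
have up : mean (fun n => ((odd n == b) && E n)%:R) N <=
    mean (fun n => (odd n == b)%:R * p1.[X n]) N + e + mean (fun n => (n < n0)%:R) N.
  rewrite -[Y in _ <= _ + Y + _](mean_cst e N0) -!meanD; apply: le_mean => n.
  have [/andP[p0 p1'] H _] := Hp1 (X n) (sine_sum_bound beta _).
  case: eqP => [ob|_] /=; last by rewrite mul0r; case: (n < n0)%N => /=; lra.
  rewrite mul1r; case En : (E n) => /=; last by case: (n < n0)%N => /=; lra.
  case: ltnP => [_|nn]; first by rewrite /=; lra.
  have [_ /(_ En) cX] := Hn0 n nn ob.
  by rewrite /=; have := H _; lra.
have lo : mean (fun n => (odd n == b)%:R * p2.[X n]) N - e - mean (fun n => (n < n0)%:R) N <=
    mean (fun n => ((odd n == b) && E n)%:R) N.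
  rewrite lerBlDr lerBlDr -[Y in _ <= _ + Y](mean_cst e N0) -!meanD; apply: le_mean => n.
  have [/andP[p0 p1'] _ H] := Hp2 (X n) (sine_sum_bound beta _).
  case: eqP => [ob|_] /=; last by rewrite mul0r; case: (n < n0)%N => /=; lra.
  rewrite mul1r; case En : (E n) => /=; first by case: (n < n0)%N => /=; lra.
  case: ltnP => [_|nn]; first by rewrite /=; lra.
  have [cX _] := Hn0 n nn ob.
  have Xc : X n < c + dl3 by rewrite ltNge; apply/negP => /cX; rewrite En.
  by rewrite /=; have := H _; lra.
move: Z' W1' W2'; rewrite !ler_norml => /andP[z1 z2] /andP[w1 w2] /andP[w3 w4].
have e4 : e0 = 4 * e by rewrite /e; field.
by apply/andP; split; lra.
Unshelve. all: by end_near. Qed.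

End Density.

Section DensityFormula.
Variables (R : realType) (d : nat) (theta omega beta : 'I_d -> R).
Hypotheses (indep : int_independent theta) (d_gt0 : (0 < d)%N) (beta_neq0 : forall j, beta j != 0).
Notation mu := (torus_haar R d).
Notation g := (sine_sum beta).
Notation X n := (sine_sum beta (orbit theta omega n)).

(* Replacing [omega] by [omega + pi] turns the sequence [X] into [- X]. *)
Lemma upper_tail_sym c : upper_tail beta c + upper_tail beta (- c) = 1.
Proof.
have XN n : sine_sum beta (orbit theta (fun j => omega j + pi) n) = - X n.
  rewrite /sine_sum -sumrN; apply: eq_bigr => j _.
  by rewrite !tnth_mktuple addrA sinDpi mulrN.
have D1 : mean (fun n => ((odd n == false) && (- c <= X n))%:R) N @[N --> \oo] -->
    2^-1 * upper_tail beta (- c).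
  by apply: (density_half (omega := omega) indep d_gt0 beta_neq0) => dl dl0; exists 0%N; move=> n _ _; split; lra.
have D2 : mean (fun n => ((odd n == false) && (X n < - c))%:R) N @[N --> \oo] -->
    2^-1 * upper_tail beta c.
  apply: (density_half (omega := fun j => omega j + pi) indep d_gt0 beta_neq0) => dl dl0.
  by exists 0%N; move=> n _ _; rewrite XN; split; lra.
(* The two events partition the even integers, whose density is 1/2. *)
have E : mean (fun n => ((odd n == false) && (- c <= X n))%:R) \+
    mean (fun n => ((odd n == false) && (X n < - c))%:R) =
    mean (fun n => (odd n == false)%:R) :> (nat -> R).
  apply/funext => N; rewrite /= -meanD; congr (mean _ N); apply/funext => n.
  by rewrite ltNge; case: (odd n == false); case: (- c <= X n); rewrite /= ?addr0 ?add0r.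
have D : mean (fun n => (odd n == false)%:R) N @[N --> \oo] -->
    2^-1 * upper_tail beta (- c) + 2^-1 * upper_tail beta c by rewrite -E; exact: cvgD D1 D2.
have H : (2^-1 : R) = 2^-1 * upper_tail beta (- c) + 2^-1 * upper_tail beta c.
  by apply: (cvg_unique _ (mean_parity false) D); exact: Rhausdorff.
move: H; lra.
Qed.

Lemma haar_between_tail lo hi : lo < hi ->
  upper_tail beta lo = haar_between beta lo hi + upper_tail beta hi.
Proof.
move=> lohi; have level0 := sine_sum_level_null hi d_gt0 beta_neq0.
have mb : measurable [set y | lo < g y < hi].
  rewrite (_ : [set y | _] = g @^-1` `]lo, hi[).
    by apply: measurable_sine_sum_preimage; exact: measurable_itv.
  by apply/seteqP; split => y /=; rewrite in_itv.
apply: EFin_inj; rewrite EFinD -!upper_tailE /haar_between -torus_fin //.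
have -> : [set y | lo < g y] = [set y | lo < g y < hi] `|` ([set y | hi < g y] `|` [set y | g y = hi]).
  apply/seteqP; split => y /=.
    by move=> ->; case: (ltgtP (g y) hi); [left|right; left|right; right].
  by case=> [/andP[]//|[|->//]]; exact: lt_trans.
rewrite measureU //; last 2 first.
- by apply: measurableU; [exact: measurable_gt|exact: measurable_level].
- apply/seteqP; split => // y /= [/andP[_ gh]] [|E]; last by rewrite E ltxx in gh.
  by move/lt_trans => /(_ _ gh); rewrite ltxx.
congr (_ + _)%E.
apply: (null_setU mu (measurable_level beta hi)).1; last exact: measurable_gt.
by apply/measure0_null_setP => //; exact: measurable_level.
Qed.

(** [a false] and [a true] belong to even and odd indices. Symmetry replaces the tail at [- a false]
    by 1 minus the tail at [a false]; the difference of tails left over is an interval probability,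
    as [- a true < a false]. *)
Lemma density_formula (E : nat -> bool) (a : bool -> R) : 0 < a false + a true ->
  (forall b dl, 0 < dl -> exists n0, forall n, (n0 <= n)%N -> odd n = b ->
     (- a b + dl <= X n -> E n) /\ (E n -> - a b - dl <= X n)) ->
  freq R E N @[N --> \oo] --> 1 / 2 + 1 / 2 * haar_between beta (- a true) (a false).
Proof.
move=> a0 HE; have D b := density_half indep d_gt0 beta_neq0 (HE b).
have -> : freq R E = mean (fun n => ((odd n == false) && E n)%:R) \+
    mean (fun n => ((odd n == true) && E n)%:R).
  apply/funext => N; rewrite /= -meanD /freq /mean natr_sum; congr (_ / _).
  by apply: eq_bigr => n _; case: (odd n); rewrite /= ?addr0 ?add0r.
rewrite (_ : 1 / 2 + _ = 2^-1 * upper_tail beta (- a false) + 2^-1 * upper_tail beta (- a true)).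
  exact: cvgD (D false) (D true).
have lohi : - a true < a false by lra.
rewrite (haar_between_tail lohi); have := upper_tail_sym (a false); lra.
Qed.

End DensityFormula.

(** * Positive measure of open conditions on the sine sum *)

Section Positivity.
Variables (R : realType) (d : nat) (beta : 'I_d -> R).

Lemma sin_lipschitz (x y : R) : `|sin x - sin y| <= `|x - y|.
Proof.
wlog xy : x y / y <= x.
  by move=> H; have [/H//|/ltW/H] := leP y x; rewrite distrC [leRHS]distrC.
have [|c _ ->] := @MVT_segment R sin cos y x xy (fun z _ => is_derive_sin z).
  by apply: continuous_subspaceT; exact: continuous_sin.
by rewrite normrM ler_piMl // ler_norml cos_geN1 cos_le1.
Qed.

Lemma circle_haar_itv_gt0 (a b : R) : 0 <= a -> a < b -> b <= 2 * pi ->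
  (0 < circle_haar R `[a, b])%E.
Proof.
move=> a0 ab b2; rewrite /circle_haar /uniform_prob.
change (0 < \int[lebesgue_measure]_(x in `[a, b]) (uniform_pdf 0 (2 * pi) x)%:E)%E.
rewrite (eq_integral (fun=> ((2 * pi - 0)^-1)%:E)).
  rewrite integral_cst //= lebesgue_measure_itv /= lte_fin ab -EFinD -EFinM lte_fin.
  by rewrite mulr_gt0 ?invr_gt0 ?subr0 ?twopi_gt0 // subr_gt0.
move=> x /set_mem /=; rewrite in_itv /= => /andP[ax xb]; rewrite /uniform_pdf.
by rewrite (le_trans a0 ax) (le_trans xb b2).
Qed.

(** Some value [t] strictly between the bounds is attained, and the Lipschitz bound for sine keeps
    the sum between them on a box around that point. *)
Lemma haar_between_gt0 lo hi : lo < hi -> (exists j, beta j != 0) ->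
  lo < \sum_j `|beta j| -> - (\sum_j `|beta j|) < hi ->
  0 < haar_between beta lo hi.
Proof.
move=> lohi [j0 bj0]; set S := \sum_j `|beta j| => loS Shi.
have S0 : 0 < S.
  rewrite /S (bigD1 j0) //= ltr_pwDl ?normr_gt0 // sumr_ge0 //.
pose t := (Num.max lo (- S) + Num.min hi S) / 2.
have ml : Num.max lo (- S) < Num.min hi S.
  by rewrite gt_max !lt_min lohi loS Shi /=; lra.
have /andP[lot Smt] : (lo < t) && (- S < t) by rewrite -gt_max /t; lra.
have /andP[thi tS] : (t < hi) && (t < S) by rewrite -lt_min /t; lra.
have pi0 := pi_gt0 R.
(* With these sines each summand is the norm of [beta j] times [t / S], so the sum is [t]. *)
pose v j : R := Num.sg (beta j) * (t / S).
have v1 j : -1 <= v j <= 1.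
  have tS1 : `|t / S| <= 1.
    by rewrite normrM normfV (gtr0_norm S0) ler_pdivrMr // mul1r ler_norml !ltW.
  rewrite -ler_norml /v normrM normr_sg; case: (beta j != 0); rewrite ?mul1r ?mul0r ?ler01 //.
(* The reflected arcsine lies in [pi / 2, 3 pi / 2], so an interval of radius at most [pi / 2]
   around it stays inside [0, 2 pi], where the uniform density lives. *)
pose y0 j : R := pi - asin (v j).
have y01 j : pi / 2 <= y0 j.
  by have := asin_lepi2 (v1 j); rewrite /y0; lra.
have y02 j : y0 j <= 3 / 2 * pi.
  by have := asin_geNpi2 (v1 j); rewrite /y0; lra.
have siny0 j : sin (y0 j) = v j.
  by rewrite /y0 sinB sinpi cospi mul0r sub0r mulN1r opprK asinK // in_itv /=; exact: v1.
have gt : \sum_j beta j * sin (y0 j) = t.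
  transitivity (\sum_j `|beta j| * (t / S)); last by rewrite -mulr_suml mulrC divfK // gt_eqF.
  by apply: eq_bigr => j _; rewrite siny0 /v normrEsg; ring.
pose rho := Num.min (t - lo) (hi - t).
have rho0 : 0 < rho by rewrite lt_min !subr_gt0 lot.
pose eta := Num.min (pi / 2) (rho / (2 * S)).
have eta0 : 0 < eta by rewrite lt_min !divr_gt0 // mulr_gt0.
have eta1 : eta <= pi / 2 by rewrite ge_min lexx.
have eta2 : S * eta < rho.
  apply: (@le_lt_trans _ _ (S * (rho / (2 * S)))).
    by rewrite ler_pM2l // ge_min lexx orbT.
  have -> : S * (rho / (2 * S)) = rho / 2 by field; exact: lt0r_neq0.
  lra.
pose A j : set (measurableTypeR R) := `[y0 j - eta, y0 j + eta].
have box := @torus_haar_box R d A (fun j => measurable_itv _).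
have mbox : measurable [set y : d.-tuple (measurableTypeR R) | forall j, A j (tnth y j)].
  rewrite (_ : [set y | _] = \bigcap_(j in [set: 'I_d]) ((@tnth _ _ ^~ j) @^-1` A j)).
    apply: fin_bigcap_measurable => // j _.
    by rewrite -[X in measurable X]setTI; apply: measurable_tnth => //; exact: measurable_itv.
  by apply/seteqP; split => y /= Ay j => [_|]; exact: Ay.
have mbet : measurable [set y | lo < sine_sum beta y < hi].
  rewrite (_ : [set y | _] = sine_sum beta @^-1` `]lo, hi[).
    by apply: measurable_sine_sum_preimage; exact: measurable_itv.
  by apply/seteqP; split => y /=; rewrite in_itv.
have sub : [set y : d.-tuple (measurableTypeR R) | forall j, A j (tnth y j)]
    `<=` [set y | lo < sine_sum beta y < hi].
  move=> y Ay /=; have : `|sine_sum beta y - t| < rho.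
    apply: le_lt_trans eta2; rewrite -gt -sumrB (le_trans (ler_norm_sum _ _ _)) //.
    rewrite mulr_suml ler_sum // => j _; rewrite -mulrBr normrM ler_wpM2l //.
    rewrite (le_trans (sin_lipschitz _ _)) // ler_norml.
    by have := Ay j; rewrite /A /= in_itv /= => /andP[? ?]; apply/andP; split; lra.
  rewrite lt_min !ltr_norml => /andP[/andP[h1 h2] /andP[h3 h4]].
  by apply/andP; split; lra.
rewrite /haar_between -lte_fin -torus_fin //.
apply: (@lt_le_trans _ _ (torus_haar R d [set y | forall j, A j (tnth y j)])).
  rewrite box; elim/big_ind: _ => [|u v' u0 v0|j _]; [exact: lte01|exact: mule_gt0|].
  by apply: circle_haar_itv_gt0; have := y01 j; have := y02 j; lra.
by apply: le_measure => //; apply: mem_set.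
Qed.

End Positivity.

Local Close Scope classical_set_scope.

(** * From the expansion to the densities *)

Section Asymptotics.
Variable R : realType.

(* Bernoulli for [sqrt s] bounds [s ^ n] below by a multiple of [n ^ 2]. *)
Lemma linear_lt_exp (s K c dl : R) : 1 < s -> 0 < dl ->
  exists n0, forall n, (n0 <= n)%N -> `|K * n%:R + c| < dl * s ^+ n.
Proof.
move=> s1 dl0; have t1 : 1 < Num.sqrt s by exact: sq_gt1.
set t := Num.sqrt s in t1; have t0 : 0 < t - 1 by lra.
have bernoulli n : n%:R * (t - 1) <= t ^+ n.
  elim: n => [|n IHn]; first by rewrite mul0r.
  have tn1 : 1 <= t ^+ n by rewrite exprn_ege1 // ltW.
  by rewrite -natr1 exprS; nra.
pose B := `|K| + `|c|; pose x := B / (dl * (t - 1) ^+ 2).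
have Bx : B = x * (dl * (t - 1) ^+ 2).
  by rewrite /x divfK // mulf_neq0 ?expf_neq0 ?gt_eqF.
exists (Num.bound `|x|).+1 => n n0.
have n1 : 1 <= n%:R :> R by rewrite ler1n; lia.
have xn : x < n%:R.
  apply: le_lt_trans (ler_norm x) _; apply: lt_trans (archi_boundP (normr_ge0 x)) _.
  by rewrite ltr_nat.
apply: (@le_lt_trans _ _ (B * n%:R)).
  apply: le_trans (ler_normD _ _) _; rewrite normrM normr_nat /B mulrDl lerD2l.
  by rewrite ler_peMr.
apply: (@lt_le_trans _ _ (dl * (n%:R * (t - 1)) ^+ 2)).
  rewrite Bx [ltRHS](_ : _ = n%:R * (dl * (t - 1) ^+ 2) * n%:R); last by ring.
  by rewrite !ltr_pM2r ?mulr_gt0 ?exprn_gt0 //; lra.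
rewrite ler_pM2l // -(sq2 s1) -exprM mulnC exprM lerXn2r ?nnegrE //.
  by rewrite mulr_ge0 // ltW.
Qed.

(* With [D delta = 1 - e^(-it) / sqrt q] in polar form, this is the imaginary
   part of [e^(i(x - delta)) (1 - e^(-it) / sqrt q) = D e^(ix)]. *)
Lemma sin_telescope (q t : R) : 1 < q ->
  let D := Num.sqrt (1 - 2 * (Num.sqrt q)^-1 * cos t + q^-1) in
  D != 0 /\ exists delta, forall x,
    sin (x - delta) - (Num.sqrt q)^-1 * sin (x - t - delta) = D * sin x.
Proof.
move=> q1 D; set s := Num.sqrt q.
have s1 : 1 < s by exact: sq_gt1.
have s0 : 0 < s^-1 by rewrite invr_gt0; lra.
have sV1 : s^-1 < 1 by rewrite invf_lt1 //; lra.
have c1 := cos_le1 t; have cs := cos2Dsin2 t.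
pose a := 1 - s^-1 * cos t; pose b := s^-1 * sin t.
have a0 : 0 < a by rewrite /a; nra.
have ab : 1 - 2 * s^-1 * cos t + q^-1 = a ^+ 2 + b ^+ 2.
  have -> : q^-1 = s^-1 ^+ 2 by rewrite exprVn sq2.
  rewrite /a /b.
  rewrite [RHS](_ : _ = 1 - 2 * s^-1 * cos t + s^-1 ^+ 2 * (cos t ^+ 2 + sin t ^+ 2)); last by ring.
  by rewrite cs mulr1.
have D2 : D ^+ 2 = a ^+ 2 + b ^+ 2.
  by rewrite /D -/s ab sqr_sqrtr // addr_ge0 ?sqr_ge0.
have D0 : D != 0 by apply/eqP => D0; move: D2; rewrite D0; nra.
split => //.
have [|delta [ad bd]] := @polar_unit R (a / D) (b / D).
  by rewrite !expr_div_n -mulrDl -D2 mulfV // expf_neq0.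
exists delta => x.
have aD : a = D * cos delta by rewrite -ad mulrC divfK.
have bD : b = D * sin delta by rewrite -bd mulrC divfK.
have -> : x - t - delta = (x - delta) - t by ring.
have -> : sin x = sin ((x - delta) + delta) by rewrite subrK.
rewrite [sin (x - delta - t)]sinB [sin (x - delta + delta)]sinD.
move: (sin (x - delta)) (cos (x - delta)) => u v.
transitivity (u * a + v * b); first by rewrite /a /b; ring.
by rewrite aD bD; ring.
Qed.

(** The main coefficient of the partial sums: one factor [1 - u] in the denominator for odd [M], a
    double one for even [M]. *)
Definition total_coef (q : R) (e : bool) (C E O : R) (n : nat) : R :=
  if e then
    if odd n then C * ((2 * Num.sqrt q ^+ 3 * E + (q ^+ 2 + q) * O) / (q - 1) ^+ 2)
    else C * (((q ^+ 2 + q) * E + 2 * Num.sqrt q ^+ 3 * O) / (q - 1) ^+ 2)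
  else main_coef q true C E O n.

(** Multiplied by [Num.sqrt q ^+ n.+1], this says that the increments of the main term of the
    partial sums form the main term of [b_lambda]. *)
Lemma total_coef_telescope (q : R) e C E O n : 1 < q ->
  total_coef q e C E O n.+1 - (Num.sqrt q)^-1 * total_coef q e C E O n = main_coef q e C E O n.+1.
Proof.
move=> q1; have s1 := sq_gt1 q1.
rewrite /total_coef /main_coef /= -[q in q ^+ 2](sq2 q1).
move: (Num.sqrt q) s1 (sq2 q1) => s s1 <-.
have s0 : s != 0 by rewrite gt_eqF //; lra.
have s2 : s ^+ 2 - 1 != 0 by rewrite gt_eqF //; nra.
by case: e; case: (odd n) => /=; field; rewrite s0 s2.
Qed.

Lemma total_coef_gt0 (q : R) e C E O : 1 < q -> 0 < C -> 0 < E + O ->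
  0 < total_coef q e C E O false + total_coef q e C E O true.
Proof.
move=> q1 C0 EO; have s1 := sq_gt1 q1; have s2 := sq2 q1.
rewrite /total_coef /main_coef; case: e => /=; rewrite -mulrDr mulr_gt0 // -mulrDl.
  rewrite divr_gt0 ?exprn_gt0 //; last by lra.
  rewrite [ltRHS](_ : _ = (q ^+ 2 + q + 2 * Num.sqrt q ^+ 3) * (E + O)); last by ring.
  by rewrite mulr_gt0 // !addr_gt0 ?mulr_gt0 ?exprn_gt0 //; lra.
rewrite divr_gt0 //; last by lra.
rewrite [ltRHS](_ : _ = (q + Num.sqrt q) * (E + O)); last by ring.
by rewrite mulr_gt0 //; lra.
Qed.

Lemma main_coef_gt0 (q : R) e C E O : 1 < q -> 0 < C -> 0 < E + O ->
  0 < main_coef q e C E O false + main_coef q e C E O true.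
Proof.
case: e; first exact: (@total_coef_gt0 _ false).
by move=> _ C0 EO; rewrite /main_coef /= -mulrDr mulr_gt0.
Qed.

End Asymptotics.

Section SignDensity.
Local Open Scope classical_set_scope.
Variables (R : realType) (d : nat) (theta omega beta : 'I_d -> R).
Hypotheses (indep : int_independent theta) (d_gt0 : (0 < d)%N) (beta_neq0 : forall j, beta j != 0).

(** Division by [Num.sqrt q ^+ n] makes the remainder tend to 0. It is allowed to be linear because
    summing the constant of [b_lambda] gives a multiple of [n]. *)
Lemma sign_density (q K c : R) (a : bool -> R) (D : nat -> R) (N0 : nat) :
  1 < q -> 0 < a false + a true ->
  (forall n, (N0 <= n)%N -> D n =
     Num.sqrt q ^+ n * (a (odd n) + \sum_j beta j * sin (n%:R * theta j + omega j))
     + (K * n%:R + c)) ->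
  freq R (fun n => 0 < D n) N @[N --> \oo] -->
    1 / 2 + 1 / 2 * haar_between beta (- a true) (a false).
Proof.
move=> q1 a0 HD; apply: (density_formula (omega := omega) indep d_gt0 beta_neq0 a0) => b dl dl0.
have s1 := sq_gt1 q1; have [n0 Hn0] := linear_lt_exp K c s1 dl0.
exists (maxn N0 n0) => n; rewrite geq_max => /andP[nN0 nn0] nb.
have := Hn0 n nn0; rewrite ltr_norml => /andP[e1 e2].
have sn : 0 < Num.sqrt q ^+ n by rewrite exprn_gt0 //; lra.
rewrite (HD n nN0) nb.
have -> : \sum_j beta j * sin (n%:R * theta j + omega j) = sine_sum beta (orbit theta omega n).
  by apply: eq_bigr => j _; rewrite tnth_mktuple.
move: (sine_sum _ _) => x; move: (K * _ + c) e1 e2 => err e1 e2.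
split => h; first by nra.
rewrite leNgt; apply/negP => hx.
have : Num.sqrt q ^+ n * (a b + x) < Num.sqrt q ^+ n * (- dl) by rewrite ltr_pM2l //; lra.
lra.
Qed.

End SignDensity.

Section Summation.
Variables (R : realType) (F : finFieldType) (m : {poly F}) (M : nat) (theta : 'I_(Mprime M) -> R).

Lemma a_minus_lt_a_plus n : (a_minus n m < a_plus n m)%N = (0 < (b_lambda n m)%:~R :> R).
Proof. by rewrite /b_lambda ltr0z subr_gt0 ltz_nat. Qed.

Definition B_lambda n : R := (A_plus n m)%:R - (A_minus n m)%:R.

Lemma A_minus_lt_A_plus n : (A_minus n m < A_plus n m)%N = (0 < B_lambda n).
Proof. by rewrite /B_lambda subr_gt0 ltr_nat. Qed.

Lemma B_lambdaS n : B_lambda n.+1 = B_lambda n + (b_lambda n.+1 m)%:~R.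
Proof.
have recr f : (\sum_(1 <= k < n.+2) f k = \sum_(1 <= k < n.+1) f k + f n.+1)%N.
  by rewrite big_nat_recr.
rewrite /B_lambda /A_plus /A_minus !recr /b_lambda !natrD !pmulrn intrB.
ring.
Qed.

(** Summation by telescoping: [sin_telescope] determines the phase shifts [delta] and the division
    that turns [beta] into [beta']. *)
Lemma B_lambda_expansion (q C K : R) (beta omega : 'I_(Mprime M) -> R) :
  1 < q ->
  (forall n, (2 * M <= n)%N -> (b_lambda n m)%:~R =
    Num.sqrt q ^+ n * (main_coef q (~~ odd M) C (e_even theta) (e_odd theta) n
                       + \sum_j beta j * sin (n%:R * theta j + omega j)) + K) ->
  exists (omega' : 'I_(Mprime M) -> R) c, forall n, (2 * M <= n)%N -> B_lambda n =
    Num.sqrt q ^+ n * (total_coef q (~~ odd M) C (e_even theta) (e_odd theta) n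
                       + \sum_j beta' q theta beta j * sin (n%:R * theta j + omega' j))
    + (K * n%:R + c).
Proof.
move=> q1 Hb; have s1 := sq_gt1 q1.
have s0 : Num.sqrt q != 0 by rewrite gt_eqF //; lra.
have [delta Hdelta] := choice (fun j => (sin_telescope (theta j) q1).2).
exists (fun j => omega j - delta j).
pose T n := Num.sqrt q ^+ n * (total_coef q (~~ odd M) C (e_even theta) (e_odd theta) n +
  \sum_j beta' q theta beta j * sin (n%:R * theta j + (omega j - delta j))).
(* The constant of summation, fixed by the value at [2 * M], where the range of the expansion
   begins. *)
exists (B_lambda (2 * M) - T (2 * M)%N - K * (2 * M)%N%:R).
elim=> [|n IHn] Mn; rewrite -/(T _); first by move: Mn; rewrite leqn0 => /eqP ->; ring.
have [->|nM] := eqVneq (2 * M)%N n.+1; first by ring.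
have {}Mn : (2 * M <= n)%N by move: Mn; rewrite leq_eqVlt (negPf nM).
rewrite B_lambdaS IHn // (Hb n.+1 (leqW Mn)) // -/(T n).
suff -> : T n.+1 = T n + Num.sqrt q ^+ n.+1 *
    (main_coef q (~~ odd M) C (e_even theta) (e_odd theta) n.+1 +
     \sum_j beta j * sin (n.+1%:R * theta j + omega j)).
  by rewrite -natr1; ring.
rewrite /T -(total_coef_telescope _ _ _ _ _ q1).
have -> : \sum_j beta j * sin (n.+1%:R * theta j + omega j) =
    \sum_j beta' q theta beta j * sin (n.+1%:R * theta j + (omega j - delta j)) -
    (Num.sqrt q)^-1 * \sum_j beta' q theta beta j * sin (n%:R * theta j + (omega j - delta j)).
  rewrite mulr_sumr -sumrB; apply: eq_bigr => j _.
  have D0 := (sin_telescope (theta j) q1).1.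
  apply: (mulfI D0); rewrite mulrCA -(Hdelta j) /beta'.
  rewrite addrA (_ : _ + omega j - theta j - delta j = n%:R * theta j + (omega j - delta j)); last first.
    by rewrite -natr1; ring.
  move: D0; move: (Num.sqrt (_ + q^-1)) (sin (_ - delta j)) (sin (_ + (omega j - _))) => D x y D0.
  by field; rewrite s0 D0.
by rewrite exprS; field.
Qed.

End Summation.

Section Densities.
Local Open Scope classical_set_scope.
Variables (R : realType) (F : finFieldType) (m : {poly F}) (M r : nat).
Variables (p : 'I_r -> {poly F}) (theta : 'I_(Mprime M) -> R).
Hypotheses (m_monic : m \is monic) (m_sqfree : squarefree m) (size_m : size m = M.+1)
  (M_ge3 : (3 <= M)%N) (p_inj : injective p)
  (p_irr : forall i, p i \is monic /\ irreducible_poly (p i)) (m_prod : m = \prod_(i < r) p i)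
  (Lm : L_factors m theta) (gsh : GSH theta).
Variables (beta omega : 'I_(Mprime M) -> R) (K : R).
Notation q := (#|F|%:R : R).
Notation C := (Cm p theta).
Notation E := (e_even theta).
Notation O := (e_odd theta).
Hypothesis expansion : b_expansion m C theta beta omega K.

Let indep : int_independent theta := GSH_int gsh.
Let q_gt1 : 1 < q := card_field_gt1 R F.
Let d_gt0 : (0 < Mprime M)%N := Mprime_gt0 M_ge3.

Lemma Cm_gt0 : 0 < C.
Proof.
rewrite CmE divr_gt0 ?(euler_constant_gt0 R p_irr) // mulr_gt0 ?exprn_gt0 // prodr_gt0 // => j _.
by rewrite exprn_even_gt0 //= (sin_theta_neq0 indep).
Qed.

Lemma e_evenDodd_gt0 : 0 < E + O.
Proof.
rewrite e_evenDodd prodr_gt0 // => j _; have /andP[] := cos_theta_lt1 indep j; lra.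
Qed.

Lemma beta_neq0 j : beta j != 0.
Proof.
exact: (amplitude_neq0 m_monic m_sqfree size_m M_ge3 p_inj p_irr m_prod Lm gsh j expansion).
Qed.

Lemma beta'_neq0 j : beta' q theta beta j != 0.
Proof. by rewrite mulf_neq0 ?beta_neq0 // invr_neq0 // (sin_telescope (theta j) q_gt1).1. Qed.

Let Kp := if odd M then 0 else K.

Lemma b_lambda_expansion n : (2 * M <= n)%N -> (b_lambda n m)%:~R =
  Num.sqrt q ^+ n * (main_coef q (~~ odd M) C E O n
                     + \sum_j beta j * sin (n%:R * theta j + omega j)) + Kp.
Proof. by move=> /expansion ->; rewrite alpha_main_coef. Qed.

Lemma density_nc_cvg : density_seq_nc R m @ \oo -->
  1 / 2 + 1 / 2 * haar_between beta (- main_coef q (~~ odd M) C E O true)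
                                    (main_coef q (~~ odd M) C E O false).
Proof.
rewrite /density_seq_nc; under eq_fun do rewrite (a_minus_lt_a_plus R).
apply: (sign_density (omega := omega) (theta := theta) (K := 0) (c := Kp) (N0 := (2 * M)%N)
  indep d_gt0 beta_neq0 q_gt1 (a := main_coef q (~~ odd M) C E O)).
  exact: main_coef_gt0 Cm_gt0 e_evenDodd_gt0.
move=> n /b_lambda_expansion ->; rewrite mul0r add0r /main_coef.
by case: (odd n).
Qed.

Lemma density_cvg : density_seq R m @ \oo -->
  1 / 2 + 1 / 2 * haar_between (beta' q theta beta) (- total_coef q (~~ odd M) C E O true)
                               (total_coef q (~~ odd M) C E O false).
Proof.
rewrite /density_seq; under eq_fun do rewrite (A_minus_lt_A_plus R).
have [omega' [c B]] := B_lambda_expansion q_gt1 b_lambda_expansion.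
apply: (sign_density (omega := omega') (theta := theta) (K := Kp) (c := c) (N0 := (2 * M)%N)
  indep d_gt0 beta'_neq0 q_gt1 (a := total_coef q (~~ odd M) C E O)).
  exact: total_coef_gt0 Cm_gt0 e_evenDodd_gt0.
move=> n /B ->; rewrite /total_coef /main_coef.
by case: (odd n).
Qed.

(** [E + O] and [E - O] are products of the positive numbers [1 + cos (theta j)] and
    [1 - cos (theta j)]. *)
Lemma e_odd_lt_e_even : `|O| < E.
Proof.
have h1 := e_evenDodd_gt0; have : 0 < E - O.
  rewrite e_evenBodd prodr_gt0 // => j _; have /andP[] := cos_theta_lt1 indep j; lra.
by move=> h2; rewrite ltr_norml; apply/andP; split; lra.
Qed.

(** The upper bound is positive because [E] is. The lower one may be positive too, when [O] is
    negative, and there the amplitude bound is essential. *)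
Lemma haar_between_nc_gt0 : odd M -> 0 < haar_between beta (- (C * O)) (C * E).
Proof.
move=> oM; have /andP[E1 E2] : - E < O < E by rewrite -ltr_norml e_odd_lt_e_even.
have C0 := Cm_gt0.
apply: haar_between_gt0.
- by rewrite -mulrN ltr_pM2l //; lra.
- by exists (Ordinal d_gt0); exact: beta_neq0.
- exact: (sum_amplitudes_gt m_monic m_sqfree size_m M_ge3 p_inj p_irr m_prod Lm gsh oM expansion).
- apply: (@le_lt_trans _ _ 0); first by rewrite oppr_le0 sumr_ge0.
  by rewrite mulr_gt0 //; lra.
Qed.

Lemma haar_between_total_gt0 : odd M ->
  0 < haar_between (beta' q theta beta)
        (- (C * ((Num.sqrt q * E + q * O) / (q - 1))))
        (C * ((q * E + Num.sqrt q * O) / (q - 1))).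
Proof.
move=> oM; have /andP[E1 E2] : - E < O < E by rewrite -ltr_norml e_odd_lt_e_even.
have C0 := Cm_gt0; have s1 := sq_gt1 q_gt1; have s2 := sq2 q_gt1.
have q1 : 0 < q - 1 by rewrite subr_gt0.
(* Together with [- E < O] this makes the upper bound positive. *)
have sq : Num.sqrt q < q by rewrite -[ltRHS]s2; nra.
apply: haar_between_gt0.
- rewrite -subr_gt0 opprK; have := total_coef_gt0 false q_gt1 C0 e_evenDodd_gt0.
  by rewrite /total_coef /main_coef /=.
- by exists (Ordinal d_gt0); exact: beta'_neq0.
- exact: (sum_amplitudes'_gt m_monic m_sqfree size_m M_ge3 p_inj p_irr m_prod Lm gsh oM expansion).
- apply: (@le_lt_trans _ _ 0); first by rewrite oppr_le0 sumr_ge0.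
  rewrite mulr_gt0 // divr_gt0 //; nra.
Qed.

End Densities.

Unset Implicit Arguments.

Theorem corollary4p5 (R : realType) (F : finFieldType) (m : {poly F}) (M r : nat)
    (p : 'I_r -> {poly F}) (theta : 'I_(Mprime M) -> R) :
  odd #|F| ->
  m \is monic -> squarefree m -> size m = M.+1 -> (3 <= M)%N ->
  injective p ->
  (forall i, p i \is monic /\ irreducible_poly (p i)) ->
  m = \prod_(i < r) p i ->
  L_factors m theta -> GSH theta ->
  let q : R := #|F|%:R in
  let C : R := Cm p theta in
  let E : R := e_even theta in
  let O : R := e_odd theta in
  (exists (beta omega : 'I_(Mprime M) -> R) (K : R),
      b_expansion m C theta beta omega K) /\
  forall (beta omega : 'I_(Mprime M) -> R) (K : R),
    b_expansion m C theta beta omega K ->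
    [/\ cvgn (density_seq_nc R m),
        cvgn (density_seq R m),
        odd M ->
        [/\ delta_plus_nc R m =
              1 / 2 + 1 / 2 * haar_between beta (- (C * O)) (C * E),
            delta_plus R m =
              1 / 2 + 1 / 2 *
                haar_between (beta' q theta beta)
                  (- (C * ((Num.sqrt q * E + q * O) / (q - 1))))
                  (C * ((q * E + Num.sqrt q * O) / (q - 1))),
            1 / 2 < delta_plus_nc R m &
            1 / 2 < delta_plus R m]
      & ~~ odd M ->
        delta_plus_nc R m =
          1 / 2 + 1 / 2 *
            haar_between beta
              (- (C * ((Num.sqrt q * E + q * O) / (q - 1))))
              (C * ((q * E + Num.sqrt q * O) / (q - 1))) /\
        delta_plus R m =
          1 / 2 + 1 / 2 *
            haar_between (beta' q theta beta)
              (- (C * ((2 * Num.sqrt q ^+ 3 * E + (q ^+ 2 + q) * O)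
                       / (q - 1) ^+ 2)))
              (C * (((q ^+ 2 + q) * E + 2 * Num.sqrt q ^+ 3 * O)
                    / (q - 1) ^+ 2))].
Proof.
move=> _ m_monic m_sqfree size_m M_ge3 p_inj p_irr m_prod Lm gsh q C E O.
split; first exact: exists_expansion m_monic m_sqfree size_m M_ge3 p_inj p_irr m_prod Lm gsh.
move=> beta omega K expansion.
have nc := density_nc_cvg m_monic m_sqfree size_m M_ge3 p_inj p_irr m_prod Lm gsh expansion.
have tot := density_cvg m_monic m_sqfree size_m M_ge3 p_inj p_irr m_prod Lm gsh expansion.
have ncE := cvg_lim (@Rhausdorff R) nc; have totE := cvg_lim (@Rhausdorff R) tot.
split; [exact: cvgP nc | exact: cvgP tot | |].
  move=> oM; move: ncE totE; rewrite oM /= => ncE totE.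
  have h1 := haar_between_nc_gt0 m_monic m_sqfree size_m M_ge3 p_inj p_irr m_prod Lm gsh expansion oM.
  have h2 := haar_between_total_gt0 m_monic m_sqfree size_m M_ge3 p_inj p_irr m_prod Lm gsh expansion oM.
  rewrite /delta_plus_nc /delta_plus ncE totE; split=> //.
    by move: h1; rewrite /main_coef /=; lra.
  by move: h2; rewrite /total_coef /main_coef /=; lra.
by move=> eM; move: ncE totE; rewrite eM /= => ncE totE; rewrite /delta_plus_nc /delta_plus ncE totE.
Qed.
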